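(* For $\sigma>0$ let $\varphi_G(t,\sigma)=\exp\left(-\frac{t^2}{2\sigma^2}\right)$ and $\varphi_L(t,\sigma)=\frac{\sigma^2}{\sigma^2+t^2}$, $t\in\mathbb{R}$, and let $\widetilde{\varphi}_G(t,\sigma)$ and $\widetilde{\varphi}_L(t,\sigma)$ be the basic nod functions of the systems of integer shifts of $\varphi_G(\cdot,\sigma)$ and $\varphi_L(\cdot,\sigma)$, respectively. Let $\widetilde{A}_G(\sigma),\widetilde{B}_G(\sigma)$ be the lower and upper Riesz constants of the system $\{\widetilde{\varphi}_G(\cdot-k,\sigma)\}_{k\in\mathbb{Z}}$ and $\widetilde{A}_L(\sigma),\widetilde{B}_L(\sigma)$ those of the system $\{\widetilde{\varphi}_L(\cdot-k,\sigma)\}_{k\in\mathbb{Z}}$. Then $$\lim_{\sigma\to\infty}\widetilde{A}_G(\sigma)=\lim_{\sigma\to\infty}\widetilde{A}_L(\sigma)=\frac12,\qquad \lim_{\sigma\to\infty}\widetilde{B}_G(\sigma)=\lim_{\sigma\to\infty}\widetilde{B}_L(\sigma)=1.$$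
   Context: A family of functions $\varphi_k\in L_2(\mathbb{R})$, $k\in\mathbb{Z}$, is called a Riesz system if there exist constants $A,B>0$ such that for every sequence $c=(c_k)_{k\in\mathbb{Z}}\in \ell_2$ $$A\|c\|_{\ell_2}^2\le\Big\|\sum_{k=-\infty}^{\infty}c_k\varphi_k\Big\|_{L_2(\mathbb{R})}^2\le B\|c\|_{\ell_2}^2.$$ The largest admissible $A$ is called the lower Riesz constant and the smallest admissible $B$ the upper Riesz constant. Given a function $\varphi$ on $\mathbb{R}$, the basic nod function (fundamental interpolating function) of the system of its integer shifts is the function $$\widetilde{\varphi}(t)=\sum_{k=-\infty}^{\infty}d_k\,\varphi(t-k),\qquad (d_k)_{k\in\mathbb{Z}}\in\ell_2,$$ satisfying $\widetilde{\varphi}(m)=\delta_{0m}$ for all $m\in\mathbb{Z}$, where $\delta_{0m}$ is the Kronecker symbol. Equivalently, the $d_k$ are the coefficients of the Fourier series $D(t)=\sum_k d_k e^{-ikt}$ with $D(t)\Phi(t)=1$, where $\Phi(t)=\sum_{k}\varphi(k)e^{-ikt}$. *)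

(* Defs.v *)
From HB Require Import structures.
From mathcomp Require Import all_boot all_order all_algebra.
From mathcomp Require Import all_classical all_reals all_analysis.
From mathcomp Require Import complex.

Set Implicit Arguments.
Unset Strict Implicit.
Unset Printing Implicit Defensive.

Import Order.TTheory GRing.Theory Num.Theory.
Import numFieldNormedType.Exports.

Local Open Scope classical_set_scope.
Local Open Scope complex_scope.
Local Open Scope ring_scope.

(* Scalars, coefficient sequences and functions are complex-valued. For
   z : R[i] the library norm `|z| again lives in R[i]; modulus z : R. *)
Definition modulus (R : realType) (z : R[i]) : R := ComplexField.Normc.normc z.

(* The bilateral series of u is the limit of the partial sums over
   -n <= k <= n. *)
Definition bilateral_psum (V : zmodType) (u : int -> V) (n : nat) : V :=
  \sum_(i < n.*2.+1) u (i%:Z - n%:Z).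

Definition ell2 (R : realType) (c : int -> R[i]) : Prop :=
  summable [set: int] (fun k => (modulus (c k) ^+ 2)%:E).

Definition ell2_norm_sq (R : realType) (c : int -> R[i]) : \bar R :=
  \esum_(k in [set: int]) (modulus (c k) ^+ 2)%:E.

Definition L2 (R : realType) (f : R -> R[i]) : Prop :=
  (fun t => complex.Re (f t)) \in Lfun (@lebesgue_measure R) 2%:E /\
  (fun t => complex.Im (f t)) \in Lfun (@lebesgue_measure R) 2%:E.

Definition L2norm (R : realType) (f : R -> R[i]) : \bar R :=
  Lnorm (@lebesgue_measure R) 2%:E (fun t => (modulus (f t))%:E).

Definition is_L2_sum (R : realType) (u : int -> R -> R[i]) (f : R -> R[i]) :
    Prop :=
  L2 f /\
  L2norm (fun t => bilateral_psum (fun k => u k t) n - f t)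
    @[n --> \oo] --> 0%E.

(* f is the sum of the series c_k phi_k; it is determined by c up to a null
   set, so its norm does not depend on the witness. *)
Definition riesz_bounds (R : realType) (phi : int -> R -> R[i]) (A B : R) :
    Prop :=
  [/\ 0 < A, 0 < B, forall k, L2 (phi k) &
      forall c : int -> R[i], ell2 c ->
      exists2 f : R -> R[i], is_L2_sum (fun k t => c k * phi k t) f &
        (A%:E * ell2_norm_sq c <= L2norm f ^+ 2 /\
         L2norm f ^+ 2 <= B%:E * ell2_norm_sq c)%E].

Definition riesz_system (R : realType) (phi : int -> R -> R[i]) : Prop :=
  exists A B : R, riesz_bounds phi A B.

(* The greatest admissible A and the least admissible B, with default value 0
   when phi is not a Riesz system. *)
Definition lower_riesz_constant (R : realType) (phi : int -> R -> R[i]) : R :=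
  let S := [set A | exists B, riesz_bounds phi A B] in
  xget 0 (S `&` ubound S).

Definition upper_riesz_constant (R : realType) (phi : int -> R -> R[i]) : R :=
  let S := [set B | exists A, riesz_bounds phi A B] in
  xget 0 (S `&` lbound S).

Definition integer_shifts (R : realType) (f : R -> R[i]) (k : int) (t : R) :
  R[i] := f (t - k%:~R).

(* The series is understood pointwise, at every t. *)
Definition is_nod_function (R : realType) (phi f : R -> R[i]) : Prop :=
  (exists2 d : int -> R[i], ell2 d &
     forall t : R,
       modulus (bilateral_psum (fun k => d k * integer_shifts phi k t) n - f t)
         @[n --> \oo] --> (0 : R)) /\
  (forall m : int, f m%:~R = (m == 0)%:R).

(* The default value 0 is used only when phi has no nod function; the zero
   function is not itself a nod function and its shifts are not a Riesz
   system. *)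
Definition nod_function (R : realType) (phi : R -> R[i]) : R -> R[i] :=
  xget (fun=> 0) (is_nod_function phi).

Definition phi_G (R : realType) (sigma t : R) : R[i] :=
  (expR (- (t ^+ 2 / (2 * sigma ^+ 2))))%:C.

Definition phi_L (R : realType) (sigma t : R) : R[i] :=
  (sigma ^+ 2 / (sigma ^+ 2 + t ^+ 2))%:C.

Definition A_G (R : realType) (sigma : R) : R :=
  lower_riesz_constant (integer_shifts (nod_function (phi_G sigma))).

Definition B_G (R : realType) (sigma : R) : R :=
  upper_riesz_constant (integer_shifts (nod_function (phi_G sigma))).

Definition A_L (R : realType) (sigma : R) : R :=
  lower_riesz_constant (integer_shifts (nod_function (phi_L sigma))).

Definition B_L (R : realType) (sigma : R) : R :=
  upper_riesz_constant (integer_shifts (nod_function (phi_L sigma))).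

(* Main.v *)
Require Import Defs.
From HB Require Import structures.
From mathcomp Require Import all_boot all_order all_algebra.
From mathcomp Require Import all_classical all_reals all_analysis.
From mathcomp Require Import measurable_realfun complex.
From mathcomp Require Import ring lra zify.
Import Order.TTheory GRing.Theory Num.Theory.
Import numFieldNormedType.Exports.
Local Open Scope classical_set_scope.
Local Open Scope ring_scope.

Set Implicit Arguments.
Unset Strict Implicit.
Unset Printing Implicit Defensive.

(** The limits come from exact values of the lower Riesz constants, and from
bounds on the upper ones, that hold for every sigma > 0.

For an even kernel phi put p k = phi k and let g k be the Gram coefficients,
<phi(. - k), phi(. - l)> = g (k - l); let P and G be the trigonometric symbols
of p and g. The nod function is sum_l d_l phi(. - l) with P D = 1, so that
sum_k c_k nod(. - k) = sum_l b_l phi(. - l) whenever c is the convolution of p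
and b. The squared norm of this function is the Toeplitz form of g at b, and
the squared norm of c is the Toeplitz form of the autocorrelation of p at b.
Hence the Riesz constants are the extrema of G / P^2, and they can be studied
without any Fourier transform by comparing the two forms on finitely supported
sequences (riesz_bounds_dual, riesz_bounds_Form). Long windows of b = 1 and of
b = (-1)^k evaluate the quotient at 0 and at pi (Form1_bounded_zsum_le0). This
gives lower_nod_constant and upper_nod_constant, which need only that the form
of p is bounded below by a positive multiple of the norm: convolution by p is
then a bijection of l2 (zconv_inj, zconv_surj).

In both families an identity ties P^2 to G.
- Gaussian: with q = exp (- 1 / (4 sigma^2)) and E(x) = sum_k q^(k^2) cos (k x),
  one has G = sigma sqrt(pi) E and P(x)^2 = (E(0) E(x) + E(pi) E(x + pi)) / 2
  (zconv_gseq). Since E is smallest at pi and largest at 0, the quotient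
  G / P^2 lies between I / E(0), attained at pi, and 2 I / E(0), where
  I = sigma sqrt(pi).
- Lorentz: decomposing p (n - l) * p l into partial fractions gives
  G = T P^2 - kappa with T = pi sigma / P(0) and 2 kappa = T P(pi)^2
  (zconv_lor). Since P is smallest at pi, G / P^2 lies between T / 2, attained
  at pi, and T.

That the symbols are smallest at pi is itself proved as a comparison of forms.
For theta functions the bound is elementary when q <= 1/8, and the identity
above carries it from q^2 to q (coercive_gseq). For the Lorentz samples
P(x) = pi sigma cosh (sigma (pi - x)) / sinh (sigma pi), and it is enough to
integrate nonnegative weights against the squared modulus of a trigonometric
polynomial (Form_weight_ge0, lor_coercive, lor_symbol_pi).

Finally E(0) and P(0) are unit-step sums of unimodal functions with maximum 1,
so they are within 1 of the corresponding integrals 2 I and pi sigma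
(sum_vs_integral). The lower constants therefore tend to 1/2; the upper ones
are at most 2 I / E(0), resp. T, which tends to 1, and at least G(0) / P(0)^2,
which tends to 1 as well. *)

(** * Bilateral sums *)

Section Sums.
Context {R : realType}.
Implicit Types (u v w : int -> R) (N n : nat) (k : int) (c C s : R).

Definition psum u N : R := bilateral_psum u N.

Lemma psumE u N : psum u N = \sum_(i < N.*2.+1) u (i%:Z - N%:Z).
Proof. by []. Qed.

Lemma psum0 u : psum u 0 = u 0.
Proof. by rewrite psumE big_ord_recl big_ord0 addr0; congr u; lia. Qed.

Lemma psumS u N : psum u N.+1 = psum u N + u (Posz N.+1) + u (- Posz N.+1).
Proof.
rewrite !psumE doubleS big_ord_recl big_ord_recr /=.
rewrite -addrA [LHS]addrC -!addrA; congr (_ + _).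
  by apply: eq_bigr => i _; congr u; rewrite /bump /=; lia.
by congr (_ + _); congr u; rewrite /bump /= ; lia.
Qed.

Lemma eq_psum u v N : (forall k : int, u k = v k) -> psum u N = psum v N.
Proof. by move=> uv; apply: eq_bigr => i _; rewrite uv. Qed.

Lemma psumD u v N : psum (fun k => u k + v k) N = psum u N + psum v N.
Proof. exact: big_split. Qed.

Lemma psumN u N : psum (fun k => - u k) N = - psum u N.
Proof. by rewrite psumE sumrN. Qed.

Lemma psumB u v N : psum (fun k => u k - v k) N = psum u N - psum v N.
Proof. by rewrite psumD psumN. Qed.

Lemma psumZ c u N : psum (fun k => c * u k) N = c * psum u N.
Proof. by rewrite !psumE mulr_sumr. Qed.

Lemma psumZr c u N : psum (fun k => u k * c) N = psum u N * c.
Proof. by rewrite !psumE mulr_suml. Qed.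

Lemma ler_psum_in u v N :
  (forall k : int, (absz k <= N)%N -> u k <= v k) -> psum u N <= psum v N.
Proof. by move=> uv; apply: ler_sum => i _; apply: uv; have := ltn_ord i; lia. Qed.

Lemma ler_psum u v N : (forall k : int, u k <= v k) -> psum u N <= psum v N.
Proof. by move=> uv; apply: ler_psum_in. Qed.

Lemma psum_ge0 u N : (forall k : int, 0 <= u k) -> 0 <= psum u N.
Proof. by move=> u0; apply: sumr_ge0. Qed.

Lemma psum_norm u N : `|psum u N| <= psum (fun k => `|u k|) N.
Proof. exact: ler_norm_sum. Qed.

Lemma eq_psum_in u v N :
  (forall k : int, (absz k <= N)%N -> u k = v k) -> psum u N = psum v N.
Proof. by move=> uv; apply: eq_bigr => i _; apply: uv; have := ltn_ord i; lia. Qed.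

Lemma psum_opp u N : psum (fun k => u (- k)) N = psum u N.
Proof. by elim: N => [|N IH]; rewrite ?psum0 ?oppr0// !psumS IH opprK addrAC. Qed.

Lemma psum_nd u N K : (forall k : int, 0 <= u k) -> (N <= K)%N ->
  psum u N <= psum u K.
Proof.
move=> u0; elim: K => [|K IH]; first by rewrite leqn0 => /eqP ->.
rewrite leq_eqVlt => /predU1P[->//|]; rewrite ltnS => /IH /le_trans; apply.
by rewrite psumS -addrA lerDl addr_ge0.
Qed.

Lemma psum_term u N (k : int) : (forall k : int, 0 <= u k) -> (absz k <= N)%N ->
  u k <= psum u N.
Proof.
move=> u0; elim: N k => [|N IH] k kN; first by rewrite psum0; have -> : k = 0 by lia.
rewrite psumS; have [/IH kN'|kN'] := leqP (absz k) N.
  by rewrite -addrA (le_trans kN')// lerDl addr_ge0.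
have : k = (Posz N.+1) \/ k = - (Posz N.+1) by lia.
move=> [->|->]; last by rewrite lerDr addr_ge0// psum_ge0.
by rewrite addrAC lerDr addr_ge0// psum_ge0.
Qed.

(** Absolute summability, as a bound on the symmetric partial sums. *)
Definition asum u := exists C, forall N, psum (fun k => `|u k|) N <= C.

Definition zsum u : R := limn (psum u).

Lemma ge0_psum_cvg u C : (forall k : int, 0 <= u k) ->
  (forall N, psum u N <= C) -> psum u n @[n --> \oo] --> zsum u.
Proof.
move=> u0 uC; apply: nondecreasing_is_cvgn; last by exists C => _ [n _ <-].
by move=> m n mn; exact: psum_nd.
Qed.

(** u is the difference of the nonnegative families |u| + u and |u|, whose partial
sums are monotone and bounded. *)
Lemma asum_cvg u : asum u -> psum u n @[n --> \oo] --> zsum u.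
Proof.
move=> [C uC].
have cv1 : cvgn (psum (fun k => `|u k|)) by apply/cvgP/(ge0_psum_cvg _ uC) => k.
have cv2 : cvgn (psum (fun k => `|u k| + u k)).
  apply/cvgP/(@ge0_psum_cvg _ (C + C)).
    by move=> k; have := ler_norm (- u k); rewrite normrN; lra.
  move=> N; rewrite psumD; apply: lerD => //.
  by apply: le_trans (ler_norm _) _; exact: le_trans (psum_norm _ _) _.
rewrite /zsum.
have -> : psum u = (fun n => psum (fun k => `|u k| + u k) n - psum (fun k => `|u k|) n).
  by apply/funext => n; rewrite psumD addrAC subrr add0r.
exact: is_cvgB.
Qed.

Lemma zsum_eq u s : psum u n @[n --> \oo] --> s -> zsum u = s.
Proof. by move=> us; apply: cvg_lim. Qed.

Lemma eq_zsum u v : (forall k : int, u k = v k) -> zsum u = zsum v.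
Proof. by move=> uv; congr zsum; apply/funext. Qed.

Lemma asum_abs u : asum u -> asum (fun k => `|u k|).
Proof. by move=> [C uC]; exists C => N; under eq_psum do rewrite normr_id. Qed.

Lemma asum_le u v : (forall k : int, `|u k| <= v k) -> asum v -> asum u.
Proof.
move=> uv [C vC]; exists C => N; apply: le_trans (vC N); apply: ler_psum => k.
exact: le_trans (uv k) (ler_norm _).
Qed.

Lemma asumD u v : asum u -> asum v -> asum (fun k => u k + v k).
Proof.
move=> [C uC] [D vD]; exists (C + D) => N.
apply: le_trans (lerD (uC N) (vD N)); rewrite -psumD.
by apply: ler_psum => k; exact: ler_normD.
Qed.

Lemma asumZ c u : asum u -> asum (fun k => c * u k).
Proof.
move=> [C uC]; exists (`|c| * C) => N.
under eq_psum do rewrite normrM.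
by rewrite psumZ ler_wpM2l.
Qed.

Lemma asumN u : asum u -> asum (fun k => - u k).
Proof. by move=> [C uC]; exists C => N; under eq_psum do rewrite normrN. Qed.

Lemma asumB u v : asum u -> asum v -> asum (fun k => u k - v k).
Proof. by move=> au av; apply: asumD => //; exact: asumN. Qed.

Lemma asumM u v C : (forall k : int, `|u k| <= C) -> asum v ->
  asum (fun k => u k * v k).
Proof.
move=> uC /asum_abs/(asumZ C); apply: asum_le => k.
by rewrite normrM ler_wpM2r.
Qed.

Lemma asum_opp u : asum u -> asum (fun k => u (- k)).
Proof. by move=> [C uC]; exists C => N; rewrite (psum_opp (fun k => `|u k|)). Qed.

Lemma zsumD u v : asum u -> asum v ->
  zsum (fun k => u k + v k) = zsum u + zsum v.
Proof.
move=> au av; apply: zsum_eq; under eq_fun do rewrite psumD.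
by apply: cvgD; exact: asum_cvg.
Qed.

Lemma zsumZ c u : asum u -> zsum (fun k => c * u k) = c * zsum u.
Proof.
move=> au; apply: zsum_eq; under eq_fun do rewrite psumZ.
by apply: cvgMl_tmp; exact: asum_cvg.
Qed.

Lemma zsumN u : asum u -> zsum (fun k => - u k) = - zsum u.
Proof.
move=> au; apply: zsum_eq; under eq_fun do rewrite psumN.
by apply: cvgN; exact: asum_cvg.
Qed.

Lemma zsumB u v : asum u -> asum v ->
  zsum (fun k => u k - v k) = zsum u - zsum v.
Proof. by move=> au av; rewrite zsumD ?zsumN//; exact: asumN. Qed.

Lemma zsum_opp u : asum u -> zsum (fun k => u (- k)) = zsum u.
Proof.
by move=> au; apply: zsum_eq; under eq_fun do rewrite psum_opp; exact: asum_cvg.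
Qed.

Lemma ge0_psum_le u N : (forall k : int, 0 <= u k) -> asum u ->
  psum u N <= zsum u.
Proof.
move=> u0 au; apply: nondecreasing_cvgn_le; last by apply/cvgP/asum_cvg.
by move=> m n mn; exact: psum_nd.
Qed.

Lemma zsum_le u C : asum u -> (forall N, psum u N <= C) -> zsum u <= C.
Proof.
move=> au uC; apply: limr_le; first by apply/cvgP/asum_cvg.
exact: nearW.
Qed.

Lemma ler_zsum u v : (forall k : int, u k <= v k) -> asum u -> asum v ->
  zsum u <= zsum v.
Proof.
move=> uv au av; apply: ler_lim; [exact/cvgP/asum_cvg..|].
by apply: nearW => N; exact: ler_psum.
Qed.

Lemma zsum_ge0 u : (forall k : int, 0 <= u k) -> asum u -> 0 <= zsum u.
Proof. by move=> u0 au; apply: le_trans (ge0_psum_le 0 u0 au); exact: psum_ge0. Qed.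

Lemma zsum_norm u : asum u -> `|zsum u| <= zsum (fun k => `|u k|).
Proof.
move=> au; have aa := asum_abs au; rewrite ler_norml; apply/andP; split.
  rewrite -zsumN//; apply: ler_zsum => //; last exact: asumN.
  by move=> k; rewrite lerNl -normrN ler_norm.
by apply: ler_zsum => // k; exact: ler_norm.
Qed.

Lemma asum_cvg0 u : asum u ->
  (u n%:Z @[n --> \oo] --> (0 : R)) /\ (u (- n%:Z) @[n --> \oo] --> (0 : R)).
Proof.
move=> au; have /asum_cvg cu := asum_abs au.
have cS := cu; rewrite -cvg_shiftS in cS.
have c0 : (psum (fun k => `|u k|) n.+1 - psum (fun k => `|u k|) n) @[n --> \oo] --> (0:R).
  by rewrite -(subrr (zsum (fun k => `|u k|))); exact: cvgB.
have bound (f : nat -> R) : (forall n, `|f n.+1| <= `|u (Posz n.+1)| + `|u (- Posz n.+1)|) ->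
    f n @[n --> \oo] --> (0 : R).
  move=> fb; rewrite -cvg_shiftS; apply/norm_cvg0P.
  apply: squeeze_cvgr c0; last exact: (cvg_cst 0).
  by apply: nearW => n; rewrite normr_ge0/= psumS; have := fb n; lra.
by split; apply: bound => n; rewrite ?lerDl ?lerDr.
Qed.
End Sums.

(** * Shifts and convolutions of summable families *)

Section Convolution.
Context {R : realType}.
Implicit Types (u v w : int -> R) (N n : nat) (k : int) (c C s : R).

(** A shift by k changes a symmetric partial sum by boundary terms only; vanishing at
both ends is what makes it harmless, even when u is not absolutely summable. *)
Definition vanishing u :=
  (u n%:Z @[n --> \oo] --> (0 : R)) /\ (u (- n%:Z) @[n --> \oo] --> (0 : R)).

Lemma psum_shift1 u N :
  psum (fun k => u (k + 1)) N = psum u N + u (Posz N.+1) - u (- N%:Z).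
Proof.
elim: N => [|N IH]; first by rewrite !psum0 add0r oppr0 addrAC subrr add0r.
rewrite !psumS IH.
have -> : Posz N.+1 + 1 = Posz N.+2 by lia.
have -> : - Posz N.+1 + 1 = - N%:Z by lia.
ring.
Qed.


Lemma eq_cvgn (f g : nat -> R) s : (forall n, f n = g n) ->
  f n @[n --> \oo] --> s -> g n @[n --> \oo] --> s.
Proof. by move=> fg; have -> : f = g by apply/funext. Qed.

Lemma ler_cvgn (f g : nat -> R) s t : f n @[n --> \oo] --> s ->
  g n @[n --> \oo] --> t -> (\forall n \near \oo, f n <= g n) -> s <= t.
Proof. exact: ler_cvg_to. Qed.

Lemma psum_shift_cvg_nat (m : nat) u s : psum u n @[n --> \oo] --> s ->
  vanishing u -> psum (fun k => u (k + m%:Z)) n @[n --> \oo] --> s.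
Proof.
elim: m u => [|m IH] u us uu.
  by apply: eq_cvgn us => n; apply: eq_psum => k; rewrite addr0.
have [u1 u2] := uu.
apply: (eq_cvgn _ (IH (fun k => u (k + 1)) _ _)).
- by move=> n; apply: eq_psum => k; congr u; lia.
- apply: (@eq_cvgn (fun n => psum u n + u (Posz n.+1) - u (- n%:Z))).
    by move=> n; rewrite psum_shift1.
  rewrite -[s]addr0 -[s + 0]subr0; apply: cvgB => //; apply: cvgD => //.
  by move: u1; rewrite -cvg_shiftS.
- split.
    move: u1; rewrite -cvg_shiftS; apply: eq_cvgn => n /=.
    by congr u; lia.
  rewrite -cvg_shiftS; apply: eq_cvgn u2 => n /=.
  by congr u; lia.
Qed.

Lemma psum_shift_cvg k u s : psum u n @[n --> \oo] --> s ->
  vanishing u -> psum (fun l => u (l + k)) n @[n --> \oo] --> s.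
Proof.
move=> us [u1 u2]; case: (intP k) => [|m|m].
- exact: (psum_shift_cvg_nat 0).
- exact: (psum_shift_cvg_nat m.+1).
- apply: (@eq_cvgn (psum (fun l => u (- (l + Posz m.+1))))).
    by move=> n; rewrite -psum_opp; apply: eq_psum => l; congr u; lia.
  apply: (@psum_shift_cvg_nat _ (fun l => u (- l))).
    by apply: eq_cvgn us => n; rewrite psum_opp.
  by split => //; apply: eq_cvgn u1 => n; rewrite opprK.
Qed.

Lemma asum_psum_shift k u : asum u ->
  psum (fun l => u (l + k)) n @[n --> \oo] --> zsum u.
Proof.
by move=> au; apply: psum_shift_cvg; [exact: asum_cvg|exact: asum_cvg0].
Qed.

Lemma asum_shift k u : asum u -> asum (fun l => u (l + k)).
Proof.
move=> au; exists (zsum (fun l => `|u l|)) => N.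
have h := asum_psum_shift k (asum_abs au).
rewrite -(zsum_eq h); apply: nondecreasing_cvgn_le; last exact: cvgP h.
by move=> m n mn; apply: psum_nd.
Qed.

Lemma zsum_shift k u : asum u -> zsum (fun l => u (l + k)) = zsum u.
Proof. by move=> au; apply/zsum_eq/asum_psum_shift. Qed.

Lemma asum_rshift k u : asum u -> asum (fun l => u (k - l)).
Proof.
move=> au; have := asum_opp (asum_shift k au).
by under eq_fun do rewrite addrC.
Qed.

Lemma zsum_rshift k u : asum u -> zsum (fun l => u (k - l)) = zsum u.
Proof.
move=> au; rewrite -(zsum_shift k au) -(zsum_opp (asum_shift k au)).
by apply: eq_zsum => l; rewrite addrC.
Qed.

Lemma psum_tail u w N n : (forall k, `|u k| <= w k) -> (N <= n)%N ->
  `|psum u n - psum u N| <= psum w n - psum w N.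
Proof.
move=> uw; elim: n => [|n IH]; first by rewrite leqn0 => /eqP ->; rewrite !subrr normr0.
rewrite leq_eqVlt => /predU1P[->|]; first by rewrite !subrr normr0.
rewrite ltnS => /IH h; rewrite !psumS.
have -> : psum u n + u (Posz n.+1) + u (- Posz n.+1) - psum u N =
  psum u n - psum u N + u (Posz n.+1) + u (- Posz n.+1) by ring.
have := ler_normD (psum u n - psum u N + u (Posz n.+1)) (u (- Posz n.+1)).
have := ler_normD (psum u n - psum u N) (u (Posz n.+1)).
have := uw (Posz n.+1); have := uw (- Posz n.+1).
lra.
Qed.

Lemma zsum_tail u w N : (forall k, `|u k| <= w k) -> asum w ->
  `|zsum u - psum u N| <= zsum w - psum w N.
Proof.
move=> uw aw; have au := asum_le uw aw.
apply: (@ler_cvgn (fun n => `|psum u n - psum u N|)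
  (fun n => psum w n - psum w N)).
- by apply: cvg_norm; apply: (cvgB (asum_cvg au)); exact: cvg_cst.
- by apply: (cvgB (asum_cvg aw)); exact: cvg_cst.
- by near=> n; apply: psum_tail => //; near: n; exact: nbhs_infty_ge.
Unshelve. all: by end_near. Qed.

Lemma psum_cvg (u_ : nat -> int -> R) u N :
  (forall k, u_ n k @[n --> \oo] --> u k) ->
  psum (u_ n) N @[n --> \oo] --> psum u N.
Proof.
move=> uu; elim: N => [|N IH].
  by rewrite psum0; apply: eq_cvgn (uu 0) => n; rewrite psum0.
rewrite psumS; apply: (@eq_cvgn (fun n => psum (u_ n) N + u_ n (Posz N.+1) + u_ n (- Posz N.+1))).
  by move=> n; rewrite psumS.
by apply: cvgD => //; apply: cvgD.
Qed.

(** Dominated convergence for series, with the tails controlled by those of w. *)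
Lemma zsum_dominated (u_ : nat -> int -> R) u w : asum w ->
  (forall n k, `|u_ n k| <= w k) ->
  (forall k, u_ n k @[n --> \oo] --> u k) ->
  zsum (u_ n) @[n --> \oo] --> zsum u.
Proof.
move=> aw uw uu.
have uw' k : `|u k| <= w k.
  apply: (ler_cvgn (cvg_norm (uu k)) (cvg_cst (w k))).
  by apply: nearW => n; exact: uw.
apply/cvgrPdist_lt => e e0.
have e3 : 0 < e / 3 by lra.
have /cvgrPdist_lt/(_ _ e3)[N _ /(_ N (leqnn N)) /= hN] := asum_cvg aw.
have /cvgrPdist_lt/(_ _ e3) h := @psum_cvg u_ u N uu.
near=> n.
have h1 := zsum_tail N uw' aw.
have h2 := zsum_tail N (uw n) aw.
have h3 : `|psum u N - psum (u_ n) N| < e / 3 by near: n.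
have -> : zsum u - zsum (u_ n) = (zsum u - psum u N) + (psum u N - psum (u_ n) N)
   - (zsum (u_ n) - psum (u_ n) N) by ring.
move: h1 h2 h3 hN; rewrite !ltr_norml !ler_norml => /andP[? ?] /andP[? ?] /andP[? ?] /andP[? ?].
by apply/andP; split; lra.
Unshelve. all: by end_near. Qed.

Definition zconv u v k := zsum (fun l => u (k - l) * v l).

Lemma asum_bounded u : asum u -> exists2 C, 0 <= C & forall k, `|u k| <= C.
Proof.
move=> [C uC]; exists C => [|k].
  by apply: le_trans (uC 0%N); apply: psum_ge0.
apply: le_trans (uC (absz k)).
exact: (@psum_term _ (fun k => `|u k|)).
Qed.

Lemma asum_zconvM u v k : asum u -> (exists C, forall k, `|v k| <= C) ->
  asum (fun l => u (k - l) * v l).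
Proof.
move=> au [C vC]; under eq_fun do rewrite mulrC.
by apply: (@asumM _ _ _ C) => //; exact: asum_rshift.
Qed.

Lemma psum_zconv u v N : asum u -> asum v ->
  psum (zconv u v) N = zsum (fun l => psum (fun k => u (k - l)) N * v l).
Proof.
move=> au av; have [C C0 vC] := asum_bounded av.
have a k : asum (fun l => u (k - l) * v l) by apply: asum_zconvM => //; exists C.
have aN n : asum (fun l => psum (fun k => u (k - l) * v l) n).
  elim: n => [|n IH]; first by under eq_fun do rewrite psum0.
  under eq_fun do rewrite psumS.
  by apply: asumD; [apply: asumD|].
rewrite [RHS](_ : _ = zsum (fun l => psum (fun k => u (k - l) * v l) N)); last first.
  by apply: eq_zsum => l; rewrite psumZr.
elim: N => [|N IH].
  by rewrite psum0; apply: eq_zsum => l; rewrite psum0.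
rewrite psumS IH /zconv; under [RHS]eq_zsum do rewrite psumS.
by rewrite !zsumD//; exact: asumD.
Qed.

Lemma asum_zconv u v : asum u -> asum v -> asum (zconv u v).
Proof.
move=> au av; have aau := asum_abs au; have aav := asum_abs av.
have [C C0 vC] := asum_bounded av.
exists (zsum (fun k => `|u k|) * zsum (fun k => `|v k|)) => N.
apply: (@le_trans _ _ (psum (zconv (fun k => `|u k|) (fun k => `|v k|)) N)).
  apply: ler_psum => k; apply: le_trans (zsum_norm _) _.
    by apply: asum_zconvM => //; exists C.
  by rewrite le_eqVlt; apply/orP; left; apply/eqP/eq_zsum => l; rewrite normrM.
rewrite psum_zconv// -zsumZ//; apply: ler_zsum.
- move=> l; apply: ler_wpM2r => //.
  rewrite -(zsum_shift (- l) aau); apply: ge0_psum_le => //.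
  exact: (asum_shift (- l) aau).
- apply: (@asumM _ _ _ (zsum (fun k => `|u k|))) => // l.
  rewrite ger0_norm ?psum_ge0// -(zsum_shift (- l) aau).
  by apply: ge0_psum_le => //; exact: (asum_shift (- l) aau).
- exact: asumZ.
Qed.

(** Cauchy product: the partial sums of the convolution are sums over l of shifted
partial sums of u, and these converge boundedly, so dominated convergence applies. *)
Lemma zsum_zconv u v : asum u -> asum v -> zsum (zconv u v) = zsum u * zsum v.
Proof.
move=> au av; have aau := asum_abs au; have aav := asum_abs av.
apply: zsum_eq.
apply: (@eq_cvgn (fun N => zsum (fun l => psum (fun k => u (k - l)) N * v l))).
  by move=> N; rewrite psum_zconv.
rewrite -zsumZ//.
apply: (@zsum_dominated _ _ (fun l => zsum (fun k => `|u k|) * `|v l|)).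
- exact: asumZ.
- move=> N l; rewrite normrM; apply: ler_wpM2r => //.
  apply: le_trans (psum_norm _ _) _.
  rewrite -(zsum_shift (- l) aau); apply: ge0_psum_le => //.
  exact: (asum_shift (- l) aau).
- by move=> l; apply: cvgMr_tmp; exact: (asum_psum_shift (- l) au).
Qed.

End Convolution.

(** * Toeplitz forms *)

Section Forms.
Context {R : realType}.
Implicit Types (u v w b e : int -> R) (N n : nat) (k l : int) (c C s x : R).

Definition sgn k : R := (-1) ^+ absz k.

Lemma sgnM k l : sgn (k - l) = sgn k * sgn l.
Proof.
rewrite /sgn -exprD -signr_odd -[RHS]signr_odd; congr (_ ^+ nat_of_bool _).
lia.
Qed.

Lemma sgn_sqr k : sgn k * sgn k = 1.
Proof. by rewrite /sgn -exprD addnn -mul2n exprM sqrrN expr1n expr1n. Qed.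

Lemma sgnN k : sgn (- k) = sgn k.
Proof. by rewrite /sgn; congr (_ ^+ _); lia. Qed.

Lemma norm_sgn k : `|sgn k| = 1.
Proof. by rewrite /sgn normrX normrN1 expr1n. Qed.

(** A finite section of the Toeplitz form with symbol sum_k e_k exp (i k x),
evaluated at the coefficients b_k for |k| <= N. *)
Definition Form e b N := psum (fun k => psum (fun l => b k * b l * e (k - l)) N) N.

Lemma eq_Form e e' b N : (forall k, e k = e' k) -> Form e b N = Form e' b N.
Proof. by move=> ee; apply: eq_psum => k; apply: eq_psum => l; rewrite ee. Qed.

Lemma FormD e e' b N : Form (fun k => e k + e' k) b N = Form e b N + Form e' b N.
Proof.
rewrite /Form -psumD; apply: eq_psum => k; rewrite -psumD; apply: eq_psum => l.
by rewrite mulrDr.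
Qed.

Lemma FormZ c e b N : Form (fun k => c * e k) b N = c * Form e b N.
Proof.
rewrite /Form -psumZ; apply: eq_psum => k; rewrite -psumZ; apply: eq_psum => l.
by rewrite mulrCA.
Qed.

Lemma FormB e e' b N : Form (fun k => e k - e' k) b N = Form e b N - Form e' b N.
Proof.
rewrite -[X in _ = _ + X]mulN1r -FormZ -FormD; apply: eq_Form => k.
by rewrite mulN1r.
Qed.

Definition delta k : R := (k == 0)%:R.

Lemma psum_delta u N k : (absz k <= N)%N ->
  psum (fun l => u l * delta (k - l)) N = u k.
Proof.
move=> kN; have h : (absz (k + N%:Z)%R < N.*2.+1)%N by lia.
rewrite psumE (bigD1 (Ordinal h))//= big1 ?addr0.
  have -> : Posz (absz (k + N%:Z)) - N%:Z = k by lia.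
  by rewrite /delta subrr eqxx mulr1.
move=> i /eqP ih; rewrite /delta; case: eqP; rewrite ?mulr0// => H.
by exfalso; apply: ih; apply/val_inj => /=; lia.
Qed.

Lemma Form_delta b N : Form delta b N = psum (fun k => b k ^+ 2) N.
Proof.
apply: eq_psum_in => k kN; under eq_psum do rewrite -mulrA.
by rewrite psumZ psum_delta.
Qed.

(** Evaluating at the alternating sequence translates the symbol by pi. *)
Lemma Form_sgn e N : Form e sgn N = Form (fun k => sgn k * e k) (fun=> 1) N.
Proof.
by apply: eq_psum => k; apply: eq_psum => l; rewrite sgnM !mul1r.
Qed.

Lemma psum_half u M : psum u M = u 0 + \sum_(i < M) (u (Posz i.+1) + u (- Posz i.+1)).
Proof.
elim: M => [|M IH]; first by rewrite psum0 big_ord0 addr0.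
by rewrite psumS IH big_ord_recr/= !addrA.
Qed.

Lemma psum_even u M : (forall k, u (- k) = u k) ->
  psum u M = u 0 + 2 * \sum_(i < M) u (Posz i.+1).
Proof.
move=> ue; rewrite psum_half; congr (_ + _); rewrite mulr_sumr; apply: eq_bigr => i _.
by rewrite ue; ring.
Qed.

(** The new row and column of the window each contribute a partial sum of e, up to
what happens at the corners. *)
Lemma Form1S e N : (forall k, e (- k) = e k) ->
  Form e (fun=> 1) N.+1 = Form e (fun=> 1) N + 2 * psum e N.*2.+1 + 2 * e (Posz N.+1.*2).
Proof.
move=> ev.
pose F N K := psum (fun k => psum (fun l => e (k - l)) K) N.
have FE K : Form e (fun=> 1) K = F K K.
  by apply: eq_psum => k; apply: eq_psum => l; rewrite !mul1r.
rewrite !FE.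
have -> : psum e N.*2.+1 = e 0 + 2 * psum (fun k => e (k + Posz N.+1)) N.
  rewrite psum_even//; congr (_ + _ * _); rewrite psumE; apply: eq_bigr => i _.
  by congr e; lia.
rewrite /F psumS.
under eq_psum do rewrite psumS.
rewrite !psumD !psumS.
have -> : psum (fun k => e (k - Posz N.+1)) N = psum (fun k => e (k + Posz N.+1)) N.
  by rewrite -psum_opp; apply: eq_psum => k; rewrite -ev; congr e; lia.
have -> : psum (fun k => e (k - - Posz N.+1)) N = psum (fun k => e (k + Posz N.+1)) N.
  by apply: eq_psum => k; congr e; lia.
have -> : psum (fun l => e (Posz N.+1 - l)) N = psum (fun k => e (k + Posz N.+1)) N.
  by rewrite -psum_opp; apply: eq_psum => k; congr e; lia.
have -> : psum (fun l => e (- Posz N.+1 - l)) N = psum (fun k => e (k + Posz N.+1)) N.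
  by apply: eq_psum => k; rewrite -ev; congr e; lia.
have -> : Posz N.+1 - Posz N.+1 = 0 by lia.
have -> : - Posz N.+1 - - Posz N.+1 = 0 by lia.
have -> : Posz N.+1 - - Posz N.+1 = Posz N.+1.*2 by lia.
have -> : - Posz N.+1 - Posz N.+1 = - Posz N.+1.*2 by lia.
rewrite ev; ring.
Qed.

(** The form at b = 1 grows like N times the symbol at 0: by Form1S its increments
tend to 2 zsum e, so a positive sum would make it unbounded. *)
Lemma Form1_bounded_zsum_le0 e C : (forall k, e (- k) = e k) -> asum e ->
  (forall N, Form e (fun=> 1) N <= C) -> zsum e <= 0.
Proof.
move=> ev ae FC; rewrite leNgt; apply/negP => s0.
pose h N := 2 * psum e N.*2.+1 + 2 * e (Posz N.+1.*2).
have : h N @[N --> \oo] --> 2 * zsum e.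
  rewrite -[2 * zsum e]addr0 -[X in _ + X](mulr0 2).
  apply: cvgD; apply: cvgMl_tmp.
    apply: (@cvg_comp _ _ _ (fun N => N.*2.+1) (psum e) \oo \oo); last exact: asum_cvg.
    by apply/cvgnyPge => A; near=> n; rewrite (@leq_trans n)//; [near: n; exact: nbhs_infty_ge|lia].
  apply: (@cvg_comp _ _ _ (fun N => N.+1.*2) (fun n => e n%:Z) \oo \oo); last exact: (asum_cvg0 ae).1.
  by apply/cvgnyPge => A; near=> n; rewrite (@leq_trans n)//; [near: n; exact: nbhs_infty_ge|lia].
move=> /cvgrPdist_lt/(_ _ s0)[N0 _ hN].
have step N : (N0 <= N)%N -> Form e (fun=> 1) N + zsum e <= Form e (fun=> 1) N.+1.
  move=> NN; have /= := hN _ NN; rewrite Form1S// -addrA lerD2l -/(h N).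
  by rewrite ltr_norml => /andP[]; lra.
have grow n : Form e (fun=> 1) N0 + n%:R * zsum e <= Form e (fun=> 1) (N0 + n)%N.
  elim: n => [|n IH]; first by rewrite mul0r addr0 addn0.
  rewrite addnS; apply: le_trans (step _ _); last exact: leq_addr.
  by rewrite -natr1 mulrDl mul1r addrA lerD2r.
(* linear growth exceeds the bound C after this many steps *)
pose n := (Num.truncn ((C - Form e (fun=> 1) N0) / zsum e)).+1.
have : (C - Form e (fun=> 1) N0) / zsum e < n%:R by rewrite truncnS_gt.
rewrite ltr_pdivrMr// => hn.
have := le_trans (grow n) (FC _); lra.
Unshelve. all: by end_near. Qed.

(** Antiderivatives take the place of integrals: the trigonometric weights below all
have explicit ones. *)
Lemma ge0_derive_le (F f : R -> R) (a b : R) : a <= b ->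
  (forall x, is_derive x 1 F (f x)) -> (forall x, a <= x <= b -> 0 <= f x) ->
  F a <= F b.
Proof.
move=> ab dF f0.
apply: (@ger0_derive1_le_cc _ F a b) => //; rewrite ?in_itv/= ?lexx ?ab//.
- move=> x; rewrite in_itv/= => /andP[ax xb].
  by have [_] := dF x; rewrite derive1E => ->; rewrite f0// !ltW.
- by apply: derivable_within_continuous => x _; have [] := dF x.
Qed.

Lemma is_derive_psum (F : int -> R -> R) (f : int -> R) N x :
  (forall k, is_derive x 1 (F k) (f k)) ->
  is_derive x 1 (fun y => psum (F ^~ y) N) (psum f N).
Proof.
move=> dF; elim: N => [|N IH].
  rewrite psum0; have -> : (fun y => psum (F ^~ y) 0) = F 0.
    by apply/funext => y; rewrite psum0.
  by [].
rewrite psumS; have -> : (fun y => psum (F ^~ y) N.+1) =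
    ((fun y => psum (F ^~ y) N) \+ F (Posz N.+1)) \+ F (- Posz N.+1).
  by apply/funext => y; rewrite psumS.
by apply: is_deriveD; apply: is_deriveD.
Qed.

Lemma is_deriveMl c (f : R -> R) x d : is_derive x 1 f d ->
  is_derive x 1 (fun y => c * f y) (c * d).
Proof. by move=> df; have := @is_deriveZ _ _ _ f c x 1 d df. Qed.

(** The coefficients W k (2 pi) - W k 0 are the cosine coefficients of the weight w, and
the form is the integral over [0, 2 pi] of w times |sum_k b_k exp (i k x)|^2. *)
Lemma Form_weight_ge0 (w : R -> R) (W : int -> R -> R) b N :
  (forall k x, is_derive x 1 (W k) (w x * cos (k%:~R * x))) ->
  (forall x, 0 <= x <= 2 * pi -> 0 <= w x) ->
  0 <= Form (fun k => W k (2 * pi) - W k 0) b N.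
Proof.
move=> dW w0; rewrite FormB subr_ge0.
pose A x := psum (fun k => b k * cos (k%:~R * x)) N.
pose B x := psum (fun k => b k * sin (k%:~R * x)) N.
apply: (@ge0_derive_le (fun x => Form (W ^~ x) b N) (fun x => w x * (A x ^+ 2 + B x ^+ 2))).
- by rewrite mulr_ge0// pi_ge0.
- move=> x; have -> : w x * (A x ^+ 2 + B x ^+ 2) =
      psum (fun k => psum (fun l => b k * b l * (w x * cos ((k - l)%:~R * x))) N) N.
    rewrite !expr2 {1}/A {1}/B -!psumZr -psumD -psumZ; apply: eq_psum => k.
    rewrite -!psumZ -psumD -psumZ; apply: eq_psum => l.
    rewrite intrB mulrBl cosB; ring.
  apply: (@is_derive_psum (fun k x => psum (fun l => b k * b l * W (k - l) x) N)) => k.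
  apply: (@is_derive_psum (fun l x => b k * b l * W (k - l) x)).
- by move=> x x0; rewrite mulr_ge0 ?w0// addr_ge0// sqr_ge0.
Qed.

End Forms.

(** * Positivity of forms from positivity of symbols *)

Section Symbol.
Context {R : realType}.
Implicit Types (u v w b e K : int -> R) (N L : nat) (k l n : int) (c C s x : R).

Lemma sin_int2pi k : sin (k%:~R * (2 * pi)) = 0 :> R.
Proof.
have nat_case (n : nat) : sin (n%:R * (2 * pi)) = 0 :> R.
  have := periodicn (@sinD2pi R) n 0; rewrite add0r sin0 => <-.
  by congr sin; rewrite -[RHS]mulr_natl -[pi *+ 2]mulr_natl.
case: (intP k) => [|n|n]; first by rewrite mul0r sin0.
  exact: nat_case.
by rewrite mulrNz mulNr sinN nat_case oppr0.
Qed.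

(** The antiderivative of cos (k x), with the degenerate case k = 0 apart. *)
Definition cosint k x : R := if k == 0 then x else sin (k%:~R * x) / k%:~R.

Lemma is_derive_cosint k x : is_derive x 1 (cosint k) (cos (k%:~R * x)).
Proof.
rewrite /cosint; have [->|k0] := eqVneq k 0.
  by rewrite mul0r cos0; exact: is_derive_id.
have h : is_derive x 1 (fun y => k%:~R * y : R) k%:~R.
  by rewrite -[X in is_derive _ _ _ X]mulr1; exact: is_deriveMl.
have -> : (fun y => sin (k%:~R * y) / k%:~R) = (fun y => k%:~R^-1 * (sin \o (fun y => k%:~R * y : R)) y).
  by apply/funext => y; rewrite mulrC.
have -> : cos (k%:~R * x) = k%:~R^-1 * (k%:~R * cos (k%:~R * x)).
  by rewrite mulrA mulVf ?mul1r// intr_eq0.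
by apply: is_deriveMl; rewrite mulrC; apply: is_derive1_comp.
Qed.

Lemma cosint_2pi k : cosint k (2 * pi) - cosint k 0 = 2 * pi * delta k.
Proof.
rewrite /cosint /delta; case: eqVneq => k0; first by rewrite subr0 mulr1.
by rewrite sin_int2pi mulr0 sin0 !mul0r subr0 mulr0.
Qed.

(** The products cos (n x) cos (j x) reduce a trigonometric polynomial weight to the
antiderivatives of cosines. The bound N.*2 <= L makes every index j = k - l
of the window visible to the polynomial. *)
Lemma Form_trigpoly_ge0 K L b N : (forall k, K (- k) = K k) -> (N.*2 <= L)%N ->
  (forall x, 0 <= psum (fun n => K n * cos (n%:~R * x)) L) -> 0 <= Form K b N.
Proof.
move=> ev NL K0.
pose W j x := psum (fun n => K n / 2 * (cosint (j + n) x + cosint (j - n) x)) L.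
have := @Form_weight_ge0 R (fun x => psum (fun n => K n * cos (n%:~R * x)) L) W b N.
have -> : Form (fun k => W k (2 * pi) - W k 0) b N = Form (fun k => 2 * pi * K k) b N.
  rewrite /Form; apply: eq_psum_in => k kN; apply: eq_psum_in => l lN; congr (_ * _).
  rewrite /W -psumB; set j := k - l.
  transitivity (psum (fun n => pi * K n * delta (j - n)) L +
     psum (fun n => pi * K n * delta (- j - n)) L).
    rewrite -psumD; apply: eq_psum => n.
    have -> : delta (- j - n) = delta (j + n) :> R by rewrite /delta; congr (_%:R); lia.
    have := cosint_2pi (j + n); have := cosint_2pi (j - n); move=> h1 h2.
    rewrite -mulrBr opprD addrACA h1 h2; by field.
  rewrite !psum_delta; [|lia..].
  by rewrite ev; ring.
rewrite FormZ pmulr_rge0; last by rewrite mulr_gt0// pi_gt0.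
apply; last by [].
move=> j x; rewrite -psumZr.
apply: (@is_derive_psum _ (fun n y => K n / 2 * (cosint (j + n) y + cosint (j - n) y))) => n.
rewrite (_ : _ * _ * _ = K n / 2 * (cos ((j + n)%:~R * x) + cos ((j - n)%:~R * x))); last first.
  by rewrite intrD intrB mulrDl mulrBl cosD cosB; field.
by apply: is_deriveMl; apply: is_deriveD; exact: is_derive_cosint.
Qed.

(** The truncated symbol is nonnegative up to the tail t L of the series; adding
t L times delta repairs it, and t L tends to 0. *)
Lemma Form_symbol_ge0 K b N : (forall k, K (- k) = K k) -> asum K ->
  (forall x, 0 <= zsum (fun n => K n * cos (n%:~R * x))) -> 0 <= Form K b N.
Proof.
move=> ev aK K0.
have aaK := asum_abs aK.
pose t L := zsum (fun k => `|K k|) - psum (fun k => `|K k|) L.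
have key L : (N.*2 <= L)%N -> 0 <= Form K b N + t L * psum (fun k => b k ^+ 2) N.
  move=> NL; rewrite -Form_delta -FormZ -FormD.
  apply: (@Form_trigpoly_ge0 _ L) => //.
    by move=> k; rewrite ev /delta oppr_eq0.
  move=> x; have cK k : `|K k * cos (k%:~R * x)| <= `|K k|.
    by rewrite normrM ler_piMr// cos_max.
  have h := zsum_tail L cK aaK.
  under eq_psum do rewrite mulrDl.
  rewrite psumD (_ : psum (fun k => t L * delta k * _) L = t L); last first.
    under eq_psum do rewrite -mulrA; rewrite psumZ.
    have -> : psum (fun k => delta k * cos (k%:~R * x)) L =
         psum (fun k => cos (k%:~R * x) * delta (0 - k)) L.
      by apply: eq_psum => k; rewrite mulrC /delta sub0r oppr_eq0.
    by rewrite psum_delta// mul0r cos0 mulr1.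
  have := K0 x; move: h; rewrite ler_norml => /andP[_]; rewrite -/(t L); lra.
have t0 : t L @[L --> \oo] --> (0 : R).
  rewrite -(subrr (zsum (fun k => `|K k|))); apply: cvgB; first exact: cvg_cst.
  exact: asum_cvg.
apply: (@ler_cvgn _ (fun=> 0) (fun L => Form K b N + t L * psum (fun k => b k ^+ 2) N)).
- exact: cvg_cst.
- rewrite -[X in _ --> X]addr0 -[X in _ + X](mul0r (psum (fun k => b k ^+ 2) N)).
  by apply: cvgD; [exact: cvg_cst|apply: cvgMr_tmp].
- by near=> L; apply: key; near: L; exact: nbhs_infty_ge.
Unshelve. all: by end_near. Qed.

Lemma asum_delta : asum (@delta R).
Proof.
exists 1 => N.
rewrite (_ : psum _ N = psum (fun k => 1 * delta (0 - k)) N); last first.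
  by apply: eq_psum => k; rewrite ger0_norm ?ler0n// mul1r /delta sub0r oppr_eq0.
by rewrite psum_delta.
Qed.

Lemma zsum_deltaM u : zsum (fun k => u k * delta k) = u 0.
Proof.
apply: zsum_eq; apply: (@eq_cvgn _ (fun=> u 0)); last exact: cvg_cst.
move=> n; rewrite -(@psum_delta R u n 0)//; apply: eq_psum => k.
by rewrite /delta sub0r oppr_eq0.
Qed.

(** The symbol of e is at most the sum of the |e k|. *)
Lemma Form_le e b N : (forall k, e (- k) = e k) -> asum e ->
  Form e b N <= zsum (fun k => `|e k|) * psum (fun k => b k ^+ 2) N.
Proof.
move=> ev ae; have aae := asum_abs ae.
set M := zsum _.
have aM : asum (fun k => M * delta k) by apply: asumZ; exact: asum_delta.
rewrite -Form_delta -FormZ -subr_ge0 -FormB.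
apply: Form_symbol_ge0; first by move=> k; rewrite ev /delta oppr_eq0.
  exact: asumB.
move=> x.
have ac : asum (fun k => e k * cos (k%:~R * x)).
  by apply: asum_le aae => k; rewrite normrM ler_piMr// cos_max.
have ad : asum (fun k => M * cos (k%:~R * x) * delta k).
  under eq_fun do rewrite -mulrA (mulrC (cos _)) mulrA mulrC.
  apply: (@asumM _ _ _ 1) => // k; exact: cos_max.
under eq_zsum do rewrite mulrBl mulrAC.
rewrite zsumB// zsum_deltaM mul0r cos0 mulr1 subr_ge0.
apply: ler_zsum => // k; apply: le_trans (ler_norm _) _.
by rewrite normrM ler_piMr// cos_max.
Qed.

Lemma asum_sgnM (u : int -> R) : asum u -> asum (fun k => sgn k * u k).
Proof. by move=> au; apply: (@asumM _ _ _ 1) => // k; rewrite norm_sgn. Qed.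

(** The symbol of the autocorrelation at pi is the square of the symbol there. *)
Lemma zsum_sgn_autocorr (p : int -> R) : asum p ->
  zsum (fun k => sgn k * zconv p p k) = zsum (fun k => sgn k * p k) ^+ 2.
Proof.
move=> p_sum; have a := asum_sgnM p_sum.
rewrite expr2 -zsum_zconv//; apply: eq_zsum => k; rewrite -zsumZ; last first.
  by apply: asum_zconvM; [exact: p_sum|have [C _ pC] := asum_bounded p_sum; exists C].
by apply: eq_zsum => l; rewrite mulrACA sgnM -(mulrA (sgn k)) sgn_sqr mulr1.
Qed.

(** A lower bound for the form bounds the symbol everywhere, in particular at pi;
test it on the alternating sequence. *)
Lemma coercive_le_symbol_pi (p : int -> R) (m : R) :
  (forall k, p (- k) = p k) -> asum p ->
  (forall b N, m * psum (fun k => b k ^+ 2) N <= Form p b N) ->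
  m <= zsum (fun k => sgn k * p k).
Proof.
move=> p_even p_sum coercive; have a := asum_sgnM p_sum.
pose e k := m * delta k - sgn k * p k.
have ed : asum (fun k => m * delta k) by apply/asumZ/asum_delta.
have : zsum e <= 0.
  apply: (@Form1_bounded_zsum_le0 _ _ 0); first 1 last.
  - exact: asumB.
  - move=> N; rewrite /e FormB FormZ Form_delta -Form_sgn subr_le0.
    have := coercive sgn N; congr (_ * _ <= _); apply: eq_psum => k.
    by rewrite expr2 sgn_sqr expr1n.
  - by move=> k; rewrite /e sgnN p_even /delta oppr_eq0.
by rewrite /e zsumB// zsum_deltaM subr_le0.
Qed.

End Symbol.

(** * Convolution by a summable kernel on l2 *)

Section L2seq.
Context {R : realType}.
Implicit Types (u v w b e p : int -> R) (N L : nat) (k l : int) (c C s x : R).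

Definition l2 u := asum (fun k => u k ^+ 2).
(** The squared norm of l2, only meaningful under the hypothesis l2 u. *)
Definition normsq u : R := zsum (fun k => u k ^+ 2).
Definition trunc N u k : R := if (absz k <= N)%N then u k else 0.

Lemma normsq_ge0 u : l2 u -> 0 <= normsq u.
Proof. by move=> lu; apply: zsum_ge0 => // k; exact: sqr_ge0. Qed.

Lemma psum_le_normsq u N : l2 u -> psum (fun k => u k ^+ 2) N <= normsq u.
Proof. by move=> lu; apply: ge0_psum_le => // k; exact: sqr_ge0. Qed.

Lemma sqr_le_normsq u k : l2 u -> u k ^+ 2 <= normsq u.
Proof.
move=> lu; apply: le_trans (psum_le_normsq (absz k) lu).
by apply: (@psum_term _ (fun k => u k ^+ 2)) => // l; exact: sqr_ge0.
Qed.

Lemma l2_bound u C : (forall N, psum (fun k => u k ^+ 2) N <= C) -> l2 u.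
Proof. by move=> uC; exists C => N; under eq_psum do rewrite ger0_norm ?sqr_ge0//. Qed.

Lemma norm_le1D (x C : R) : x ^+ 2 <= C -> `|x| <= 1 + C.
Proof.
move=> xC; apply: (@le_trans _ _ (1 + x ^+ 2)); last by rewrite lerD2l.
rewrite -real_normK ?num_real//; have := normr_ge0 x; nra.
Qed.

Lemma l2_bounded u k : l2 u -> `|u k| <= 1 + normsq u.
Proof. by move=> lu; apply/norm_le1D/sqr_le_normsq. Qed.

Lemma sqrD_eps (ep x y : R) : 0 < ep ->
  (x + y) ^+ 2 <= (1 + ep) * x ^+ 2 + (1 + ep^-1) * y ^+ 2.
Proof.
move=> e0; rewrite -subr_ge0.
have -> : (1 + ep) * x ^+ 2 + (1 + ep^-1) * y ^+ 2 - (x + y) ^+ 2 =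
  ep * (x - y / ep) ^+ 2 by field; rewrite gt_eqF.
by rewrite mulr_ge0 ?sqr_ge0// ltW.
Qed.

Lemma normsq_0 u : (forall k, u k = 0) -> normsq u = 0.
Proof.
move=> u0; rewrite -[RHS](zsum_deltaM (fun=> 0)).
by apply: eq_zsum => k; rewrite u0 mul0r expr0n.
Qed.

Lemma l2D u v : l2 u -> l2 v -> l2 (fun k => u k + v k).
Proof.
move=> lu lv; apply: asum_le (asumD (asumZ (1 + 1) lu) (asumZ (1 + 1^-1) lv)) => k.
by rewrite ger0_norm ?sqr_ge0// sqrD_eps.
Qed.

(** This form of the triangle inequality stays within squared norms, so that no
square root of a series is ever taken. *)
Lemma normsqD_eps ep u v : 0 < ep -> l2 u -> l2 v ->
  normsq (fun k => u k + v k) <= (1 + ep) * normsq u + (1 + ep^-1) * normsq v.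
Proof.
move=> e0 lu lv; rewrite -!zsumZ// -zsumD; [|exact: asumZ..].
apply: ler_zsum; [|exact: l2D|by apply: asumD; exact: asumZ].
by move=> k; exact: sqrD_eps.
Qed.

Lemma l2Z c u : l2 u -> l2 (fun k => c * u k).
Proof. by move=> lu; rewrite /l2; under eq_fun do rewrite exprMn; exact: asumZ. Qed.

Lemma normsqZ c u : l2 u -> normsq (fun k => c * u k) = c ^+ 2 * normsq u.
Proof. by move=> lu; rewrite -zsumZ//; apply: eq_zsum => k; rewrite exprMn. Qed.

Lemma l2N u : l2 u -> l2 (fun k => - u k).
Proof. by rewrite /l2; under [X in _ -> asum X]eq_fun do rewrite sqrrN. Qed.

Lemma normsqN u : normsq (fun k => - u k) = normsq u.
Proof. by apply: eq_zsum => k; rewrite sqrrN. Qed.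

Lemma l2B u v : l2 u -> l2 v -> l2 (fun k => u k - v k).
Proof. by move=> lu lv; apply: l2D => //; exact: l2N. Qed.

Lemma zsum_fin u N : (forall k, (N < absz k)%N -> u k = 0) ->
  asum u /\ zsum u = psum u N.
Proof.
move=> u0; have st v n : (forall k, (N < absz k)%N -> v k = 0) -> (N <= n)%N -> psum v n = psum v N.
  move=> v0; elim: n => [|n IH]; first by rewrite leqn0 => /eqP ->.
  rewrite leq_eqVlt => /predU1P[->//|]; rewrite ltnS => Nn.
  by rewrite psumS IH// !v0 ?addr0//; lia.
split.
  exists (psum (fun k => `|u k|) N) => n.
  apply: (@le_trans _ _ (psum (fun k => `|u k|) (maxn n N))).
    by apply: psum_nd => //; rewrite leq_maxl.
  by rewrite st ?leq_maxr// => k /u0 ->; rewrite normr0.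
apply: zsum_eq; apply: cvg_near_cst; near=> n; apply: st => //.
by near: n; exact: nbhs_infty_ge.
Unshelve. all: by end_near. Qed.

Lemma trunc_fin u N : l2 (trunc N u) /\ normsq (trunc N u) = psum (fun k => u k ^+ 2) N.
Proof.
have [] := @zsum_fin (fun k => trunc N u k ^+ 2) N.
  by move=> k Nk; rewrite /trunc leqNgt Nk expr0n.
rewrite -/(normsq _) => ? ->; split => //; apply: eq_psum_in => k kN; by rewrite /trunc kN.
Qed.

Lemma l2_trunc u N : l2 (trunc N u). Proof. by have [] := trunc_fin u N. Qed.
Lemma normsq_trunc u N : normsq (trunc N u) = psum (fun k => u k ^+ 2) N.
Proof. by have [] := trunc_fin u N. Qed.

Lemma normsq_tail u : l2 u ->
  normsq (fun k => u k - trunc N u k) @[N --> \oo] --> (0 : R).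
Proof.
move=> lu; apply: (@eq_cvgn _ (fun N => normsq u - psum (fun k => u k ^+ 2) N)).
  move=> N; rewrite -normsq_trunc -zsumB//; last exact: l2_trunc.
  apply: eq_zsum => k; rewrite /trunc; case: ifP => _; ring.
rewrite -(subrr (normsq u)); apply: cvgB; first exact: cvg_cst.
exact: asum_cvg.
Qed.

Lemma trunc_cvg u k : trunc N u k @[N --> \oo] --> u k.
Proof.
apply: cvg_near_cst; near=> N; rewrite /trunc ifT//.
by near: N; exact: nbhs_infty_ge.
Unshelve. all: by end_near. Qed.

(** Fatou: the squared norm is lower semicontinuous for pointwise convergence. *)
Lemma normsq_lsc (u_ : nat -> int -> R) u (C_ : nat -> R) C :
  (forall k, u_ N k @[N --> \oo] --> u k) -> (forall N, l2 (u_ N)) ->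
  (forall N, normsq (u_ N) <= C_ N) -> C_ N @[N --> \oo] --> C -> l2 u /\ normsq u <= C.
Proof.
move=> uu lu uC CC.
have h M : psum (fun k => u k ^+ 2) M <= C.
  apply: (@ler_cvgn _ (fun N => psum (fun k => u_ N k ^+ 2) M) C_) => //.
    apply: (@psum_cvg _ (fun N k => u_ N k ^+ 2) (fun k => u k ^+ 2)) => k.
    rewrite expr2; apply: (@eq_cvgn _ (fun N => u_ N k * u_ N k)) => [N|]; first by rewrite expr2.
    exact: cvgM.
  by apply: nearW => N; apply: le_trans (uC N); exact: psum_le_normsq.
by split; [exact: (l2_bound h)|apply: zsum_le => //; exact: (l2_bound h)].
Qed.

Lemma asum_zconv_l2 p b n : asum p -> l2 b -> asum (fun k => p (n - k) * b k).
Proof. by move=> ap lb; apply: asum_zconvM => //; exists (1 + normsq b) => k; exact: l2_bounded. Qed.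

Lemma zconvD p u v n : asum p -> l2 u -> l2 v ->
  zconv p (fun k => u k + v k) n = zconv p u n + zconv p v n.
Proof.
move=> ap lu lv; rewrite -zsumD; [|exact: asum_zconv_l2..].
by apply: eq_zsum => k; rewrite mulrDr.
Qed.

Lemma zconvZ p c u n : asum p -> l2 u ->
  zconv p (fun k => c * u k) n = c * zconv p u n.
Proof.
move=> ap lu; rewrite -zsumZ; last exact: asum_zconv_l2.
by apply: eq_zsum => k; rewrite mulrCA.
Qed.

Lemma zconvN p u n : asum p -> l2 u ->
  zconv p (fun k => - u k) n = - zconv p u n.
Proof.
move=> ap lu; rewrite -zsumN; last exact: asum_zconv_l2.
by apply: eq_zsum => k; rewrite mulrN.
Qed.

Lemma zconvB p u v n : asum p -> l2 u -> l2 v ->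
  zconv p (fun k => u k - v k) n = zconv p u n - zconv p v n.
Proof. by move=> ap lu lv; rewrite zconvD ?zconvN//; exact: l2N. Qed.

Lemma zconv_trunc p b N n : zconv p (trunc N b) n = psum (fun k => p (n - k) * b k) N.
Proof.
have [|_] := @zsum_fin (fun k => p (n - k) * trunc N b k) N.
  by move=> k Nk; rewrite /trunc leqNgt Nk mulr0.
rewrite -/(zconv _ _ _) => ->.
by apply: eq_psum_in => k kN; rewrite /trunc kN.
Qed.

Lemma zconv_trunc_cvg p b n : asum p -> l2 b ->
  zconv p (trunc N b) n @[N --> \oo] --> zconv p b n.
Proof.
move=> ap lb; apply: (eq_cvgn _ (asum_cvg (asum_zconv_l2 n ap lb))) => N.
by rewrite zconv_trunc.
Qed.

Lemma zsum_psum (F : int -> int -> R) N : (forall k, asum (F k)) ->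
  asum (fun n => psum (fun k => F k n) N) /\
  zsum (fun n => psum (fun k => F k n) N) = psum (fun k => zsum (F k)) N.
Proof.
move=> aF; elim: N => [|N [IH1 IH2]].
  have -> : (fun n => psum (fun k => F k n) 0) = F 0 by apply/funext => n; rewrite psum0.
  by rewrite psum0.
have -> : (fun n => psum (fun k => F k n) N.+1) =
  (fun n => psum (fun k => F k n) N + F (Posz N.+1) n + F (- Posz N.+1) n).
  by apply/funext => n; rewrite psumS.
have a2 : asum (fun n => psum (fun k => F k n) N + F (Posz N.+1) n) by exact: asumD.
split; first exact: asumD.
by rewrite psumS !zsumD// IH2.
Qed.

Section Kernel.
Variable p : int -> R.
Hypothesis p_ge0 : forall k, 0 <= p k.
Hypothesis p_even : forall k, p (- k) = p k.
Hypothesis p_sum : asum p.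

Let M := zsum p.

Lemma asum_pp k l : asum (fun n => p (n - k) * p (n - l)).
Proof.
have [C _ pC] := asum_bounded p_sum.
apply: (@asumM _ _ _ C); last exact: asum_shift.
by move=> n; exact: pC.
Qed.

Lemma zsum_autocorr k l : zsum (fun n => p (n - k) * p (n - l)) = zconv p p (k - l).
Proof.
rewrite -(zsum_shift l (asum_pp k l)); apply: eq_zsum => n; rewrite addrK; congr (_ * _).
by rewrite -p_even; congr p; lia.
Qed.

Lemma autocorr_even k : zconv p p (- k) = zconv p p k.
Proof.
rewrite /zconv -[RHS]zsum_opp; last first.
  by apply: asum_zconvM => //; have [C _ pC] := asum_bounded p_sum; exists C.
by apply: eq_zsum => n; rewrite p_even -p_even; congr (p _ * _); lia.
Qed.

Lemma autocorr_ge0 k : 0 <= zconv p p k.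
Proof.
apply: zsum_ge0 => [n|]; first exact: mulr_ge0.
by apply: asum_zconvM => //; have [C _ pC] := asum_bounded p_sum; exists C.
Qed.

(** Expanding the square, the sums over n of p (n - k) * p (n - l) are the
autocorrelation of p at k - l. *)
Lemma zconv_trunc_sqr b N :
  l2 (zconv p (trunc N b)) /\ normsq (zconv p (trunc N b)) = Form (zconv p p) b N.
Proof.
pose F k n := psum (fun l => (b k * b l) * (p (n - k) * p (n - l))) N.
have aF k : asum (F k) /\ zsum (F k) = psum (fun l => b k * b l * zconv p p (k - l)) N.
  rewrite /F; have [|h1 h2] := @zsum_psum (fun l n => (b k * b l) * (p (n - k) * p (n - l))) N.
    by move=> l; apply/asumZ/asum_pp.
  split => //; rewrite h2; apply: eq_psum => l.
  by rewrite zsumZ ?zsum_autocorr//; exact: asum_pp.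
have [|h1 h2] := @zsum_psum F N; first by move=> k; have [] := aF k.
have E : (fun n => zconv p (trunc N b) n ^+ 2) = (fun n => psum (fun k => F k n) N).
  apply/funext => n; rewrite zconv_trunc expr2 -psumZr; apply: eq_psum => k.
  rewrite -psumZ; apply: eq_psum => l; ring.
split; first by rewrite /l2 E.
by rewrite /normsq E h2; apply: eq_psum => k; have [] := aF k.
Qed.

Lemma normsq_zconv_trunc_le b N :
  normsq (zconv p (trunc N b)) <= M ^+ 2 * psum (fun k => b k ^+ 2) N.
Proof.
have [_ ->] := zconv_trunc_sqr b N.
apply: le_trans (Form_le _ _ autocorr_even (asum_zconv p_sum p_sum)) _.
rewrite le_eqVlt; apply/orP; left; apply/eqP; congr (_ * _).
rewrite expr2 -zsum_zconv//; apply: eq_zsum => k.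
by rewrite ger0_norm// autocorr_ge0.
Qed.

Lemma normsq_zconv_le b : l2 b -> l2 (zconv p b) /\ normsq (zconv p b) <= M ^+ 2 * normsq b.
Proof.
move=> lb; apply: (@normsq_lsc (fun N => zconv p (trunc N b)) _
  (fun N => M ^+ 2 * psum (fun k => b k ^+ 2) N)).
- by move=> k; exact: zconv_trunc_cvg.
- by move=> N; have [] := zconv_trunc_sqr b N.
- by move=> N; exact: normsq_zconv_trunc_le.
- by apply: cvgMl_tmp; exact: asum_cvg.
Qed.

Lemma l2_zconv b : l2 b -> l2 (zconv p b). Proof. by case/normsq_zconv_le. Qed.

(** Expands |b - s p*b|^2 for finitely supported b; both the lower bound on the
autocorrelation and the contraction used to invert p come from it. *)
Lemma normsq_residual b N (s : R) :
  normsq (fun k => trunc N b k - s * zconv p (trunc N b) k) =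
  psum (fun k => b k ^+ 2) N - 2 * s * Form p b N + s ^+ 2 * Form (zconv p p) b N.
Proof.
have [lc <-] := zconv_trunc_sqr b N; rewrite -normsq_trunc.
set t := trunc N b; have lt := l2_trunc b N : l2 t.
have [a1 <-] : asum (fun k => t k * zconv p t k) /\ zsum (fun k => t k * zconv p t k) = Form p b N.
  have [|h1 h2] := @zsum_fin (fun k => t k * zconv p t k) N.
    by move=> k Nk; rewrite /t /trunc leqNgt Nk mul0r.
  split => //; rewrite h2; apply: eq_psum_in => k kN.
  rewrite zconv_trunc /t /trunc kN -psumZ; apply: eq_psum => l; ring.
rewrite -!zsumZ// -zsumB//; last exact: asumZ.
rewrite -zsumD; [|by apply: asumB => //; exact: asumZ|exact: asumZ].
by apply: eq_zsum => k; ring.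
Qed.

Variable m : R.
Hypothesis m_gt0 : 0 < m.
Hypothesis coercive : forall b N, m * psum (fun k => b k ^+ 2) N <= Form p b N.

Lemma m_le_M : m <= M.
Proof.
have := le_trans (coercive (fun=> 1) 0) (Form_le (fun=> 1) 0 p_even p_sum).
by rewrite psum0 expr1n !mulr1 (eq_zsum (v := p))// => k; rewrite ger0_norm.
Qed.

(** On the symbol side P >= m implies P^2 >= m^2; here it is the nonnegativity of
the residual b - m^-1 p*b. *)
Lemma autocorr_coercive b N :
  m ^+ 2 * psum (fun k => b k ^+ 2) N <= Form (zconv p p) b N.
Proof.
have [lc _] := zconv_trunc_sqr b N.
have : 0 <= normsq (fun k => trunc N b k - m^-1 * zconv p (trunc N b) k).
  by apply: normsq_ge0; apply: l2B; [exact: l2_trunc|exact: l2Z].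
rewrite normsq_residual => h.
have := mulr_ge0 (sqr_ge0 m) h.
have := ler_wpM2l (ltW m_gt0) (coercive b N).
set B := psum _ _; set X := Form p b N; set Y := Form _ b N.
have -> : m ^+ 2 * (B - 2 * m^-1 * X + m^-1 ^+ 2 * Y) = m ^+ 2 * B - 2 * (m * X) + Y.
  by field; rewrite gt_eqF.
have -> : m * (m * B) = m ^+ 2 * B by ring.
lra.
Qed.

Let M_gt0 : 0 < M. Proof. exact: lt_le_trans m_le_M. Qed.
Let s := m / M ^+ 2.
Let d := m ^+ 2 / M ^+ 2.

Let d_gt0 : 0 < d. Proof. by rewrite divr_gt0// exprn_gt0. Qed.
Let d_le1 : d <= 1.
Proof. by rewrite ler_pdivrMr ?exprn_gt0// mul1r lerXn2r ?nnegrE ?m_le_M// ltW. Qed.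

(** The step s = m / M^2 minimises the bound 1 - 2 s m + s^2 M^2 on the squared
contraction ratio of b |-> b - s p*b, with minimum 1 - d. *)
Lemma richardson_trunc b N :
  normsq (fun k => trunc N b k - s * zconv p (trunc N b) k) <=
  (1 - d) * psum (fun k => b k ^+ 2) N.
Proof.
rewrite normsq_residual; have [_ e2] := zconv_trunc_sqr b N.
set B := psum _ N.
have s0 : 0 < s by rewrite divr_gt0// exprn_gt0.
have h1 : s * (m * B) <= s * Form p b N by rewrite ler_pM2l// coercive.
have h2 : s ^+ 2 * Form (zconv p p) b N <= s ^+ 2 * (M ^+ 2 * B).
  by rewrite ler_pM2l ?exprn_gt0// -e2 normsq_zconv_trunc_le.
have h3 : s ^+ 2 * (M ^+ 2 * B) = d * B by rewrite /s /d; field; rewrite gt_eqF.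
have h4 : s * (m * B) = d * B by rewrite /s /d; field; rewrite gt_eqF.
rewrite h3 in h2; rewrite h4 in h1; lra.
Qed.

Lemma richardson b : l2 b ->
  normsq (fun k => b k - s * zconv p b k) <= (1 - d) * normsq b.
Proof.
move=> lb.
suff [] : l2 (fun k => b k - s * zconv p b k) /\
   normsq (fun k => b k - s * zconv p b k) <= (1 - d) * normsq b by [].
apply: (@normsq_lsc (fun N k => trunc N b k - s * zconv p (trunc N b) k) _
  (fun N => (1 - d) * psum (fun k => b k ^+ 2) N)).
- move=> k; apply: cvgB; first exact: trunc_cvg.
  by apply: cvgMl_tmp; exact: zconv_trunc_cvg.
- move=> N; apply: l2B; first exact: l2_trunc.
  by apply/l2Z/l2_zconv/l2_trunc.
- by move=> N; exact: richardson_trunc.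
- by apply: cvgMl_tmp; exact: asum_cvg.
Qed.

(** A bound on the squared norm of the inverse of convolution by p, in the form in
which the iteration x |-> x - s p*x + s c produces it: the fixed point x of
richardson_step satisfies d^2 |x|^2 <= (1 + 1/d) s^2 |c|^2. *)
Definition inverse_bound : R := (1 + d^-1) * s ^+ 2 / d ^+ 2.

Lemma inverse_bound_ge0 : 0 <= inverse_bound.
Proof. by rewrite divr_ge0 ?sqr_ge0// mulr_ge0 ?sqr_ge0// addr_ge0// invr_ge0 ltW. Qed.

Let richardson_step (x c : int -> R) : l2 x -> l2 c ->
  normsq (fun k => (x k - s * zconv p x k) + s * c k) <=
  (1 - d ^+ 2) * normsq x + (1 + d^-1) * s ^+ 2 * normsq c.
Proof.
move=> lx lc.
have l1 : l2 (fun k => x k - s * zconv p x k) by apply: l2B => //; exact/l2Z/l2_zconv.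
apply: le_trans (normsqD_eps d_gt0 l1 (l2Z s lc)) _.
rewrite normsqZ// mulrA lerD2r.
have -> : (1 - d ^+ 2) * normsq x = (1 + d) * ((1 - d) * normsq x) by ring.
by rewrite ler_wpM2l ?richardson// addr_ge0// ltW.
Qed.

Lemma normsq_le_zconv b : l2 b -> normsq b <= inverse_bound * normsq (zconv p b).
Proof.
move=> lb; have := richardson_step lb (l2_zconv lb).
rewrite (_ : normsq (fun k => _) = normsq b); last by apply: eq_zsum => k; rewrite subrK.
move=> h; rewrite /inverse_bound mulrAC ler_pdivlMr ?exprn_gt0//; lra.
Qed.

Lemma zconv_inj b b' : l2 b -> l2 b' -> (forall n, zconv p b n = zconv p b' n) -> b =1 b'.
Proof.
move=> lb lb' bb k; have lB := l2B lb lb'.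
have := normsq_le_zconv lB; rewrite (normsq_0 (u := zconv p _)) ?mulr0; last first.
  by move=> n; rewrite zconvB// bb subrr.
move=> h; have := le_trans (sqr_le_normsq k lB) h.
by rewrite le_eqVlt ltNge sqr_ge0 orbF sqrf_eq0 subr_eq0 => /eqP.
Qed.

(** Richardson iteration x |-> x - s p*x + s c. Its increments decay geometrically in
l2, hence at each index; the pointwise limit stays in l2 by lower semicontinuity,
and convolution passes to the limit by dominated convergence. *)
Lemma zconv_surj (c : int -> R) : l2 c -> exists2 b, l2 b & forall n, zconv p b n = c n.
Proof.
move=> lc.
pose x := fix x (j : nat) : int -> R :=
  if j is j'.+1 then fun k => (x j' k - s * zconv p (x j') k) + s * c k else fun=> 0.
have lx j : l2 (x j).
  elim: j => [|j IH] /=; last by apply: l2D; [apply: l2B => //; exact/l2Z/l2_zconv|exact: l2Z].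
  by apply: (@l2_bound _ 0) => N; rewrite [leLHS]big1// => i _; rewrite expr0n.
have nx j : normsq (x j) <= inverse_bound * normsq c.
  elim: j => [|j IH].
    rewrite (normsq_0 (u := x 0))//; apply: mulr_ge0; first exact: inverse_bound_ge0.
    exact: normsq_ge0.
  apply: le_trans (richardson_step (lx j) lc) _.
  have d2 : 0 <= 1 - d ^+ 2 by rewrite subr_ge0 expr_le1// ltW.
  have := ler_wpM2l d2 IH.
  have -> : (1 + d^-1) * s ^+ 2 * normsq c = d ^+ 2 * (inverse_bound * normsq c).
    by rewrite /inverse_bound; field; rewrite gt_eqF.
  lra.
pose y j k := x j.+1 k - x j k.
have ly j : l2 (y j) by apply: l2B; exact: lx.
have ry j : normsq (y j) <= (1 - d) ^+ j * normsq (y 0).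
  elim: j => [|j IH]; first by rewrite expr0 mul1r.
  have -> : normsq (y j.+1) = normsq (fun k => y j k - s * zconv p (y j) k).
    apply: eq_zsum => k; congr (_ ^+ 2).
    by rewrite /y zconvB// /=; ring.
  apply: le_trans (richardson (ly j)) _.
  by rewrite exprS -mulrA ler_wpM2l// subr_ge0.
pose r := Num.sqrt (1 - d).
have r2 : r ^+ 2 = 1 - d by rewrite sqr_sqrtr// subr_ge0.
have r0 : 0 <= r by exact: sqrtr_ge0.
have r1 : r < 1 by rewrite -[X in _ < X]sqrtr1 /r ltr_sqrt// ltrBlDr ltrDl.
pose D := Num.sqrt (normsq (y 0)).
have D0 : 0 <= D by exact: sqrtr_ge0.
have D2 : D ^+ 2 = normsq (y 0) by rewrite sqr_sqrtr// normsq_ge0.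
have by_ j k : `|y j k| <= D * r ^+ j.
  rewrite -ler_sqr ?nnegrE// ?mulr_ge0 ?exprn_ge0// real_normK ?num_real//.
  apply: le_trans (sqr_le_normsq k (ly j)) _; apply: le_trans (ry j) _.
  by rewrite exprMn D2 mulrC exprAC r2.
have cx k : cvgn (x^~ k).
  have -> : x^~ k = series (fun j => y j k).
    apply/funext => j; rewrite /series/= telescope_sumr ?subr0// .
  apply: normed_cvg; apply: (@series_le_cvg _ _ (geometric D r)).
  - by move=> j; exact: normr_ge0.
  - by move=> j; rewrite /geometric/= mulr_ge0// exprn_ge0.
  - by move=> j; exact: by_.
  - by apply: is_cvg_geometric_series; rewrite ger0_norm.
pose b k := limn (x^~ k).
have [lb nb] : l2 b /\ normsq b <= inverse_bound * normsq c.
  by apply: (@normsq_lsc x _ (fun=> inverse_bound * normsq c)) => //; exact: cvg_cst.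
exists b => // n.
have h1 : zconv p (x j) n @[j --> \oo] --> zconv p b n.
  apply: (@zsum_dominated _ _ _ (fun k => (1 + inverse_bound * normsq c) * p (n - k))).
  - by apply/asumZ/asum_rshift.
  - move=> j k; rewrite normrM mulrC (ger0_norm (p_ge0 _)); apply: ler_wpM2r => //.
    by apply: le_trans (l2_bounded k (lx j)) _; rewrite lerD2l.
  - by move=> k; apply: cvgMl_tmp; exact: cx.
have s0 : s != 0 by rewrite gt_eqF// divr_gt0// exprn_gt0.
have h2 : zconv p (x j) n @[j --> \oo] --> c n.
  apply: (@eq_cvgn _ (fun j => c n - s^-1 * (x j.+1 n - x j n))).
    by move=> j /=; field.
  rewrite -[X in _ --> X]subr0 -[X in _ - X](mulr0 s^-1) -[X in _ * X](subrr (b n)).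
  apply: cvgB; first exact: cvg_cst.
  apply: cvgMl_tmp; apply: cvgB; last exact: cx.
  by have := cx n; rewrite -cvg_shiftS.
exact: (cvg_unique _ h1 h2).
Qed.

End Kernel.
End L2seq.

(** * Square integrals of real functions *)

Section Sqint.
Context {R : realType}.
Local Notation mu := (@lebesgue_measure R).
Implicit Types (f h : R -> R) (c C : R).

Definition sqint f : \bar R := (\int[mu]_t ((f t) ^+ 2)%:E)%E.

Lemma measurable_sqr f : measurable_fun setT f ->
  measurable_fun setT (EFin \o (fun t => (f t) ^+ 2)).
Proof. by move=> mf; apply/measurable_EFinP; exact: measurable_funX. Qed.

Lemma sqint_ge0 f : (0 <= sqint f)%E.
Proof. by apply: integral_ge0 => t _; rewrite lee_fin sqr_ge0. Qed.

Lemma sqintD_eps ep f h : 0 < ep ->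
  measurable_fun setT f -> measurable_fun setT h ->
  (sqint (fun t => f t + h t)%R <=
   (1 + ep)%:E * sqint f + (1 + ep^-1)%:E * sqint h)%E.
Proof.
move=> e0 mf mh.
have e1 : 0 <= 1 + ep by rewrite addr_ge0// ltW.
have e2 : 0 <= 1 + ep^-1 by rewrite addr_ge0// invr_ge0 ltW.
rewrite /sqint -!ge0_integralZl_EFin//; [|by move=> t _; rewrite lee_fin sqr_ge0|exact: measurable_sqr|by move=> t _; rewrite lee_fin sqr_ge0|exact: measurable_sqr].
rewrite -ge0_integralD//; last 4 first.
- by move=> t _; rewrite mule_ge0// lee_fin sqr_ge0.
- by apply: measurable_funeM; exact: measurable_sqr.
- by move=> t _; rewrite mule_ge0// lee_fin sqr_ge0.
- by apply: measurable_funeM; exact: measurable_sqr.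
apply: ge0_le_integral => //.
- by move=> t _; rewrite lee_fin sqr_ge0.
- by apply: measurable_sqr; exact: measurable_funD.
- by apply: emeasurable_funD; apply: measurable_funeM; exact: measurable_sqr.
- by move=> t _; rewrite -!EFinM -EFinD lee_fin; exact: sqrD_eps.
Qed.

Lemma sqint_fatou (f_ : nat -> R -> R) f c :
  (forall n, measurable_fun setT (f_ n)) ->
  (forall t, f_ n t @[n --> \oo] --> f t) ->
  (forall n, sqint (f_ n) <= c%:E)%E -> (sqint f <= c%:E)%E.
Proof.
move=> mf ff fc.
have fE t : ((f t) ^+ 2)%:E = limn_einf (fun n => ((f_ n t) ^+ 2)%:E).
  have cv : ((f_ n t) ^+ 2)%:E @[n --> \oo] --> ((f t) ^+ 2)%:E.
    apply: cvg_EFin; first exact: nearW.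
    rewrite expr2; apply: (@eq_cvgn _ (fun n => f_ n t * f_ n t)) => [n|].
      by rewrite /= expr2.
    exact: cvgM.
  rewrite is_cvg_limn_einfE; last by apply/cvg_ex; exists ((f t) ^+ 2)%:E.
  by apply/esym/cvg_lim.
rewrite /sqint; under eq_integral do rewrite fE.
apply: le_trans (fatou mu measurableT _ _) _.
- by move=> n; exact: measurable_sqr.
- by move=> n t _; rewrite lee_fin sqr_ge0.
rewrite limn_einf_lim; apply: lime_le; first exact: is_cvg_einfs.
apply: nearW => n; apply: le_trans (fc n).
by apply: ereal_inf_lbound; exists n => /=.
Qed.

(** Keeping integrability together with the value lets finite sums be integrated
without side conditions. *)
Definition has_int f c := mu.-integrable setT (EFin \o f) /\
  (\int[mu]_t (f t)%:E)%E = c%:E.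

Lemma has_intD f h c d : has_int f c -> has_int h d ->
  has_int (fun t => f t + h t) (c + d).
Proof.
move=> [i1 e1] [i2 e2]; split; first by have := integrableD measurableT i1 i2.
by under eq_integral do rewrite EFinD; rewrite integralD// e1 e2.
Qed.

Lemma has_intZ k f c : has_int f c -> has_int (fun t => k * f t) (k * c).
Proof.
move=> [i1 e1]; split; first by have := integrableZl measurableT k i1.
by under eq_integral do rewrite EFinM; rewrite integralZl// e1.
Qed.

Lemma has_int_psum (F : int -> R -> R) (I : int -> R) N :
  (forall k, has_int (F k) (I k)) ->
  has_int (fun t => psum (fun k => F k t) N) (psum I N).
Proof.
move=> FI; elim: N => [|N IH].
  by have -> : (fun t => psum (fun k => F k t) 0) = F 0; [apply/funext => t|]; rewrite psum0.
have -> : (fun t => psum (fun k => F k t) N.+1) =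
  (fun t => psum (fun k => F k t) N + F (Posz N.+1) t + F (- Posz N.+1) t).
  by apply/funext => t; rewrite psumS.
by rewrite psumS; apply: has_intD => //; exact: has_intD.
Qed.

Lemma measurable_psum (F : int -> R -> R) N :
  (forall k, measurable_fun setT (F k)) ->
  measurable_fun setT (fun t => psum (fun k => F k t) N).
Proof.
move=> mF; elim: N => [|N IH].
  by have -> : (fun t => psum (fun k => F k t) 0) = F 0; [apply/funext => t; rewrite psum0|].
have -> : (fun t => psum (fun k => F k t) N.+1) =
  (fun t => psum (fun k => F k t) N + F (Posz N.+1) t + F (- Posz N.+1) t).
  by apply/funext => t; rewrite psumS.
by apply: measurable_funD => //; exact: measurable_funD.
Qed.

End Sqint.

Section Compare.
Context {R : realType}.
Implicit Types (u v b : int -> R).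

(** What is needed of a bounded nonnegative quadratic form on l2 in order to compare
two of them by density. *)
Definition quadlike (C : R) (P : (int -> R) -> R) :=
  [/\ forall u, l2 u -> 0 <= P u, forall u, l2 u -> P u <= C * normsq u &
   forall ep u v, 0 < ep -> l2 u -> l2 v ->
     P (fun k => u k + v k) <= (1 + ep) * P u + (1 + ep^-1) * P v].

Lemma le_eps_sqr (x y : R) : 0 <= y ->
  (forall e, 0 < e -> x <= (1 + e) ^+ 2 * y) -> x <= y.
Proof.
move=> y0 h; apply/ler_addgt0Pr => e e0.
have y1 : 0 < 3 * (y + 1) by lra.
pose d := Num.min 1 (e / (3 * (y + 1))).
have d0 : 0 < d by rewrite lt_min ltr01/= divr_gt0.
have d1 : d <= 1 by rewrite ge_min lexx.
have d2 : d * (3 * (y + 1)) <= e by rewrite -ler_pdivlMr// ge_min lexx orbT.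
have := h d d0; nra.
Qed.

(** Density: replacing b by trunc N b costs a factor 1 + e on each side and a multiple
of the squared norm of the tail, which vanishes as N grows; then e tends to 0. *)
Lemma quadlike_le C C' P P' b : quadlike C P -> quadlike C' P' ->
  (forall b N, P (trunc N b) <= P' (trunc N b)) -> l2 b -> P b <= P' b.
Proof.
move=> [P0 PC PD] [P0' PC' PD'] PP lb.
apply: le_eps_sqr; first exact: P0'.
move=> e e0.
pose t N := normsq (fun k => b k - trunc N b k).
have lt N : l2 (fun k => b k - trunc N b k) by apply: l2B => //; exact: l2_trunc.
have lt' N : l2 (fun k => trunc N b k - b k) by apply: l2B => //; exact: l2_trunc.
have tE N : normsq (fun k => trunc N b k - b k) = t N.
  by rewrite -normsqN; apply: eq_zsum => k; rewrite opprB.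
have e1 : 0 < 1 + e by lra.
have e2 : 0 < 1 + e^-1 by rewrite addr_gt0// invr_gt0.
have key N : P b <= (1 + e) ^+ 2 * P' b + ((1 + e) * (1 + e^-1) * C' + (1 + e^-1) * C) * t N.
  have h1 := PD e (trunc N b) (fun k => b k - trunc N b k) e0 (l2_trunc b N) (lt N).
  have h2 := PD' e b (fun k => trunc N b k - b k) e0 lb (lt' N).
  have E1 : (fun k => trunc N b k + (b k - trunc N b k)) = b by apply/funext => k; ring.
  have E2 : (fun k => b k + (trunc N b k - b k)) = trunc N b by apply/funext => k; ring.
  rewrite E1 in h1; rewrite E2 in h2.
  have h3 := ler_wpM2l (ltW e2) (PC _ (lt N)).
  have h4 := ler_wpM2l (ltW (mulr_gt0 e1 e2)) (PC' _ (lt' N)).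
  have h5 := ler_wpM2l (ltW e1) (le_trans (PP b N) h2).
  rewrite tE in h4; rewrite -/(t N) in h3.
  lra.
have t0 := normsq_tail lb.
apply: (@ler_cvgn _ (fun=> P b) (fun N => (1 + e) ^+ 2 * P' b + ((1 + e) * (1 + e^-1) * C' + (1 + e^-1) * C) * t N)).
- exact: cvg_cst.
- set K := (1 + e) * (1 + e^-1) * C' + (1 + e^-1) * C; set y := _ * P' b.
  suff : y + K * t N @[N --> \oo] --> y + K * 0 by rewrite mulr0 addr0.
  by apply: cvgD; [exact: cvg_cst|apply: cvgMl_tmp].
- exact: nearW.
Qed.

End Compare.

(** * Bilateral limits and unordered sums *)

Section Esum.
Context {R : realType}.
Implicit Types (u : int -> R).

(** The enumeration 0, 1, -1, 2, -2, ..., whose initial segments of odd length are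
the symmetric intervals. *)
Definition int_enum (n : nat) : int := if odd n then Posz n.+1./2 else - Posz n./2.

Lemma int_enum_bij : set_bij [set: nat] [set: int] int_enum.
Proof.
split => //.
- move=> m n _ _; rewrite /int_enum; case: ifP; case: ifP => h1 h2; lia.
- move=> [k|k] _.
  + case: k => [|k]; first by exists 0%N.
    by exists k.*2.+1 => //; rewrite /int_enum; case: ifP; lia.
  + by exists k.+1.*2 => //; rewrite /int_enum; case: ifP; lia.
Qed.

Lemma psum_enum u N : psum u N = \sum_(0 <= i < N.*2.+1) u (int_enum i).
Proof.
elim: N => [|N IH]; first by rewrite psum0 big_nat1.
rewrite psumS IH doubleS !big_nat_recr//=; congr (_ + u _ + u _).
  by rewrite /int_enum; case: ifP; lia.
by rewrite /int_enum; case: ifP; lia.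
Qed.

(** The symmetric partial sums are a subsequence of those along int_enum. *)
Lemma esum_enum u : (forall k, 0 <= u k) ->
  (psum u N)%:E @[N --> \oo] --> (\esum_(k in [set: int]) (u k)%:E)%E.
Proof.
move=> u0; rewrite (reindex_esum _ _ _ _ int_enum_bij) -nneseries_esumT; last by move=> n; rewrite lee_fin.
have h : (\sum_(0 <= i < n) (u (int_enum i))%:E)%E @[n --> \oo] -->
    (\sum_(i <oo) (u (int_enum i))%:E)%E.
  by apply: is_cvg_nneseries => n _ _; rewrite lee_fin.
have -> : (fun N => (psum u N)%:E) = (fun n => (\sum_(0 <= i < n) (u (int_enum i))%:E)%E) \o (fun N => N.*2.+1).
  by apply/funext => N /=; rewrite psum_enum sumEFin.
apply: cvg_comp h.
by apply/cvgnyPge => A; near=> n; rewrite (@leq_trans n)//; [near: n; exact: nbhs_infty_ge|lia].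
Unshelve. all: by end_near. Qed.

Lemma esum_zsum u : (forall k, 0 <= u k) -> asum u ->
  (\esum_(k in [set: int]) (u k)%:E = (zsum u)%:E)%E.
Proof.
move=> u0 au; apply: (cvg_unique _ (esum_enum u0)) => //.
by apply: cvg_EFin; [exact: nearW|exact: asum_cvg].
Qed.

Lemma esum_lty_asum u : (forall k, 0 <= u k) ->
  (\esum_(k in [set: int]) (u k)%:E < +oo)%E -> asum u.
Proof.
move=> u0 h; exists (fine (\esum_(k in [set: int]) (u k)%:E)%E) => N.
have -> : psum (fun k => `|u k|) N = psum u N by apply: eq_psum => k; rewrite ger0_norm.
rewrite -lee_fin fineK; last by rewrite ge0_fin_numE// esum_ge0// => k _; rewrite lee_fin.
have := esum_enum u0; move/cvg_lim => <-//.
apply: lime_ge; first by apply: cvgP; exact: esum_enum.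
near=> n; rewrite lee_fin; apply: psum_nd => //.
by near: n; exact: nbhs_infty_ge.
Unshelve. all: by end_near. Qed.

End Esum.

(** * Complex L2 norms through real and imaginary parts *)

Section Complex.
Context {R : realType}.
Local Notation mu := (@lebesgue_measure R).
Local Open Scope complex_scope.
Implicit Types (c : int -> R[i]) (f h : R -> R[i]).
Local Notation re := (@complex.Re R).
Local Notation im := (@complex.Im R).

Lemma modulus_sqr (z : R[i]) : modulus z ^+ 2 = re z ^+ 2 + im z ^+ 2.
Proof. by case: z => a b; rewrite /modulus/= sqr_sqrtr// addr_ge0// sqr_ge0. Qed.

Lemma modulus_ge0 (z : R[i]) : 0 <= modulus z.
Proof. by case: z => a b; rewrite /modulus/= sqrtr_ge0. Qed.

Lemma L2norm_sqr f : measurable_fun setT (re \o f) -> measurable_fun setT (im \o f) ->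
  (L2norm f ^+ 2 = sqint (re \o f) + sqint (im \o f))%E.
Proof.
move=> mre mim.
have -> : (L2norm f ^+ 2 = \int[mu]_t ((modulus (f t)) ^+ 2)%:E)%E.
  rewrite /L2norm unlock poweR12_sqrt ?integral_ge0//; last by move=> t _; exact: poweR_ge0.
  rewrite sqr_sqrte; last by apply: integral_ge0 => t _; exact: poweR_ge0.
  apply: eq_integral => t _; rewrite gee0_abs ?lee_fin ?modulus_ge0//.
  by rewrite poweR_EFin powR_mulrn ?modulus_ge0.
rewrite /sqint -ge0_integralD//.
- by apply: eq_integral => t _; rewrite modulus_sqr EFinD.
- by move=> t _; rewrite lee_fin sqr_ge0.
- exact: measurable_sqr.
- by move=> t _; rewrite lee_fin sqr_ge0.
- exact: measurable_sqr.
Qed.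

Lemma Lfun2P (f : R -> R) : f \in Lfun mu 2%:E <->
  measurable_fun setT f /\ (sqint f < +oo)%E.
Proof.
split=> [f2|[mf ff]].
  have := sub_Lfun_mfun f2; rewrite inE/= => mf; split => //.
  have /integrableP[_] := Lfun2_integrable_sqr f2.
  by under eq_integral do rewrite /= ger0_norm ?sqr_ge0//.
rewrite inE; apply/andP; split; rewrite inE/=//.
rewrite /finite_norm unlock /= poweR_lty//.
under eq_integral => t _ do rewrite powR_mulrn// real_normK ?num_real//.
exact: ff.
Qed.

Lemma L2P f : L2 f <->
  [/\ measurable_fun setT (re \o f), measurable_fun setT (im \o f),
     (sqint (re \o f) < +oo)%E & (sqint (im \o f) < +oo)%E].
Proof.
rewrite /L2; split=> [[/Lfun2P[? ?] /Lfun2P[? ?]]|[? ? ? ?]]; first by split.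
by split; apply/Lfun2P.
Qed.

Lemma re_bilateral (u : int -> R[i]) N : re (bilateral_psum u N) = psum (fun k => re (u k)) N.
Proof. by rewrite /bilateral_psum raddf_sum. Qed.

Lemma im_bilateral (u : int -> R[i]) N : im (bilateral_psum u N) = psum (fun k => im (u k)) N.
Proof. by rewrite /bilateral_psum raddf_sum. Qed.

Lemma ell2P c : ell2 c <-> l2 (fun k => re (c k)) /\ l2 (fun k => im (c k)).
Proof.
have E : (\esum_(k in [set: int]) `|(modulus (c k) ^+ 2)%:E| =
  \esum_(k in [set: int]) (modulus (c k) ^+ 2)%:E)%E.
  by apply: eq_esum => k _; rewrite gee0_abs// lee_fin sqr_ge0.
rewrite /ell2 /summable E; split.
  move=> /(esum_lty_asum (fun k => sqr_ge0 _)) a.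
  split; apply: asum_le a => k; rewrite ger0_norm ?sqr_ge0// modulus_sqr.
    by rewrite lerDl sqr_ge0.
  by rewrite lerDr sqr_ge0.
move=> [a b]; rewrite esum_zsum ?ltry// => [k|]; first exact: sqr_ge0.
by have := asumD a b; congr asum; apply/funext => k; rewrite modulus_sqr.
Qed.

Lemma ell2_norm_sqE c : ell2 c ->
  ell2_norm_sq c = (normsq (fun k => re (c k)) + normsq (fun k => im (c k)))%:E.
Proof.
move=> /ell2P[a b]; rewrite /ell2_norm_sq -zsumD//.
rewrite esum_zsum => [|k|]; last 2 first.
- exact: sqr_ge0.
- by have := asumD a b; congr asum; apply/funext => k; rewrite modulus_sqr.
by congr (_%:E); apply: eq_zsum => k; rewrite modulus_sqr.
Qed.

End Complex.

Section SqintLimits.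
Context {R : realType}.
Implicit Types (f h : R -> R).

(** Two L2 limits of the same sequence have the same norm; only an inequality is
stated since f and h play symmetric roles. *)
Lemma sqint_lim_le (P_ : nat -> R -> R) f h :
  (forall n, measurable_fun setT (P_ n)) ->
  measurable_fun setT f -> measurable_fun setT h ->
  (sqint h < +oo)%E ->
  sqint (fun t => P_ n t - f t) @[n --> \oo] --> 0%E ->
  sqint (fun t => P_ n t - h t) @[n --> \oo] --> 0%E ->
  (sqint f <= sqint h)%E.
Proof.
move=> mP mf mh hfin cf ch.
have [r hE] : exists r, sqint h = r%:E.
  by exists (fine (sqint h)); rewrite fineK// ge0_fin_numE ?sqint_ge0.
pose a n := sqint (fun t => P_ n t - f t); pose b n := sqint (fun t => P_ n t - h t).
have key e : 0 < e -> (sqint f <= ((1 + e) ^+ 2 * r)%:E)%E.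
  move=> e0.
  have e1 : (0 : R) <= 1 + e by rewrite addr_ge0// ltW.
  have e2 : (0 : R) <= 1 + e^-1 by rewrite addr_ge0// invr_ge0 ltW.
  have main n : (sqint f <= ((1 + e) ^+ 2 * r)%:E +
     ((1 + e)%:E * ((1 + e^-1)%:E * b n) + (1 + e^-1)%:E * a n))%E.
    have -> : f = fun t => P_ n t + - (P_ n t - f t) by apply/funext => t; ring.
    apply: le_trans (sqintD_eps e0 (mP n) _) _.
      by apply: measurable_funN; exact: measurable_funB.
    have -> : sqint (fun t => - (P_ n t - f t)) = a n.
      by apply: eq_integral => t _; rewrite sqrrN.
    rewrite addeA; apply: leeD2r.
    have {1}-> : P_ n = fun t => h t + (P_ n t - h t) by apply/funext => t; ring.
    apply: le_trans (lee_wpmul2l _ (sqintD_eps e0 mh (measurable_funB (mP n) mh))) _.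
      by rewrite lee_fin.
    rewrite muleDr//; last first.
      by apply: ge0_adde_def; rewrite inE mule_ge0// ?lee_fin// sqint_ge0.
    rewrite le_eqVlt; apply/orP; left; apply/eqP; congr (_ + _)%E.
    by rewrite hE -!EFinM mulrA.
  rewrite -[leRHS]adde0.
  have lim0 : (((1 + e) ^+ 2 * r)%:E +
     ((1 + e)%:E * ((1 + e^-1)%:E * b n) + (1 + e^-1)%:E * a n))%E @[n --> \oo]
     --> (((1 + e) ^+ 2 * r)%:E + 0)%E.
    apply: cvgeD => //; first exact: cvg_cst.
    rewrite -[X in _ --> X]adde0; apply: cvgeD => //.
      rewrite -[X in _ --> X](mule0 (1 + e)%:E); apply: cvgeZl => //.
      by rewrite -[X in _ --> X](mule0 (1 + e^-1)%:E); apply: cvgeZl.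
    by rewrite -[X in _ --> X](mule0 (1 + e^-1)%:E); apply: cvgeZl.
  rewrite -(cvg_lim _ lim0)//; apply: lime_ge; first by apply: cvgP lim0.
  exact: nearW.
have ffin : sqint f = (fine (sqint f))%:E.
  by rewrite fineK// ge0_fin_numE ?sqint_ge0// (le_lt_trans (key 1 ltr01))// ltry.
rewrite ffin hE lee_fin; apply: le_eps_sqr; first by rewrite -lee_fin -hE sqint_ge0.
by move=> e e0; rewrite -lee_fin -ffin; exact: key.
Qed.

End SqintLimits.

(** * Extremal Riesz bounds *)

Section RieszGeneral.
Context {R : realType}.
Local Notation mu := (@lebesgue_measure R).
Local Open Scope complex_scope.
Local Notation re := (@complex.Re R).
Local Notation im := (@complex.Im R).
Implicit Types (f h : R -> R[i]) (u psi : int -> R -> R[i]).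

Lemma norm_re_le (z : R[i]) : `|re z| <= modulus z.
Proof.
rewrite -ler_sqr ?nnegrE ?modulus_ge0// real_normK ?num_real// modulus_sqr.
by rewrite lerDl sqr_ge0.
Qed.

Lemma norm_im_le (z : R[i]) : `|im z| <= modulus z.
Proof.
rewrite -ler_sqr ?nnegrE ?modulus_ge0// real_normK ?num_real// modulus_sqr.
by rewrite lerDr sqr_ge0.
Qed.

Lemma modulus_realC (x : R) : modulus x%:C = `|x|.
Proof. by rewrite /modulus/= expr0n/= addr0 sqrtr_sqr. Qed.

Lemma re_mulC (z : R[i]) (x : R) : re (z * x%:C) = re z * x.
Proof. by case: z => a b /=; rewrite mulr0 subr0. Qed.

Lemma im_mulC (z : R[i]) (x : R) : im (z * x%:C) = im z * x.
Proof. by case: z => a b /=; rewrite mulr0 add0r. Qed.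

Lemma squeeze_ereal0 (x y : nat -> \bar R) :
  (\forall n \near \oo, (0 <= x n <= y n)%E) ->
  y n @[n --> \oo] --> 0%E -> x n @[n --> \oo] --> 0%E.
Proof. by move=> xy yc; apply: (squeeze_cvge xy) yc; exact: cvg_cst. Qed.

Lemma sqre_cvg0 (x : nat -> \bar R) : (forall n, 0 <= x n)%E ->
  x n @[n --> \oo] --> 0%E <-> (x n ^+ 2)%E @[n --> \oo] --> 0%E.
Proof.
move=> x0; split=> [xc|xc].
  have x1 : \forall n \near \oo, (x n <= 1)%E.
    have /fine_cvgP[fin /cvgrPdist_le/(_ _ ltr01) h] := xc.
    near=> n; have fn : x n \is a fin_num by near: n.
    rewrite -(fineK fn) lee_fin.
    have : `|0 - fine (x n)| <= 1 by near: n.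
    by rewrite sub0r normrN; apply: le_trans; exact: ler_norm.
  apply: squeeze_ereal0 xc.
  near=> n; apply/andP; split; first exact: sqre_ge0.
  rewrite expe2 -[leRHS]mul1e.
  by apply: lee_wpmul2r => //; near: n.
have [fin h] : (\forall n \near \oo, (x n ^+ 2)%E \is a fin_num) /\
    fine (x n ^+ 2)%E @[n --> \oo] --> (0 : R).
  by have /fine_cvgP[] := xc.
apply/fine_cvgP; split.
  near=> n; have : (x n ^+ 2)%E \is a fin_num by near: n.
  by case: (x n) (x0 n).
have h2 : Num.sqrt (fine (x n ^+ 2)%E) @[n --> \oo] --> (0 : R).
  by rewrite -sqrtr0; apply: continuous_cvg => //; exact: sqrt_continuous.
apply: cvg_trans h2; apply: near_eq_cvg; near=> n.
have : (x n ^+ 2)%E \is a fin_num by near: n.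
rewrite /=; case: (x n) (x0 n) => [r| |] //= r0 _.
by rewrite -expr2 sqrtr_sqr ger0_norm.
Unshelve. all: by end_near. Qed.

Lemma measurable_re_mul (z : R[i]) f : measurable_fun setT (re \o f) ->
  measurable_fun setT (im \o f) ->
  measurable_fun setT (fun t => re (z * f t)) /\ measurable_fun setT (fun t => im (z * f t)).
Proof.
move=> mre mim; case: z => a b.
have -> : (fun t => re ((a +i* b) * f t)) = (fun t => a * (re \o f) t - b * (im \o f) t).
  by apply/funext => t /=; case: (f t).
have -> : (fun t => im ((a +i* b) * f t)) = (fun t => a * (im \o f) t + b * (re \o f) t).
  by apply/funext => t /=; case: (f t).
by split; [apply: measurable_funB|apply: measurable_funD]; apply: measurable_funM.
Qed.

Lemma L2_sum_unique (c : int -> R[i]) psi f h : (forall k, L2 (psi k)) ->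
  is_L2_sum (fun k t => c k * psi k t) f -> is_L2_sum (fun k t => c k * psi k t) h ->
  (L2norm f ^+ 2 = L2norm h ^+ 2)%E.
Proof.
move=> L2psi [L2f cf] [L2h ch].
pose P n t : R[i] := bilateral_psum (fun k => c k * psi k t) n.
have mP n : measurable_fun setT (re \o P n) /\ measurable_fun setT (im \o P n).
  have m k := measurable_re_mul (c k) (let: And4 a _ _ _ := (L2P (psi k)).1 (L2psi k) in a)
     (let: And4 _ a _ _ := (L2P (psi k)).1 (L2psi k) in a).
  split.
    rewrite (_ : re \o P n = fun t => psum (fun k => re (c k * psi k t)) n); last first.
      by apply/funext => t /=; rewrite re_bilateral.
    by apply: measurable_psum => k; have [] := m k.
  rewrite (_ : im \o P n = fun t => psum (fun k => im (c k * psi k t)) n); last first.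
    by apply/funext => t /=; rewrite im_bilateral.
  by apply: measurable_psum => k; have [] := m k.
have split_cvg g : L2 g -> L2norm (fun t => P n t - g t) @[n --> \oo] --> 0%E ->
   sqint (fun t => (re \o P n) t - (re \o g) t) @[n --> \oo] --> 0%E /\
   sqint (fun t => (im \o P n) t - (im \o g) t) @[n --> \oo] --> 0%E.
  move=> /L2P[m1 m2 _ _] /sqre_cvg0 -/(_ (fun n => Lnorm_ge0 _ _ _)) cg.
  have E n : (L2norm (fun t => P n t - g t)%R ^+ 2 =
     sqint (fun t => (re \o P n) t - (re \o g) t)%R + sqint (fun t => (im \o P n) t - (im \o g) t)%R)%E.
    have E1 : re \o (fun t => P n t - g t) = fun t => (re \o P n) t - (re \o g) t.
      by apply/funext => t /=; case: (P n t) (g t) => ? ? [].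
    have E2 : im \o (fun t => P n t - g t) = fun t => (im \o P n) t - (im \o g) t.
      by apply/funext => t /=; case: (P n t) (g t) => ? ? [].
    rewrite L2norm_sqr; first by congr (sqint _ + sqint _)%E; [exact: E1|exact: E2].
      by rewrite [X in measurable_fun _ X]E1; apply: measurable_funB => //; have [] := mP n.
    by rewrite [X in measurable_fun _ X]E2; apply: measurable_funB => //; have [] := mP n.
  split; apply: squeeze_ereal0 cg; apply: nearW => n; apply/andP; split; try exact: sqint_ge0.
    by rewrite [leRHS]E leeDl// sqint_ge0.
  by rewrite [leRHS]E leeDr// sqint_ge0.
have [rf jf] := split_cvg f L2f cf; have [rh jh] := split_cvg h L2h ch.
have /L2P[mf1 mf2 ff1 ff2] := L2f; have /L2P[mh1 mh2 fh1 fh2] := L2h.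
rewrite !L2norm_sqr//; congr (_ + _)%E; apply/eqP; rewrite eq_le; apply/andP; split.
- by apply: (@sqint_lim_le _ (fun n => re \o P n)) => // n; have [] := mP n.
- by apply: (@sqint_lim_le _ (fun n => re \o P n)) => // n; have [] := mP n.
- by apply: (@sqint_lim_le _ (fun n => im \o P n)) => // n; have [] := mP n.
- by apply: (@sqint_lim_le _ (fun n => im \o P n)) => // n; have [] := mP n.
Qed.

Lemma L2norm_sqr_fin f : L2 f -> exists2 q : R, 0 <= q & (L2norm f ^+ 2 = q%:E)%E.
Proof.
move=> /L2P[m1 m2 f1 f2]; rewrite L2norm_sqr//.
exists (fine (sqint (re \o f)) + fine (sqint (im \o f))).
  by rewrite addr_ge0// fine_ge0// sqint_ge0.
by rewrite EFinD !fineK// ge0_fin_numE// sqint_ge0.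
Qed.

Lemma ell2_norm_sq_fin (c : int -> R[i]) : ell2 c ->
  exists2 n : R, 0 <= n & (ell2_norm_sq c = n%:E)%E.
Proof.
move=> ec; rewrite ell2_norm_sqE//; have /ell2P[a b] := ec.
by eexists; last reflexivity; rewrite addr_ge0// normsq_ge0.
Qed.

(** The supremum of the admissible lower bounds is admissible: for a fixed c the norm
of the sum does not depend on the witness f (L2_sum_unique), so all lower bounds
constrain the same number. It is therefore the value selected by the definition. *)
Lemma lower_riesz_constant_bounds psi A0 B0 A1 : riesz_bounds psi A0 B0 ->
  (forall A B, riesz_bounds psi A B -> A <= A1) ->
  A0 <= lower_riesz_constant psi <= A1.
Proof.
move=> rb ub; set S := [set A | exists B, riesz_bounds psi A B].
have hs : has_sup S by split; [exists A0, B0|exists A1 => A [B /ub]].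
have memS : S (sup S).
  have [A0_gt0 B0_gt0 L2psi bd] := rb.
  exists B0; split => //.
    by apply: lt_le_trans A0_gt0 _; apply: ub_le_sup; [exact: hs.2|exists B0].
  move=> c ec; have [f sf [_ fB]] := bd c ec; exists f => //; split => //.
  have [n n0 nE] := ell2_norm_sq_fin ec; have [L2f _] := sf.
  have [q q0 qE] := L2norm_sqr_fin L2f.
  rewrite nE qE -EFinM lee_fin.
  have key A : S A -> A * n <= q.
    move=> [B [_ _ _ bd']]; have [f' sf' [+ _]] := bd' c ec.
    by rewrite (L2_sum_unique L2psi sf' sf) nE qE -EFinM lee_fin.
  have [->|nn0] := eqVneq n 0; first by rewrite mulr0.
  have n1 : 0 < n by rewrite lt_neqAle eq_sym nn0.
  rewrite -ler_pdivlMr//; apply: ge_sup; first exact: hs.1.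
  by move=> A SA; rewrite ler_pdivlMr// key.
have : (S `&` ubound S) (lower_riesz_constant psi).
  apply: xgetPex; exists (sup S); split => //; exact: sup_upper_bound.
move=> [[B /ub ->] uS]; rewrite andbT; apply: uS; by exists B0.
Qed.

(** Same argument with the infimum of the admissible upper bounds, which is
positive because a unit sequence puts it above A0. *)
Lemma upper_riesz_constant_bounds psi A0 B0 B1 : riesz_bounds psi A0 B0 ->
  (forall A B, riesz_bounds psi A B -> B1 <= B) ->
  B1 <= upper_riesz_constant psi <= B0.
Proof.
move=> rb lb; set S := [set B | exists A, riesz_bounds psi A B].
have hs : has_inf S by split; [exists B0, A0|exists B1 => B [A /lb]].
have [A0_gt0 B0_gt0 L2psi bd] := rb.
have memS : S (inf S).
  exists A0.
  have key c n q f : ell2 c -> is_L2_sum (fun k t => c k * psi k t) f ->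
     ell2_norm_sq c = n%:E -> (L2norm f ^+ 2 = q%:E)%E -> forall B, S B -> q <= B * n.
    move=> ec sf nE qE B [A [_ _ _ bd']]; have [f' sf' [_ ]] := bd' c ec.
    by rewrite (L2_sum_unique L2psi sf' sf) nE qE -EFinM lee_fin.
  have inf_ge c n q f : ell2 c -> is_L2_sum (fun k t => c k * psi k t) f ->
     ell2_norm_sq c = n%:E -> 0 <= n -> (L2norm f ^+ 2 = q%:E)%E -> q <= inf S * n.
    move=> ec sf nE n0 qE.
    have [n00|nn0] := eqVneq n 0.
      have := key c n q f ec sf nE qE B0 (ex_intro _ A0 rb).
      by rewrite n00 !mulr0.
    have n1 : 0 < n by rewrite lt_neqAle eq_sym nn0.
    rewrite -ler_pdivrMr//; apply: lb_le_inf; first exact: hs.1.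
    by move=> B SB; rewrite ler_pdivrMr// (key c n q f).
  split => //.
    apply: (@lt_le_trans _ _ A0) => //.
    pose c (k : int) : R[i] := (delta k)%:C.
    have ec : ell2 c.
      apply/ell2P; split.
        have := @asum_delta R; congr asum; apply/funext => k /=.
        by rewrite /delta; case: eqP; rewrite ?expr1n ?expr0n.
      by apply: (@l2_bound _ _ 0) => N; rewrite psumE big1// => i _; rewrite expr0n.
    have [f sf [fA fB]] := bd c ec.
    have nE : ell2_norm_sq c = 1%:E.
      rewrite ell2_norm_sqE// [X in (_ + X)%:E]normsq_0// addr0; congr (_%:E).
      rewrite -(zsum_deltaM (fun=> 1)); apply: eq_zsum => k /=.
      by rewrite /delta; case: eqP; rewrite ?expr1n ?expr0n ?mul1r.
    have [q q0 qE] := L2norm_sqr_fin (let: conj a _ := sf in a).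
    have := inf_ge c 1 q f ec sf nE ler01 qE.
    move: fA; rewrite nE qE -EFinM lee_fin !mulr1; exact: le_trans.
  move=> c ec; have [f sf [fA fB]] := bd c ec; exists f => //; split => //.
  have [n n0 nE] := ell2_norm_sq_fin ec; have [L2f _] := sf.
  have [q q0 qE] := L2norm_sqr_fin L2f.
  by rewrite nE qE -EFinM lee_fin (inf_ge c n q f).
have : (S `&` lbound S) (upper_riesz_constant psi).
  apply: xgetPex; exists (inf S); split => //; apply: ge_inf; exact: hs.2.
move=> [[A /lb ->] uS]; apply: uS; by exists A0.
Qed.

End RieszGeneral.

(** * Finite combinations of shifts *)

Section L2psum.
Context {R : realType}.
Implicit Types (u v b d : int -> R).

Lemma l2_psum (F : int -> int -> R) N : (forall k, l2 (F k)) ->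
  l2 (fun j => psum (fun k => F k j) N).
Proof.
move=> lF; elim: N => [|N IH].
  by have -> : (fun j => psum (fun k => F k j) 0) = F 0; [apply/funext => j; rewrite psum0|].
have -> : (fun j => psum (fun k => F k j) N.+1) =
  (fun j => psum (fun k => F k j) N + F (Posz N.+1) j + F (- Posz N.+1) j).
  by apply/funext => j; rewrite psumS.
by apply: l2D => //; exact: l2D.
Qed.

Lemma l2_shift u k : l2 u -> l2 (fun j => u (j - k)).
Proof. by move=> lu; exact: (asum_shift (- k) lu). Qed.

Lemma zconv_shift (p d : int -> R) k n : asum p -> l2 d ->
  zconv p (fun j => d (j - k)) n = zconv p d (n - k).
Proof.
move=> ap ld; rewrite /zconv -(zsum_shift k).
  by apply: eq_zsum => j; rewrite addrK; congr (p _ * _); lia.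
by apply: asum_zconv_l2 => //; exact: l2_shift.
Qed.

Lemma zconv_psum (p : int -> R) (F : int -> int -> R) N n : asum p ->
  (forall k, l2 (F k)) ->
  zconv p (fun j => psum (fun k => F k j) N) n = psum (fun k => zconv p (F k) n) N.
Proof.
move=> ap lF; have [|_ <-] := @zsum_psum R (fun k l => p (n - l) * F k l) N.
  by move=> k; exact: asum_zconv_l2.
by apply: eq_zsum => l; rewrite psumZ.
Qed.

(** Gives summability of samples and uniform control of shifts for every kernel
decaying like 1 / (1 + t^2). *)
Lemma asum_inv_sqr : asum (fun k : int => (1 + k%:~R ^+ 2)^-1 : R).
Proof.
exists 5 => N; apply: (@le_trans _ _ (5 - 4 / N.+1%:R)); last first.
  by rewrite gerBl divr_ge0.
elim: N => [|N IH].
  by rewrite psum0 expr0n/= addr0 invr1 normr1; lra.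
rewrite psumS !ger0_norm ?invr_ge0 ?addr_ge0 ?sqr_ge0//.
rewrite rmorphN/= sqrrN.
have n1 : (0 : R) < N.+1%:R by rewrite ltr0n.
have n2 : (0 : R) < N.+2%:R by rewrite ltr0n.
suff : 2 * (1 + (Posz N.+1)%:~R ^+ 2)^-1 <= 4 / N.+1%:R - 4 / N.+2%:R :> R.
  move: IH; set P := psum _ _; set a := (_ ^-1); set y := 4 / N.+1%:R; set z := 4 / N.+2%:R.
  by clearbody P a y z => *; lra.
have E : N.+2%:R = N.+1%:R + 1 :> R by rewrite -natr1.
rewrite -[(Posz N.+1)%:~R]/(N.+1%:R : R).
rewrite E in n2 *; set x := N.+1%:R in n1 n2 *.
have x1 : 1 <= x by rewrite /x ler1n.
have -> : 4 / x - 4 / (x + 1) = 4 / (x * (x + 1)) by field; rewrite !gt_eqF.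
rewrite ler_pdivlMr ?mulr_gt0// mulrC mulrA ler_pdivrMr; nra.
Qed.

End L2psum.

(** * Riesz constants of the nod function of a kernel *)

Section Shifts.
Context {R : realType}.
Local Notation mu := (@lebesgue_measure R).
Implicit Types (u v b d c : int -> R) (N : nat).
Variables (phi : R -> R) (K : R) (g : int -> R).
Hypothesis phi_cont : continuous phi.
Hypothesis phi_even : forall t, phi (- t) = phi t.
Hypothesis phi_ge0 : forall t, 0 <= phi t.
Hypothesis phi_le : forall t, phi t <= K / (1 + t ^+ 2).
Hypothesis phi_int : forall k l : int,
  (\int[mu]_t (phi (t - k%:~R) * phi (t - l%:~R))%:E = (g (k - l))%:E)%E.

Let p (k : int) : R := phi k%:~R.
Let K_ge0 : 0 <= K.
Proof. by have := le_trans (phi_ge0 0) (phi_le 0); rewrite expr0n/= addr0 divr1. Qed.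

Lemma phi_shift_asum t : asum (fun k : int => phi (t - k%:~R)).
Proof.
apply: asum_le (asumZ (K * (2 + 2 * t ^+ 2)) asum_inv_sqr) => k.
rewrite ger0_norm//; apply: le_trans (phi_le _) _.
rewrite -mulrA ler_wpM2l//.
set x := k%:~R.
have h1 : 0 < 1 + x ^+ 2 by have := sqr_ge0 x; lra.
have h2 : 0 < 1 + (t - x) ^+ 2 by have := sqr_ge0 (t - x); lra.
rewrite ler_pdivlMr// mulrC ler_pdivrMr//.
have := sqr_ge0 (x - 2 * (t)); have := sqr_ge0 (t * (t - x)); nra.
Qed.

Lemma p_even k : p (- k) = p k.
Proof. by rewrite /p rmorphN /= phi_even. Qed.

Lemma p_ge0 k : 0 <= p k. Proof. exact: phi_ge0. Qed.

Lemma p_sum : asum p.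
Proof.
by have := phi_shift_asum 0; under eq_fun do rewrite sub0r phi_even.
Qed.

(** The function sum_k b_k phi (t - k), as a pointwise sum. *)
Definition shiftsum b t := zsum (fun k => b k * phi (t - k%:~R)).
Local Notation S := shiftsum.

Lemma asum_S b t : l2 b -> asum (fun k => b k * phi (t - k%:~R)).
Proof.
by move=> lb; apply: (asumM _ (phi_shift_asum t)) => k; exact: l2_bounded.
Qed.

(** Sampling at the integers turns the shift sum into convolution by p; this is why the
nod function is governed by the inverse of p. *)
Lemma S_int b (n : int) : S b n%:~R = zconv p b n.
Proof. by apply: eq_zsum => k; rewrite mulrC /p intrB. Qed.

Lemma S_D u v t : l2 u -> l2 v -> S (fun k => u k + v k) t = S u t + S v t.
Proof.
move=> lu lv; rewrite /S -zsumD; [|exact: asum_S..].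
by apply: eq_zsum => k; rewrite mulrDl.
Qed.

Lemma S_Z (c : R) u t : l2 u -> S (fun k => c * u k) t = c * S u t.
Proof.
move=> lu; rewrite /S -zsumZ; last exact: asum_S.
by apply: eq_zsum => k; rewrite mulrA.
Qed.

Lemma S_N u t : l2 u -> S (fun k => - u k) t = - S u t.
Proof.
move=> lu; rewrite /S -zsumN; last exact: asum_S.
by apply: eq_zsum => k; rewrite mulNr.
Qed.

Lemma S_B u v t : l2 u -> l2 v -> S (fun k => u k - v k) t = S u t - S v t.
Proof. by move=> lu lv; rewrite S_D ?S_N//; exact: l2N. Qed.

Lemma S_psum (F : int -> int -> R) N t : (forall k, l2 (F k)) ->
  S (fun j => psum (fun k => F k j) N) t = psum (fun k => S (F k) t) N.
Proof.
move=> lF; have [|_ <-] := @zsum_psum R (fun k l => F k l * phi (t - l%:~R)) N.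
  by move=> k; exact: asum_S.
by apply: eq_zsum => l; rewrite psumZr.
Qed.

Lemma S_shift d (k : int) t : l2 d -> S d (t - k%:~R) = S (fun j => d (j - k)) t.
Proof.
move=> ld; rewrite /S -[RHS](zsum_shift k); last by apply: asum_S; exact: l2_shift.
apply: eq_zsum => j; rewrite addrK; congr (_ * phi _).
by rewrite intrD opprD addrA addrAC.
Qed.

Lemma S_trunc b N t : S (trunc N b) t = psum (fun k => b k * phi (t - k%:~R)) N.
Proof.
have [|_] := @zsum_fin R (fun k => trunc N b k * phi (t - k%:~R)) N.
  by move=> k Nk; rewrite /trunc leqNgt Nk mul0r.
rewrite -/(shiftsum _ _) => ->.
by apply: eq_psum_in => k kN; rewrite /trunc kN.
Qed.

Lemma S_trunc_cvg b t : l2 b -> S (trunc N b) t @[N --> \oo] --> S b t.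
Proof.
move=> lb; apply: (eq_cvgn _ (asum_cvg (asum_S t lb))) => N.
by rewrite S_trunc.
Qed.

Lemma measurable_phi_shift (k : int) : measurable_fun setT (fun t : R => phi (t - k%:~R)).
Proof.
apply: measurableT_comp; first exact: continuous_measurable_fun.
exact: measurable_funB.
Qed.

Lemma measurable_S_trunc b N : measurable_fun setT (S (trunc N b)).
Proof.
rewrite (_ : S _ = fun t => psum (fun k => b k * phi (t - k%:~R)) N); last first.
  by apply/funext => t; rewrite S_trunc.
apply: measurable_psum => k; apply: measurable_funM => //.
exact: measurable_phi_shift.
Qed.

Lemma measurable_S b : l2 b -> measurable_fun setT (S b).
Proof.
move=> lb; apply: (@measurable_fun_cvg _ _ _ setT (fun N => S (trunc N b))).
  by move=> N; exact: measurable_S_trunc.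
by move=> t _; exact: S_trunc_cvg.
Qed.

Lemma has_int_phi (k l : int) :
  has_int (fun t => phi (t - k%:~R) * phi (t - l%:~R)) (g (k - l)).
Proof.
split; last exact: phi_int.
apply/integrableP; split.
  apply/measurable_EFinP; apply: measurable_funM; exact: measurable_phi_shift.
under eq_integral do rewrite /= ger0_norm ?mulr_ge0//.
by rewrite phi_int ltry.
Qed.

(** The Gram matrix of the shifts is Toeplitz with coefficients g. *)
Lemma sqint_S_trunc b N : sqint (S (trunc N b)) = (Form g b N)%:E.
Proof.
suff [] : has_int (fun t => S (trunc N b) t ^+ 2) (Form g b N) by [].
rewrite (_ : (fun t => _) = fun t => psum (fun k => psum (fun l =>
   b k * b l * (phi (t - k%:~R) * phi (t - l%:~R))) N) N); last first.
  apply/funext => t; rewrite S_trunc expr2 -psumZr; apply: eq_psum => k.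
  by rewrite -psumZ; apply: eq_psum => l; ring.
by apply: has_int_psum => k; apply: has_int_psum => l; apply/has_intZ/has_int_phi.
Qed.

Variables m A0 B0 : R.
Hypothesis m_gt0 : 0 < m.
Hypothesis coercive : forall b N, m * psum (fun k => b k ^+ 2) N <= Form p b N.
Hypothesis A0_gt0 : 0 < A0.
Hypothesis Form_g_ge : forall b N, A0 * Form (zconv p p) b N <= Form g b N.
Hypothesis Form_g_le : forall b N, Form g b N <= B0 * Form (zconv p p) b N.

Let M := zsum p.
Let CS := B0 * M ^+ 2.

(** A one-point window has positive squared norm, hence a positive autocorrelation
form, and the two comparisons of forms squeeze it. *)
Lemma upper_bound_gt0 : 0 < B0.
Proof.
have h1 := Form_g_ge (fun=> 1) 0; have h2 := Form_g_le (fun=> 1) 0.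
have [_ e] := zconv_trunc_sqr p_even p_sum (fun=> 1) 0.
have h3 : 0 < Form (zconv p p) (fun=> 1) 0.
  have := normsq_le_zconv p_ge0 p_even p_sum m_gt0 coercive (l2_trunc (fun=> 1) 0).
  rewrite e normsq_trunc psum0 expr1n; set I := inverse_bound _ _.
  have I0 : 0 <= I by exact: (inverse_bound_ge0 p_ge0 p_even p_sum m_gt0 coercive).
  nra.
have := lt_le_trans (mulr_gt0 A0_gt0 h3) (le_trans h1 h2).
by rewrite pmulr_lgt0.
Qed.

Lemma sqint_S_le b : l2 b -> (sqint (S b) <= (CS * normsq b)%:E)%E.
Proof.
move=> lb; apply: (@sqint_fatou _ (fun N => S (trunc N b))).
- by move=> N; exact: measurable_S_trunc.
- by move=> t; exact: S_trunc_cvg.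
- move=> N; rewrite sqint_S_trunc lee_fin; apply: le_trans (Form_g_le _ _) _.
  rewrite /CS -mulrA ler_pM2l ?upper_bound_gt0//.
  have [_ <-] := zconv_trunc_sqr p_even p_sum b N.
  apply: le_trans (normsq_zconv_trunc_le p_ge0 p_even p_sum b N) _.
  by rewrite ler_wpM2l ?sqr_ge0// psum_le_normsq.
Qed.

(** The squared L2 norm of the shift sum as a real number; it is finite by sqint_S_le. *)
Definition sqS b := fine (sqint (S b)).

Lemma sqSE b : l2 b -> sqint (S b) = (sqS b)%:E.
Proof.
move=> lb; rewrite /sqS fineK// ge0_fin_numE ?sqint_ge0//.
by apply: le_lt_trans (sqint_S_le lb) _; rewrite ltry.
Qed.

Lemma quadlike_sqS : quadlike CS sqS.
Proof.
split.
- by move=> u lu; rewrite -lee_fin -sqSE// sqint_ge0.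
- by move=> u lu; rewrite -lee_fin -sqSE// sqint_S_le.
- move=> ep u v e0 lu lv; rewrite -lee_fin EFinD !EFinM -!sqSE//; last exact: l2D.
  rewrite (_ : S (fun k => u k + v k) = fun t => S u t + S v t).
    by apply: sqintD_eps => //; exact: measurable_S.
  by apply/funext => t; rewrite S_D.
Qed.

Lemma quadlike_zconv (c : R) : 0 <= c -> quadlike (c * M ^+ 2) (fun b => c * normsq (zconv p b)).
Proof.
move=> c0; split.
- by move=> u lu; apply: mulr_ge0 => //; apply: normsq_ge0; exact: (l2_zconv p_ge0 p_even p_sum).
- by move=> u lu; rewrite -mulrA ler_wpM2l// (normsq_zconv_le p_ge0 p_even p_sum lu).2.
- move=> ep u v e0 lu lv.
  have -> : zconv p (fun k => u k + v k) = fun n => zconv p u n + zconv p v n.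
    by apply/funext => n; rewrite zconvD//; exact: p_sum.
  have := ler_wpM2l c0 (normsqD_eps e0 (l2_zconv p_ge0 p_even p_sum lu) (l2_zconv p_ge0 p_even p_sum lv)).
  lra.
Qed.

Lemma sqS_trunc b N : sqS (trunc N b) = Form g b N.
Proof. by rewrite /sqS sqint_S_trunc. Qed.

Lemma sqS_ge b : l2 b -> A0 * normsq (zconv p b) <= sqS b.
Proof.
apply: (quadlike_le (quadlike_zconv (ltW A0_gt0)) quadlike_sqS) => u N.
by have [_ ->] := zconv_trunc_sqr p_even p_sum u N; rewrite sqS_trunc.
Qed.

Lemma sqS_le b : l2 b -> sqS b <= B0 * normsq (zconv p b).
Proof.
apply: (quadlike_le quadlike_sqS (quadlike_zconv (ltW upper_bound_gt0))) => u N.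
by have [_ ->] := zconv_trunc_sqr p_even p_sum u N; rewrite sqS_trunc.
Qed.

(** The partial sums of sum_k c_k (S d) (. - k) are shift sums of some bN with p*bN
equal to the truncation of c. So bN - b is the preimage of minus the tail of c, and
its norm is controlled by the inverse of p. *)
Lemma sqint_expansion d b c N : l2 d -> l2 b -> l2 c ->
  (forall n, zconv p d n = delta n) -> (forall n, zconv p b n = c n) ->
  (sqint (fun t => psum (fun k => c k * S d (t - k%:~R)) N - S b t)%R <=
   (CS * (inverse_bound p m * normsq (fun k => c k - trunc N c k)))%:E)%E.
Proof.
move=> ld lb lc dd bc.
(* the coefficients of the N-th partial sum in the shifts of phi itself *)
pose bN j := psum (fun k => c k * d (j - k)) N.
have lF k : l2 (fun j => c k * d (j - k)) by apply/l2Z/l2_shift.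
have lbN : l2 bN by exact: (l2_psum _ lF).
have cbN n : zconv p bN n = trunc N c n.
  rewrite /bN zconv_psum//; last exact: p_sum.
  have E k : zconv p (fun j => c k * d (j - k)) n = c k * delta (n - k).
    rewrite zconvZ; [|exact: p_sum|exact: l2_shift].
    by rewrite zconv_shift ?dd//; exact: p_sum.
  rewrite (eq_psum _ E) /trunc; case: leqP => h; first by rewrite psum_delta.
  rewrite psumE big1// => i _; rewrite /delta; case: eqP => [?|]; rewrite ?mulr0//.
  by exfalso; have := ltn_ord i; lia.
have lB := l2B lbN lb.
rewrite (_ : (fun t => _) = S (fun j => bN j - b j)); last first.
  apply/funext => t; rewrite S_B// /bN S_psum//; congr (_ - _).
  by apply: eq_psum => k; rewrite S_Z ?S_shift//; exact: l2_shift.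
apply: le_trans (sqint_S_le lB) _; rewrite lee_fin.
have CS0 : 0 <= CS by rewrite mulr_ge0 ?sqr_ge0// ltW ?upper_bound_gt0.
apply: ler_wpM2l => //.
apply: le_trans (normsq_le_zconv p_ge0 p_even p_sum m_gt0 coercive lB) _.
rewrite le_eqVlt; apply/orP; left; apply/eqP; congr (_ * _).
rewrite -normsqN; apply: eq_zsum => n; congr (_ ^+ 2).
by rewrite zconvB//; [rewrite cbN bc opprB|exact: p_sum].
Qed.


Local Open Scope complex_scope.
Local Notation re := (@complex.Re R).
Local Notation im := (@complex.Im R).
Local Notation phiC := (fun t => (phi t)%:C).

Lemma l2_delta : l2 (@delta R).
Proof.
have := @asum_delta R; congr asum; apply/funext => k.
by rewrite /delta; case: eqP; rewrite ?expr1n ?expr0n.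
Qed.

Lemma l2_0 : l2 (fun=> 0 : R).
Proof. by apply: (@l2_bound _ _ 0) => N; rewrite psumE big1// => i _; rewrite expr0n. Qed.

Section Dual.
Variable d : int -> R.
Hypothesis ld : l2 d.
Hypothesis dd : forall n, zconv p d n = delta n.
Let f0 t : R[i] := (S d t)%:C.

Lemma dual_is_nod : is_nod_function phiC f0.
Proof.
split; last first.
  move=> k; rewrite /f0 S_int dd /delta.
  by case: (k == 0) => //=; rewrite raddf0.
exists (fun k => (d k)%:C).
  by apply/ell2P; split => //=; exact: l2_0.
move=> t; have h := asum_cvg (asum_S t ld).
have h2 : `|psum (fun k => d k * phi (t - k%:~R)) n - S d t| @[n --> \oo] --> (0 : R).
  apply/norm_cvg0P; rewrite -(subrr (S d t)); apply: cvgB => //; exact: cvg_cst.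
apply: eq_cvgn h2 => n; rewrite -modulus_realC; congr modulus.
apply/eqP; rewrite eq_complex; apply/andP; split; apply/eqP.
  rewrite !raddfB/= re_bilateral; congr (_ - _).
  by apply: eq_psum => k; rewrite /integer_shifts re_mulC.
rewrite !raddfB/= im_bilateral psumE big1 ?subrr// => i _.
by rewrite /integer_shifts im_mulC/= mul0r.
Qed.

(** Sampling at the integers shows that the coefficients of any nod function invert
the convolution by p; injectivity identifies them with d. *)
Lemma nod_unique f : is_nod_function phiC f -> f = f0.
Proof.
move=> [[c /ell2P[lr li] cv] fint].
have cvr t : re (f t) = S (fun k => re (c k)) t.
  apply/esym/zsum_eq.
  have h : psum (fun k => re (c k) * phi (t - k%:~R)) n - re (f t) @[n --> \oo] --> (0 : R).
    apply/norm_cvg0P; apply: (squeeze_cvgr _ (cvg_cst 0) (cv t)); apply: nearW => n.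
    rewrite normr_ge0/=; apply: le_trans (norm_re_le _).
    rewrite raddfB/= re_bilateral (@eq_psum _ _ (fun k => re (c k) * phi (t - k%:~R)))// => k.
    by rewrite /integer_shifts re_mulC.
  by apply/subr_cvg0; exact: h.
have cvi t : im (f t) = S (fun k => im (c k)) t.
  apply/esym/zsum_eq.
  have h : psum (fun k => im (c k) * phi (t - k%:~R)) n - im (f t) @[n --> \oo] --> (0 : R).
    apply/norm_cvg0P; apply: (squeeze_cvgr _ (cvg_cst 0) (cv t)); apply: nearW => n.
    rewrite normr_ge0/=; apply: le_trans (norm_im_le _).
    rewrite raddfB/= im_bilateral (@eq_psum _ _ (fun k => im (c k) * phi (t - k%:~R)))// => k.
    by rewrite /integer_shifts im_mulC.
  by apply/subr_cvg0; exact: h.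
have inj := zconv_inj p_ge0 p_even p_sum m_gt0 coercive.
have er : (fun k => re (c k)) =1 d.
  apply: inj => // n; rewrite dd -S_int -cvr fint /delta.
  by case: (n == 0).
have ei : (fun k => im (c k)) =1 (fun=> 0).
  apply: inj => //; first exact: l2_0.
  move=> n; rewrite -S_int -cvi fint.
  have -> : zconv p (fun=> 0) n = 0.
    by rewrite -[RHS](zsum_deltaM (fun=> 0)); apply: eq_zsum => k; rewrite mulr0 mul0r.
  by case: (n == 0).
apply/funext => t; apply/eqP; rewrite eq_complex cvr cvi/=; apply/andP; split; apply/eqP.
  by apply: eq_zsum => k; rewrite er.
by rewrite -[RHS](zsum_deltaM (fun=> 0)); apply: eq_zsum => k; rewrite ei !mul0r.
Qed.

Lemma nod_functionE : nod_function phiC = f0.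
Proof. by apply: nod_unique; apply: xgetPex; exists f0; exact: dual_is_nod. Qed.

Lemma L2_S (u v : int -> R) : l2 u -> l2 v -> L2 (fun t => S u t +i* S v t).
Proof.
move=> lu lv; apply/L2P; split.
- by have := measurable_S lu.
- by have := measurable_S lv.
- by have := sqSE lu => /= e; rewrite [X in (X < _)%E](_ : _ = sqint (S u)) // e ltry.
- by have := sqSE lv => /= e; rewrite [X in (X < _)%E](_ : _ = sqint (S v)) // e ltry.
Qed.

Lemma S_0 t : S (fun=> 0) t = 0.
Proof.
by rewrite -[RHS](zsum_deltaM (fun=> 0)); apply: eq_zsum => k; rewrite !mul0r.
Qed.

Lemma L2_dual_shift k : L2 (integer_shifts f0 k).
Proof.
have := L2_S (l2_shift k ld) l2_0; congr L2; apply/funext => t.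
by rewrite /integer_shifts /f0 S_0 S_shift.
Qed.

Lemma dual_expansion (c : int -> R[i]) u v : l2 u -> l2 v -> ell2 c ->
  (forall n, zconv p u n = re (c n)) -> (forall n, zconv p v n = im (c n)) ->
  is_L2_sum (fun k t => c k * integer_shifts f0 k t) (fun t => S u t +i* S v t).
Proof.
move=> lu lv /ell2P[lr li] ur vi; split; first exact: L2_S.
apply/sqre_cvg0; first by move=> n; exact: Lnorm_ge0.
pose E (w : int -> R) N := B0 * M ^+ 2 * (inverse_bound p m * normsq (fun k => w k - trunc N w k)).
have E0 w : l2 w -> E w n @[n --> \oo] --> (0 : R).
  move=> lw.
  suff : E w n @[n --> \oo] --> B0 * M ^+ 2 * (inverse_bound p m * 0) by rewrite !mulr0.
  by apply: cvgMl_tmp; apply: cvgMl_tmp; exact: normsq_tail.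
apply: (@squeeze_ereal0 _ _ (fun n => (E (fun k => re (c k)) n + E (fun k => im (c k)) n)%:E)); last first.
  apply: cvg_EFin; first exact: nearW.
  by rewrite -[X in _ --> X]addr0; apply: cvgD; exact: E0.
apply: nearW => n; apply/andP; split; first exact: sqre_ge0.
pose P t := bilateral_psum (fun k => c k * integer_shifts f0 k t) n - (S u t +i* S v t).
have reP : re \o P = fun t => psum (fun k => re (c k) * S d (t - k%:~R)) n - S u t.
  apply/funext => t /=; rewrite raddfB/= re_bilateral; congr (_ - _).
  by apply: eq_psum => k; rewrite /integer_shifts /f0 re_mulC.
have imP : im \o P = fun t => psum (fun k => im (c k) * S d (t - k%:~R)) n - S v t.
  apply/funext => t /=; rewrite raddfB/= im_bilateral; congr (_ - _).
  by apply: eq_psum => k; rewrite /integer_shifts /f0 im_mulC.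
have mS (w w' : int -> R) : l2 w -> measurable_fun setT (fun t : R => psum (fun k => w' k * S d (t - k%:~R)) n - S w t).
  move=> lw; apply: measurable_funB; last exact: (measurable_S lw).
  apply: measurable_psum => k; apply: measurable_funM => //.
  rewrite (_ : (fun t => _) = S (fun j => d (j - k))).
    by apply: measurable_S; exact: l2_shift.
  by apply/funext => t; rewrite S_shift.
rewrite -/P L2norm_sqr; [|by rewrite reP; exact: mS|by rewrite imP; exact: mS].
rewrite reP imP EFinD; apply: leeD; apply: sqint_expansion => //.
Qed.

(** With c = p*b the sum of the c_k nod(. - k) is the shift sum of b, so the inequalities
between the forms of g and of the autocorrelation of p are Riesz bounds. *)
Lemma riesz_bounds_dual : riesz_bounds (integer_shifts f0) A0 B0.
Proof.
split; [exact: A0_gt0|exact: upper_bound_gt0|exact: L2_dual_shift|].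
move=> c ec; have /ell2P[lr li] := ec.
have [u lu ur] := zconv_surj p_ge0 p_even p_sum m_gt0 coercive lr.
have [v lv vi] := zconv_surj p_ge0 p_even p_sum m_gt0 coercive li.
exists (fun t => S u t +i* S v t); first exact: dual_expansion.
have -> : (L2norm (fun t => S u t +i* S v t) ^+ 2 = (sqS u + sqS v)%:E)%E.
  rewrite L2norm_sqr; first by rewrite EFinD -!sqSE.
    by have := measurable_S lu.
  by have := measurable_S lv.
rewrite ell2_norm_sqE// -!EFinM !lee_fin !mulrDr.
have -> : normsq (fun k => re (c k)) = normsq (zconv p u) by apply: eq_zsum => n; rewrite ur.
have -> : normsq (fun k => im (c k)) = normsq (zconv p v) by apply: eq_zsum => n; rewrite vi.
by split; apply: lerD; rewrite ?sqS_ge// sqS_le.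
Qed.

(** The converse reading, at c = p*b for finitely supported b. *)
Lemma riesz_bounds_Form A B : riesz_bounds (integer_shifts f0) A B ->
  forall b N, A * Form (zconv p p) b N <= Form g b N /\
    Form g b N <= B * Form (zconv p p) b N.
Proof.
move=> [_ _ L2f bd] b N.
have [lc cE] := zconv_trunc_sqr p_even p_sum b N.
pose c k : R[i] := (zconv p (trunc N b) k)%:C.
have ec : ell2 c by apply/ell2P; split => //=; exact: l2_0.
have [f sf] := bd c ec.
have sf' := @dual_expansion c (trunc N b) (fun=> 0) (l2_trunc b N) l2_0 ec.
have {}sf' := sf' (fun=> erefl).
have z0 n : zconv p (fun=> 0) n = 0.
  by rewrite -[RHS](zsum_deltaM (fun=> 0)); apply: eq_zsum => k; rewrite mulr0 mul0r.
have {}sf' := sf' z0.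
rewrite (L2_sum_unique L2f sf sf') ell2_norm_sqE//.
have -> : (L2norm (fun t => S (trunc N b) t +i* S (fun=> 0) t)%R ^+ 2 = (Form g b N)%:E)%E.
  rewrite L2norm_sqr; last first.
  - by have := measurable_S l2_0.
  - by have := measurable_S (l2_trunc b N).
  rewrite -[RHS]adde0; congr (_ + _)%E; first exact: sqint_S_trunc.
  by rewrite /sqint integral0_eq// => t _; rewrite /= S_0 expr0n.
rewrite [X in (X + _)%:E](_ : _ = Form (zconv p p) b N); last by rewrite -cE.
by rewrite [X in (_ + X)%:E]normsq_0// addr0 -!EFinM !lee_fin.
Qed.

End Dual.

Hypothesis g_even : forall k, g (- k) = g k.
Hypothesis g_sum : asum g.

Let zsum_sgn_ge : m <= zsum (fun k => sgn k * p k).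
Proof. exact: coercive_le_symbol_pi p_even p_sum coercive. Qed.

(** The upper estimate is the value of G / P^2 at pi. *)
Lemma lower_nod_constant :
  A0 <= lower_riesz_constant (integer_shifts (nod_function phiC)) <=
    zsum (fun k => sgn k * g k) / zsum (fun k => sgn k * p k) ^+ 2.
Proof.
have [d ld dd] := zconv_surj p_ge0 p_even p_sum m_gt0 coercive l2_delta.
rewrite (nod_functionE ld dd).
apply: lower_riesz_constant_bounds (riesz_bounds_dual ld dd) _ => A B rb.
have s0 : 0 < zsum (fun k => sgn k * p k) := lt_le_trans m_gt0 zsum_sgn_ge.
rewrite ler_pdivlMr ?exprn_gt0// -(zsum_sgn_autocorr p_sum).
have ac : asum (zconv p p) := asum_zconv p_sum p_sum.
pose e k := A * (sgn k * zconv p p k) - sgn k * g k.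
have : zsum e <= 0.
  apply: (@Form1_bounded_zsum_le0 _ _ 0).
  - by move=> k; rewrite /e sgnN (autocorr_even p_even p_sum) g_even.
  - by apply: asumB; [apply/asumZ/asum_sgnM|exact: asum_sgnM].
  - move=> N; rewrite /e FormB FormZ -!Form_sgn subr_le0.
    by have [] := riesz_bounds_Form ld dd rb sgn N.
by rewrite /e zsumB ?zsumZ; [rewrite subr_le0|exact: asum_sgnM|apply/asumZ; exact: asum_sgnM|exact: asum_sgnM].
Qed.

(** The lower estimate is the value of G / P^2 at 0. *)
Lemma upper_nod_constant :
  zsum g / zsum p ^+ 2 <=
  upper_riesz_constant (integer_shifts (nod_function phiC)) <= B0.
Proof.
have [d ld dd] := zconv_surj p_ge0 p_even p_sum m_gt0 coercive l2_delta.
rewrite (nod_functionE ld dd).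
apply: upper_riesz_constant_bounds (riesz_bounds_dual ld dd) _ => A B rb.
have s0 : 0 < M := lt_le_trans m_gt0 (m_le_M p_ge0 p_even p_sum coercive).
rewrite ler_pdivrMr ?exprn_gt0// expr2 -zsum_zconv; [|exact: p_sum..].
have ac : asum (zconv p p) := asum_zconv p_sum p_sum.
pose e k := g k - B * zconv p p k.
have : zsum e <= 0.
  apply: (@Form1_bounded_zsum_le0 _ _ 0).
  - by move=> k; rewrite /e (autocorr_even p_even p_sum) g_even.
  - by apply: asumB => //; exact: asumZ.
  - move=> N; rewrite /e FormB FormZ subr_le0.
    by have [] := riesz_bounds_Form ld dd rb (fun=> 1) N.
by rewrite /e zsumB ?zsumZ//; [rewrite subr_le0|exact: asumZ].
Qed.

End Shifts.

(** * Theta sequences *)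

Section Theta.
Context {R : realType}.
Implicit Types (q x : R) (b u : int -> R) (N : nat).

Lemma sin_natmul_le (n : nat) (a : R) : `|sin (n%:R * a)| <= n%:R * `|sin a|.
Proof.
elim: n => [|n IH]; first by rewrite !mul0r sin0 normr0.
rewrite -natr1 !mulrDl !mul1r sinD.
apply: le_trans (ler_normD _ _) _; rewrite !normrM; apply: lerD.
  by apply: le_trans IH; rewrite ler_piMr// cos_max.
by rewrite ler_piMl// cos_max.
Qed.

Lemma cos_pi_shift (n : nat) (y : R) : cos (y + n%:R * pi) = (-1) ^+ n * cos y.
Proof.
elim: n y => [|n IH] y; first by rewrite mul0r addr0 mul1r.
rewrite -natr1 mulrDl mul1r addrA cosDpi IH exprS; ring.
Qed.

(** With x = pi + 2 a this reads sin^2 (k a) <= k^2 sin^2 a. *)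
Lemma cos_twist_ge (k : int) x :
  - (k%:~R ^+ 2 * (1 + cos x)) <= cos (k%:~R * x) - sgn k.
Proof.
wlog [n ->] : k / exists n : nat, k = n%:Z.
  move=> H; have [|n|n] := intP k; first exact: (H 0 (ex_intro _ 0%N erefl)).
    by apply: H; exists n.+1.
  rewrite rmorphN/= sqrrN mulNr cosN sgnN; apply: (H (Posz n.+1)); by exists n.+1.
pose a := (x - pi) / 2.
have xE : x = 2 * a + 1%:R * pi by rewrite /a; field.
have cosx : 1 + cos x = 2 * sin a ^+ 2.
  rewrite xE cos_pi_shift expr1 mulN1r -mulrC mulr_natr cos_mulr2n.
  have := cos2Dsin2 a; rewrite mulr2n; lra.
have cosnx : cos (n%:R * x) = sgn n * (1 - 2 * sin (n%:R * a) ^+ 2).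
  rewrite xE mulrDr mul1r cos_pi_shift /sgn /=; congr (_ * _).
  rewrite mulrCA mulrC mulr_natr cos_mulr2n.
  have := cos2Dsin2 (n%:R * a); rewrite mulr2n; lra.
rewrite -[n%:~R]/(n%:R : R) cosnx cosx.
have h : sin (n%:R * a) ^+ 2 <= n%:R ^+ 2 * sin a ^+ 2.
  rewrite -exprMn -real_normK ?num_real// -[leRHS]real_normK ?num_real// lerXn2r ?nnegrE//.
  by rewrite normrM (ger0_norm (ler0n _ n)) sin_natmul_le.
have h0 := sqr_ge0 (sin (n%:R * a) : R).
have [->|->] : sgn n = 1 :> R \/ sgn n = -1 :> R.
  by rewrite /sgn -signr_odd; case: odd; [right; rewrite expr1|left].
  nra.
nra.
Qed.

(** The coefficients of the theta function sum_k q^(k^2) exp (i k x). *)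
Definition gseq q (k : int) : R := q ^+ (absz k ^ 2).

Lemma gseq_even q k : gseq q (- k) = gseq q k.
Proof. by rewrite /gseq; congr (_ ^+ (_ ^ 2)); lia. Qed.

Lemma gseq_ge0 q k : 0 <= q -> 0 <= gseq q k. Proof. exact: exprn_ge0. Qed.

Lemma gseq_psum_le q N : 0 < q -> q < 1 -> psum (gseq q) N <= 1 + 2 * q / (1 - q).
Proof.
move=> q0 q1; apply: (@le_trans _ _ (1 + 2 * q * (1 - q ^+ N) / (1 - q))); last first.
  rewrite lerD2l ler_pM2r ?invr_gt0 ?subr_gt0//.
  have := exprn_ge0 N (ltW q0); have : 0 < 2 * q by lra.
  nra.
elim: N => [|N IH].
  by rewrite psum0 /gseq expr0 subrr mulr0 mul0r addr0.
rewrite psumS gseq_even.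
have h : gseq q (Posz N.+1) <= q * q ^+ N.
  by rewrite /gseq -exprS ler_wiXn2l ?ltW//= -mulnn leq_pmull.
have E : 2 * q * (1 - q ^+ N.+1) / (1 - q) = 2 * q * (1 - q ^+ N) / (1 - q) + 2 * (q * q ^+ N).
  by rewrite exprS; field; rewrite subr_eq0 gt_eqF.
by rewrite E; lra.
Qed.

Lemma asum_gseq q : 0 < q -> q < 1 -> asum (gseq q).
Proof.
move=> q0 q1; exists (1 + 2 * q / (1 - q)) => N.
under eq_psum do rewrite ger0_norm ?gseq_ge0 ?ltW//.
exact: gseq_psum_le.
Qed.

(** The value of the theta function at 0. *)
Definition gsum q := zsum (gseq q).
(** The value of the theta function at pi. *)
Definition gsumpi q := zsum (fun k => sgn k * gseq q k).

Lemma gsum_ge1 q : 0 < q -> q < 1 -> 1 <= gsum q.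
Proof.
move=> q0 q1; apply: le_trans (ge0_psum_le 0 _ (asum_gseq q0 q1)).
  by rewrite psum0 /gseq expr0.
by move=> k; rewrite gseq_ge0// ltW.
Qed.

(** Only the odd terms change sign, and the term k = 0 is 1. *)
Lemma gsumpi_ge q : 0 < q -> q < 1 -> 2 - gsum q <= gsumpi q.
Proof.
move=> q0 q1; have ag := asum_gseq q0 q1; have ap := asum_sgnM ag.
have -> : 2 = zsum (fun k => 2 * delta k) :> R by rewrite zsum_deltaM.
have ad : asum (fun k => 2 * delta k : R) by apply/asumZ/asum_delta.
rewrite -zsumB//; apply: ler_zsum => //; last exact: asumB.
move=> k; have gk := gseq_ge0 k (ltW q0).
rewrite /delta; case: eqP => [->|_]; first by rewrite /gseq /sgn /= !expr0; lra.
by rewrite mulr0 sub0r lerNl -mulNr ler_piMl// -(norm_sgn k) -normrN ler_norm.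
Qed.

(** The terms with |k| = 1 contribute 2 q in total, and each further pair takes away at
most half of what is left. *)
Lemma gseq_weighted_sum q N : 0 < q -> q <= 8^-1 ->
  2 * q / 2 ^+ N <= psum (fun k => (2 * q) * (absz k == 1%N)%:R - k%:~R ^+ 2 * gseq q k) N.+1.
Proof.
move=> q0 q1; elim: N => [|N IH].
  rewrite psumS psum0 /gseq /=; lra.
rewrite psumS; set P := psum _ _ in IH *.
have a1 : (absz (Posz N.+2) == 1%N) = false by lia.
have a2 : (absz (- Posz N.+2) == 1%N) = false by lia.
rewrite a1 ?a2 !mulr0 !sub0r gseq_even rmorphN/= sqrrN.
suff : (Posz N.+2)%:~R ^+ 2 * gseq q (Posz N.+2) <= q / (2 * 2 ^+ N).
  rewrite (exprS 2 N); set A := _ * gseq _ _.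
  have -> : 2 * q / (2 * 2 ^+ N) = q / 2 ^+ N by field; rewrite expf_neq0.
  have -> : q / (2 * 2 ^+ N) = (q / 2 ^+ N) / 2 by field; rewrite expf_neq0.
  move: IH; have -> : 2 * q / 2 ^+ N = 2 * (q / 2 ^+ N) by ring.
  lra.
have -> : gseq q (Posz N.+2) = q * q ^+ (N.+1 * N.+3).
  by rewrite /gseq -exprS; congr (_ ^+ _); rewrite /= -mulnn; lia.
rewrite -[_%:~R]/(N.+2%:R : R) mulrCA.
have -> : q / (2 * 2 ^+ N) = q * (2^-1 * 2^-1 ^+ N) by rewrite exprVn invfM.
rewrite ler_pM2l//.
have n4 : (N.+2%:R : R) ^+ 2 <= 4 ^+ N.+2.
  rewrite -!natrX ler_nat -[(4 ^ _)%N]/((2 ^ 2) ^ _)%N -expnM mulnC expnM leq_exp2r//.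
  by rewrite ltnW// ltn_expl.
have q8 : q ^+ (N.+1 * N.+3) <= 8^-1 ^+ N.+3.
  apply: (@le_trans _ _ (q ^+ N.+3)).
    by apply: ler_wiXn2l; [exact: ltW|lra|rewrite leq_pmull].
  by apply: lerXn2r => //; rewrite nnegrE ?invr_ge0// ltW.
apply: (@le_trans _ _ (4 ^+ N.+2 * 8^-1 ^+ N.+3)).
  by apply: ler_pM => //; exact/exprn_ge0/ltW.
have -> : 4 ^+ N.+2 * 8^-1 ^+ N.+3 = 2^-1 ^+ N.+2 * 8^-1 :> R.
  by rewrite (exprSr _ N.+2) mulrA -exprMn; congr (_ ^+ _ * _); field.
have : (0 : R) <= 2^-1 ^+ N by rewrite exprn_ge0// invr_ge0.
rewrite !exprS; lra.
Qed.

(** For small q the terms k = 1 and k = -1 dominate: they exceed their value at pi by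
2 q (1 + cos x), and cos_twist_ge bounds the loss in all others by k^2 q^(k^2) times
the same factor. *)
Lemma gseq_symbol_small q x : 0 < q -> q <= 8^-1 ->
  gsumpi q <= zsum (fun k => gseq q k * cos (k%:~R * x)).
Proof.
move=> q0 q1; have ql : q < 1 by lra.
have ag := asum_gseq q0 ql.
have ac : asum (fun k => gseq q k * cos (k%:~R * x)).
  apply: asum_le ag => k; rewrite normrM (ger0_norm (gseq_ge0 k (ltW q0))).
  by apply: ler_piMr; [exact/gseq_ge0/ltW|exact: cos_max].
have ap := asum_sgnM ag.
rewrite -subr_ge0 -zsumB//.
apply: (@ler_cvgn _ (fun=> 0) (fun N => psum (fun k => gseq q k * cos (k%:~R * x) - sgn k * gseq q k) N.+1)).
- exact: cvg_cst.
- by rewrite (cvg_shiftS (psum _)); apply: asum_cvg; exact: asumB.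
- apply: nearW => N.
  have c0 : 0 <= 1 + cos x by have := cos_geN1 x; lra.
  apply: (@le_trans _ _ ((1 + cos x) * psum (fun k => (2 * q) * (absz k == 1%N)%:R - k%:~R ^+ 2 * gseq q k) N.+1)).
    apply: mulr_ge0 => //; apply: le_trans (gseq_weighted_sum N q0 q1).
    by rewrite divr_ge0 ?exprn_ge0// mulr_ge0// ltW.
  rewrite -psumZ; apply: ler_psum => k.
  have gk := gseq_ge0 k (ltW q0).
  have := ler_wpM2l gk (cos_twist_ge k x).
  case: eqP => [k1|_]; last by rewrite mulr0; lra.
  move=> _; have [->|->] : k = 1 \/ k = -1 by lia.
    rewrite mul1r /gseq /sgn/=; lra.
  rewrite rmorphN/= mulN1r cosN /gseq /sgn/=; lra.
Qed.

(** The theta function is positive and smallest at pi, in terms of forms. *)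
Definition coercive_at_pi q := 0 < gsumpi q /\
  forall b N, gsumpi q * psum (fun k => b k ^+ 2) N <= Form (gseq q) b N.

Lemma coercive_small q : 0 < q -> q <= 8^-1 -> coercive_at_pi q.
Proof.
move=> q0 q1; have ql : q < 1 by lra.
have ag := asum_gseq q0 ql.
split.
  apply: lt_le_trans (gsumpi_ge q0 ql).
  have : gsum q <= 1 + 2 * q / (1 - q).
    by apply: zsum_le => // N; exact: gseq_psum_le.
  have : 2 * q / (1 - q) < 1 by rewrite ltr_pdivrMr; lra.
  lra.
move=> b N; rewrite -Form_delta -FormZ -subr_ge0 -FormB.
have ad : asum (fun k => gsumpi q * delta k : R) by apply/asumZ/asum_delta.
apply: Form_symbol_ge0.
- by move=> k; rewrite gseq_even /delta oppr_eq0.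
- exact: asumB.
- move=> x.
  have ac : asum (fun k => gseq q k * cos (k%:~R * x)).
    apply: asum_le ag => k; rewrite normrM (ger0_norm (gseq_ge0 k (ltW q0))).
    by apply: ler_piMr; [exact/gseq_ge0/ltW|exact: cos_max].
  have ad2 : asum (fun k => gsumpi q * cos (k%:~R * x) * delta k).
    apply: (@asumM _ _ _ `|gsumpi q|); last exact: asum_delta.
    by move=> k; rewrite normrM ler_piMr// cos_max.
  under eq_zsum do rewrite mulrBl mulrAC.
  rewrite zsumB// zsum_deltaM mul0r cos0 mulr1 subr_ge0.
  exact: gseq_symbol_small.
Qed.

(** The 2N + 1 even and 2N + 1 odd indices cover [-2N - 1, 2N], one term more than the
symmetric window. *)
Lemma psum_even_odd u N :
  psum (fun k => u (2 * k)) N + psum (fun k => u (2 * k - 1)) N =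
  psum u N.*2 + u (- Posz N.*2.+1).
Proof.
elim: N => [|N IH]; first by rewrite !psum0 mulr0 sub0r.
rewrite doubleS !psumS.
have e1 : 2 * Posz N.+1 = Posz N.*2.+2 by lia.
have e2 : 2 * - Posz N.+1 = - Posz N.*2.+2 by lia.
have e3 : 2 * Posz N.+1 - 1 = Posz N.*2.+1 by lia.
have e4 : 2 * - Posz N.+1 - 1 = - Posz N.*2.+3 by lia.
rewrite e3 e4 e1 e2.
move: IH; set A := psum _ N; set B := psum _ N; set C := psum _ _; lra.
Qed.

Lemma asum_even_odd u : asum u ->
  asum (fun k => u (2 * k)) /\ asum (fun k => u (2 * k - 1)).
Proof.
move=> au; have aau := asum_abs au.
have h N : psum (fun k => `|u (2 * k)|) N + psum (fun k => `|u (2 * k - 1)|) N <= zsum (fun k => `|u k|).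
  rewrite (psum_even_odd (fun k => `|u k|)).
  apply: (@le_trans _ _ (psum (fun k => `|u k|) N.*2.+1)); first by rewrite psumS addrAC lerDl.
  exact: ge0_psum_le.
split; exists (zsum (fun k => `|u k|)) => N; apply: le_trans (h N).
  by rewrite lerDl psum_ge0.
by rewrite lerDr psum_ge0.
Qed.

Lemma cvg_double : (fun N => N.*2) @ \oo --> \oo.
Proof.
apply/cvgnyPge => A; near=> n; rewrite (@leq_trans n)//; last by lia.
by near: n; exact: nbhs_infty_ge.
Unshelve. all: by end_near. Qed.

Lemma zsum_even_odd u : asum u ->
  zsum (fun k => u (2 * k)) + zsum (fun k => u (2 * k - 1)) = zsum u.
Proof.
move=> au; have [a1 a2] := asum_even_odd au.
rewrite -zsumD//; apply: zsum_eq.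
apply: (@eq_cvgn _ (fun N => psum u N.*2 + u (- Posz N.*2.+1))).
  by move=> N; rewrite psumD psum_even_odd.
rewrite -[X in _ --> X]addr0; apply: cvgD.
  exact: cvg_comp cvg_double (asum_cvg au).
have h : (u (- Posz n.+1)) @[n --> \oo] --> (0 : R).
  by have := (asum_cvg0 au).2; rewrite -cvg_shiftS.
exact: cvg_comp cvg_double h.
Qed.

(** (n - l)^2 + l^2 doubled is n^2 + (n - 2 l)^2, so the convolution factors through
the sum of q^((n - 2 l)^2), which only depends on the parity of n. *)
Lemma zconv_gseq q n : 0 < q -> q < 1 ->
  zconv (gseq (q ^+ 2)) (gseq (q ^+ 2)) n =
  gseq q n * (gsum q / 2 + gsumpi q / 2 * sgn n).
Proof.
move=> q0 q1; have ag := asum_gseq q0 q1.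
have [a1 a2] := asum_even_odd ag.
have e1 := zsum_even_odd ag.
have e2 := zsum_even_odd (asum_sgnM ag).
have s1 (k : int) : sgn (2 * k) = 1 :> R.
  by rewrite /sgn -signr_odd; have -> : odd (absz (2 * k)%R) = false by lia.
have s2 (k : int) : sgn (2 * k - 1) = -1 :> R.
  by rewrite /sgn -signr_odd; have -> : odd (absz (2 * k - 1)%R) = true by lia.
have e3 : zsum (fun k => gseq q (2 * k)) - zsum (fun k => gseq q (2 * k - 1)) = gsumpi q.
  rewrite /gsumpi -e2 -zsumN//; congr (_ + _); apply: eq_zsum => k.
    by rewrite s1 mul1r.
  by rewrite s2 mulN1r.
rewrite /zconv (_ : zsum _ = gseq q n * zsum (fun l => gseq q (n - 2 * l))); last first.
  have an : asum (fun l => gseq q (n - 2 * l)).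
    have [k [nk|nk]] : exists k : int, n = 2 * k \/ n = 2 * k - 1.
    - by exists ((n + 1) %/ 2)%Z; lia.
    - have := asum_rshift k a1; congr asum; apply/funext => l; congr gseq; lia.
    - have := asum_rshift k a2; congr asum; apply/funext => l; congr gseq; lia.
  rewrite -zsumZ//; apply: eq_zsum => l.
  rewrite /gseq -!exprM -!exprD; congr (_ ^+ _).
  nia.
congr (_ * _).
(* the parity of n decides whether n - 2 l runs over even or odd integers *)
have [k [nk|nk]] : exists k : int, n = 2 * k \/ n = 2 * k - 1.
- by exists ((n + 1) %/ 2)%Z; lia.
- rewrite nk s1 mulr1 (_ : zsum _ = zsum (fun k => gseq q (2 * k))).
    by rewrite -e3 /gsum -e1; field.
  by rewrite -[RHS](zsum_rshift k)//; apply: eq_zsum => l; congr gseq; lia.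
- rewrite nk s2 (_ : zsum _ = zsum (fun k => gseq q (2 * k - 1))).
    by rewrite -e3 /gsum -e1; field.
  by rewrite -[RHS](zsum_rshift k)//; apply: eq_zsum => l; congr gseq; lia.
Qed.


Section Doubling.
Variable q : R.
Hypotheses (q0 : 0 < q) (q1 : q < 1).
Let q20 : 0 < q ^+ 2. Proof. exact: exprn_gt0. Qed.
Let q21 : q ^+ 2 < 1. Proof. by rewrite expr_lt1// ltW. Qed.

Lemma gsum_sqr : gsum (q ^+ 2) ^+ 2 = (gsum q ^+ 2 + gsumpi q ^+ 2) / 2.
Proof.
have ag := asum_gseq q0 q1; have ap := asum_sgnM ag.
rewrite expr2 -zsum_zconv; [|exact: asum_gseq..].
rewrite (_ : zsum _ = zsum (fun k => gsum q / 2 * gseq q k + gsumpi q / 2 * (sgn k * gseq q k))).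
  rewrite zsumD; [|exact: asumZ..]; by rewrite !zsumZ// -/(gsum q) -/(gsumpi q); field.
by apply: eq_zsum => k; rewrite zconv_gseq//; ring.
Qed.

Lemma gsumpi_sqr : gsumpi (q ^+ 2) ^+ 2 = gsum q * gsumpi q.
Proof.
have ag := asum_gseq q0 q1; have ap := asum_sgnM ag.
have ag2 := asum_gseq q20 q21.
rewrite -(zsum_sgn_autocorr ag2).
rewrite (_ : zsum _ = zsum (fun k => gsum q / 2 * (sgn k * gseq q k) + gsumpi q / 2 * gseq q k)).
  rewrite zsumD; [|exact: asumZ..]; by rewrite !zsumZ// -/(gsum q) -/(gsumpi q); field.
apply: eq_zsum => k; rewrite zconv_gseq//.
rewrite (_ : sgn k * _ = gsum q / 2 * (sgn k * gseq q k) + gsumpi q / 2 * gseq q k * (sgn k * sgn k)).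
  by rewrite sgn_sqr mulr1.
ring.
Qed.

Lemma Form_zconv_gseq b N :
  Form (zconv (gseq (q ^+ 2)) (gseq (q ^+ 2))) b N =
  gsum q / 2 * Form (gseq q) b N + gsumpi q / 2 * Form (gseq q) (fun k => sgn k * b k) N.
Proof.
have -> : Form (gseq q) (fun k => sgn k * b k) N = Form (fun k => sgn k * gseq q k) b N.
  by apply: eq_psum => k; apply: eq_psum => l; rewrite sgnM; ring.
rewrite -!FormZ -FormD; apply: eq_Form => k; rewrite zconv_gseq//; ring.
Qed.

Lemma psum_sgn_sqr b N : psum (fun k => (sgn k * b k) ^+ 2) N = psum (fun k => b k ^+ 2) N.
Proof. by apply: eq_psum => k; rewrite exprMn expr2 sgn_sqr mul1r. Qed.

Lemma sgn_sgnM b : (fun k => sgn k * (sgn k * b k)) = b.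
Proof. by apply/funext => k; rewrite mulrA sgn_sqr mul1r. Qed.

(** Write E, P for the values at 0 and pi for q, and X, Y for the forms at b and at
its alternating twist. By the doubling identity the bound at q^2, squared, reads
E X + P Y >= 2 E P |b|^2, while the form at the twist is at most its symbol at 0,
E Y + P X <= (E^2 + P^2) |b|^2. Eliminating Y gives (E^2 - P^2) X >= (E^2 - P^2) P |b|^2. *)
Lemma coercive_sqrt : coercive_at_pi (q ^+ 2) -> coercive_at_pi q.
Proof.
move=> [m0 cm].
have ag := asum_gseq q0 q1.
have ag2 := asum_gseq q20 q21.
have E1 := gsum_ge1 q0 q1.
have pi0 : 0 < gsumpi q.
  by have := exprn_gt0 2 m0; rewrite gsumpi_sqr pmulr_rgt0//; lra.
have lt_sum : gsumpi q < gsum q.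
  have [a1 a2] := asum_even_odd ag.
  rewrite -subr_gt0 -zsumB//; last exact: asum_sgnM.
  have : 0 < gseq q 1 by rewrite exprn_gt0.
  move/lt_le_trans; apply.
  apply: (@le_trans _ _ (psum (fun k => gseq q k - sgn k * gseq q k) 1)).
    rewrite psumS psum0 gseq_even /sgn /gseq/=; have := q0; lra.
  apply: ge0_psum_le; last by apply: asumB => //; exact: asum_sgnM.
  move=> k; rewrite subr_ge0; apply: ler_piMl; first exact/gseq_ge0/ltW.
  by have := ler_norm (sgn k : R); rewrite norm_sgn.
split => // b N.
set E := gsum q in E1 lt_sum *; set P := gsumpi q in pi0 lt_sum *.
set B := psum _ N; set X := Form _ b N.
have g20 k : 0 <= gseq (q ^+ 2) k by exact/gseq_ge0/ltW.
have ge2 := @gseq_even (q ^+ 2).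
have lo := autocorr_coercive ge2 ag2 m0 cm b N.
have hi : Form (zconv (gseq (q ^+ 2)) (gseq (q ^+ 2))) (fun k => sgn k * b k) N <=
   gsum (q ^+ 2) ^+ 2 * B.
  have [_ <-] := zconv_trunc_sqr ge2 ag2 (fun k => sgn k * b k) N.
  by rewrite /B -psum_sgn_sqr; exact: normsq_zconv_trunc_le.
move: lo hi; rewrite !Form_zconv_gseq sgn_sgnM gsum_sqr gsumpi_sqr -/E -/P -/B -/X.
set Y := Form _ _ N => lo hi.
have e0 : 0 < E by lra.
have d0 : 0 < E ^+ 2 - P ^+ 2 by rewrite subr_gt0 ltrXn2r// ltW.
have h1 := ler_wpM2l (ltW e0) lo.
have h2 := ler_wpM2l (ltW pi0) hi.
rewrite -(ler_pM2l d0).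
have -> : (E ^+ 2 - P ^+ 2) * X = 2 * (E * (E / 2 * X + P / 2 * Y)) - 2 * (P * (E / 2 * Y + P / 2 * X)).
  by field.
have -> : (E ^+ 2 - P ^+ 2) * (P * B) = 2 * (E * (E * P * B)) - 2 * (P * ((E ^+ 2 + P ^+ 2) / 2 * B)).
  by field.
lra.
Qed.

End Doubling.

(** Raise q to a power 2^n at which the direct estimate applies, and come back by
successive square roots. *)
Lemma coercive_gseq q : 0 < q -> q < 1 -> coercive_at_pi q.
Proof.
move=> q0 q1.
have step (k : nat) r : 0 < r -> r < 1 -> coercive_at_pi (r ^+ (2 ^ k)) -> coercive_at_pi r.
  elim: k r => [|k IH] r r0 r1; first by rewrite expr1.
  rewrite expnS exprM => h; apply: coercive_sqrt => //; apply: IH => //.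
    exact: exprn_gt0.
  by rewrite expr_lt1// ltW.
have [n qn] : exists n, q ^+ n <= 8^-1.
  have := @cvg_expr R q; rewrite ger0_norm ?ltW// => /(_ q1)/cvgrPdist_le/(_ 8^-1).
  have e8 : (0 : R) < 8^-1 by rewrite invr_gt0.
  move=> /(_ e8)[n _ /(_ n (leqnn n))] /=; rewrite sub0r normrN (ger0_norm (exprn_ge0 _ (ltW q0))).
  by move=> h; exists n.
apply: (step n) => //; apply: coercive_small; first exact: exprn_gt0.
by apply: le_trans qn; apply: ler_wiXn2l; [exact: ltW|exact: ltW|rewrite ltnW// ltn_expl].
Qed.

End Theta.

(** * Integrals over the line and unit-step sums *)

Section RealLine.
Context {R : realType}.
Local Notation mu := (@lebesgue_measure R).
Implicit Types (f F : R -> R).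

Lemma integral_setT_split f : (forall x, 0 <= f x) -> continuous f ->
  (\int[mu]_x (f x)%:E =
   \int[mu]_(x in `[0%R, +oo[) (f x)%:E + \int[mu]_(x in `[0%R, +oo[) ((f \o -%R) x)%:E)%E.
Proof.
move=> f0 cf; have mf : measurable_fun [set: R] f by exact: continuous_measurable_fun.
have mE (D : set R) : measurable D -> measurable_fun D (EFin \o f).
  by move=> mD; apply/measurable_EFinP; apply: measurable_funTS.
have -> : [set: R] = `[0%R, +oo[%classic `|` `]-oo, 0%R[%classic.
  by rewrite -setCitvl setUC setUv.
rewrite ge0_integral_setU//=; last 3 first.
- by apply: mE; exact: measurableU.
- by move=> x _; rewrite lee_fin.
- by apply/disj_setPLR => x /=; rewrite !in_itv/= andbT leNgt => /negP.
congr (_ + _)%E.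
rewrite integral_itv_bndo_bndc; last exact: mE.
rewrite -{1}oppr0 ge0_integration_by_substitutionNy//.
exact: continuous_subspaceT.
Qed.

(** The fundamental theorem on the whole line, applied to each half-line. *)
Lemma ge0_integral_derive f F (l l' : R) : (forall x, 0 <= f x) -> continuous f ->
  (forall x : R, is_derive x 1 F (f x)) ->
  F x @[x --> +oo] --> l -> F x @[x --> -oo] --> l' ->
  (\int[mu]_x (f x)%:E = (l - l')%:E)%E.
Proof.
move=> f0 cf dF Fl Fl'.
have cF : continuous F.
  by move=> x; apply/differentiable_continuous/derivable1_diffP; have [] := dF x.
rewrite integral_setT_split//.
rewrite (@ge0_continuous_FTC2y _ f F 0 l)//; last 3 first.
- exact: continuous_subspaceT.
- exact/cvg_at_right_filter/cF.
- by move=> x _; rewrite derive1E; have [_ ->] := dF x.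
pose G x := - F (- x).
have dG (x : R) : is_derive x 1 G (f (- x)).
  have d := dF (- x).
  have h : is_derive x 1 (F \o -%R) (f (- x) * -1) by exact: is_derive1_comp.
  have := is_deriveN h; rewrite mulrN1 opprK; exact.
have cG : continuous G.
  by move=> x; apply/differentiable_continuous/derivable1_diffP; have [] := dG x.
rewrite (@ge0_continuous_FTC2y _ (f \o -%R) G 0 (- l')); last 6 first.
- by move=> x _ /=.
- apply: continuous_subspaceT => x; apply: continuous_comp; [exact: opp_continuous|exact: cf].
- by apply: cvgN; have /cvgNy_compNP := Fl'.
- by move=> x _; have [] := dG x.
- exact/cvg_at_right_filter/cG.
- by move=> x _; rewrite derive1E; have [_ ->] := dG x.
by rewrite /G oppr0 -!EFinB -EFinD; congr (_%:E); ring.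
Qed.

(** On each unit interval [n, n + 1[ the function lies between its values at the ends, so
the integral over the half-line differs from the sum over k >= 1 by at most f 0;
evenness doubles both and accounts for the term k = 0. *)
Lemma sum_vs_integral f (J : R) : (forall x, 0 <= f x) -> continuous f ->
  (forall x, f (- x) = f x) -> (forall x y, 0 <= x -> x <= y -> f y <= f x) ->
  (\int[mu]_x (f x)%:E = J%:E)%E -> asum (fun k => f k%:~R) ->
  `|zsum (fun k => f k%:~R) - J| <= f 0.
Proof.
move=> f0 cf ev dec fJ asf.
have mf : measurable_fun [set: R] f by exact: continuous_measurable_fun.
have mE (D : set R) : measurable D -> measurable_fun D (EFin \o f).
  by move=> mD; apply/measurable_EFinP; apply: measurable_funTS.
(* half-open, so that these intervals partition the half-line *)
pose I (n : nat) : set R := `[n%:R, n.+1%:R[%classic.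
have IE x n : I n x -> n = Num.truncn x.
  rewrite /I/= in_itv/= => /andP[a b]; apply/esym/eqP.
  by rewrite truncn_eq ?a//; apply: le_trans a.
have half : (\int[mu]_(x in `[0%R, +oo[) (f x)%:E = (J / 2)%:E)%E.
  move: fJ; rewrite integral_setT_split//.
  have -> : f \o -%R = f by apply/funext => x /=.
  set X := (\int[mu]_(x in _) _)%E.
  by case: X => [r| |]//= [] <-; congr (_%:E); field.
have seriesE : (J / 2)%:E = (\sum_(n <oo) \int[mu]_(x in I n) (f x)%:E)%E.
  rewrite -half.
  have -> : `[0%R, +oo[%classic = \bigcup_n I n.
    apply/seteqP; split=> x /=; rewrite in_itv/= ?andbT.
      by move=> x0; exists (Num.truncn x) => //; rewrite /I/= in_itv/= truncn_itv.
    by move=> [n _]; rewrite /I/= in_itv/= => /andP[+ _]; apply: le_trans.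
  rewrite ge0_integral_bigcup//.
  - by move=> n; exact: measurable_itv.
  - by apply: mE; apply: bigcup_measurable => n _; exact: measurable_itv.
  - by move=> x _; rewrite lee_fin.
  - by move=> i j _ _ [x [/IE -> /IE ->]].
have I1 n r : (\int[mu]_(x in I n) (cst r%:E) x = r%:E)%E.
  rewrite integral_cst; last exact: measurable_itv.
  rewrite /I/= lebesgue_measure_itv/= lte_fin ltr_nat ltnSn -EFinB -natr1 addrAC subrr add0r.
  by rewrite mule1.
have ub n : (\int[mu]_(x in I n) (f x)%:E <= (f n%:R)%:E)%E.
  rewrite -[leRHS](I1 n); apply: ge0_le_integral => //.
  - exact: measurable_itv.
  - by move=> x _; rewrite lee_fin.
  - by apply: mE; exact: measurable_itv.
  - by move=> x; rewrite /I/= in_itv/= => /andP[nx _]; rewrite lee_fin dec.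
have lb n : ((f n.+1%:R)%:E <= \int[mu]_(x in I n) (f x)%:E)%E.
  rewrite -[leLHS](I1 n); apply: ge0_le_integral => //.
  - exact: measurable_itv.
  - by move=> x _; rewrite lee_fin.
  - by apply: mE; exact: measurable_itv.
  - move=> x; rewrite /I/= in_itv/= => /andP[nx xn]; rewrite lee_fin dec ?(ltW xn)//.
    exact: le_trans nx.
have psE N : psum (fun k => f k%:~R) N = f 0 + 2 * \sum_(i < N) f i.+1%:R.
  by rewrite psum_even// => k; rewrite rmorphN/= ev.
have up : zsum (fun k => f k%:~R) <= f 0 + J.
  apply: zsum_le => // N; rewrite psE lerD2l.
  have : ((\sum_(i < N) f i.+1%:R)%:E <= (J / 2)%:E)%E.
    rewrite seriesE -sumEFin.
    apply: (@le_trans _ _ (\sum_(0 <= i < N) \int[mu]_(x in I i) (f x)%:E)%E).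
      by rewrite big_mkord; apply: lee_sum => i _; exact: lb.
    by apply: nneseries_lim_ge => n _ _; apply: integral_ge0 => x _; rewrite lee_fin.
  by rewrite lee_fin ler_pdivlMr// mulrC.
have low : J <= f 0 + zsum (fun k => f k%:~R).
  have : ((J / 2)%:E <= ((f 0 + zsum (fun k => f k%:~R)) / 2)%:E)%E.
    rewrite seriesE; apply: lime_le.
      by apply: is_cvg_nneseries => n _ _; apply: integral_ge0 => x _; rewrite lee_fin.
    apply: nearW => N.
    apply: (@le_trans _ _ (\sum_(0 <= i < N) (f i%:R)%:E)%E).
      by apply: lee_sum => i _; exact: ub.
    rewrite sumEFin lee_fin ler_pdivlMr// big_mkord.
    have := ge0_psum_le N (fun k => f0 _) asf; rewrite psE.
    suff : \sum_(i < N) f i%:R <= f 0 + \sum_(i < N) f i.+1%:R by lra.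
    have -> : f 0 + \sum_(i < N) f i.+1%:R = \sum_(i < N.+1) f i%:R.
      by rewrite big_ord_recl.
    by rewrite big_ord_recr/= lerDl.
  by rewrite lee_fin ler_pM2r// invr_gt0.
by rewrite ler_norml; apply/andP; split; lra.
Qed.

End RealLine.

(** * The Gaussian system *)

Section Gaussian.
Context {R : realType}.
Local Notation mu := (@lebesgue_measure R).

(** The parameter c = 2 sigma^2 makes products and rescalings stay in the family. *)
Definition gauss (c t : R) : R := expR (- (t ^+ 2 / c)).

Lemma continuous_gauss c : continuous (gauss c).
Proof.
move=> t; apply: continuous_comp; last exact: continuous_expR.
apply: (@continuousN _ R^o); apply: continuousM; last exact: cst_continuous.
exact: exprn_continuous.
Qed.

Lemma gauss_even c t : gauss c (- t) = gauss c t.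
Proof. by rewrite /gauss sqrrN. Qed.

Lemma gauss_ge0 c t : 0 <= gauss c t. Proof. exact: expR_ge0. Qed.

Lemma gauss_le c t : 0 < c -> gauss c t <= (1 + c) / (1 + t ^+ 2).
Proof.
move=> c0; rewrite /gauss expRN.
have x0 : 0 <= t ^+ 2 / c by rewrite divr_ge0 ?sqr_ge0// ltW.
have t0 := sqr_ge0 t.
apply: (@le_trans _ _ (1 + t ^+ 2 / c)^-1).
  by rewrite lef_pV2 ?posrE ?expR_gt0 ?expR_ge1Dx//; lra.
rewrite ler_pdivlMr; last by lra.
rewrite mulrC ler_pdivrMr; last by lra.
have -> : (1 + c) * (1 + t ^+ 2 / c) = 1 + t ^+ 2 + (c + t ^+ 2 / c).
  by field; rewrite gt_eqF.
lra.
Qed.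

Lemma gauss_nonincreasing c (x y : R) : 0 < c -> 0 <= x -> x <= y -> gauss c y <= gauss c x.
Proof.
move=> c0 x0 xy; rewrite /gauss ler_expR lerN2 ler_pM2r ?invr_gt0//.
by rewrite lerXn2r ?nnegrE//; exact: le_trans xy.
Qed.

Lemma integral_gauss c m : 0 < c ->
  (\int[mu]_t (gauss c (t - m))%:E = (Num.sqrt (c * pi))%:E)%E.
Proof.
move=> c0; pose s := Num.sqrt (c / 2).
have s2 : s ^+ 2 = c / 2 by rewrite sqr_sqrtr// divr_ge0// ltW.
have s0 : s != 0 by rewrite gt_eqF// sqrtr_gt0 divr_gt0.
have k0 : 0 < Num.sqrt (c * pi) by rewrite sqrtr_gt0 mulr_gt0// pi_gt0.
have E t : gauss c (t - m) = Num.sqrt (c * pi) * normal_pdf m s t.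
  rewrite normal_pdfE// /normal_peak /normal_fun s2 mulrA.
  have -> : c / 2 * pi *+ 2 = c * pi by rewrite -mulr_natr; field.
  have -> : c / 2 *+ 2 = c by rewrite -mulr_natr; field.
  by rewrite divff ?mul1r ?gt_eqF// /gauss mulNr.
under eq_integral do rewrite E EFinM.
rewrite ge0_integralZl_EFin//.
- by rewrite integral_normal_pdf mule1.
- by move=> t _; rewrite lee_fin normal_pdf_ge0.
- by apply/measurable_EFinP; exact: measurable_normal_pdf.
Qed.

Lemma gauss_gseq c (k : int) : gauss c k%:~R = gseq (expR (- c^-1)) k.
Proof.
rewrite /gauss /gseq -expRM_natl; congr expR.
have -> : (absz k ^ 2)%:R = k%:~R ^+ 2 :> R.
  by rewrite natrX natr_absz intr_norm real_normK// num_real.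
by rewrite mulrN.
Qed.

(** The parallelogram identity separates the product of two translates. *)
Lemma gauss_mul c (x y : R) : gauss c x * gauss c y =
  gauss (2 * c) (x - y) * gauss (c / 2) ((x + y) / 2).
Proof.
rewrite /gauss -!expRD; congr expR.
have [->|c0] := eqVneq c 0; first by rewrite !(mulr0, mul0r, invr0, oppr0, addr0).
by field.
Qed.

(** By gauss_mul the product is a constant times a Gaussian centred at the midpoint. *)
Lemma integral_gauss_gram c (k l : int) : 0 < c ->
  (\int[mu]_t (gauss c (t - k%:~R) * gauss c (t - l%:~R))%:E =
   (Num.sqrt (c / 2 * pi) * gseq (expR (- (2 * c)^-1)) (k - l))%:E)%E.
Proof.
move=> c0.
have E t : gauss c (t - k%:~R) * gauss c (t - l%:~R) =
   gseq (expR (- (2 * c)^-1)) (k - l) * gauss (c / 2) (t - (k%:~R + l%:~R) / 2).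
  rewrite gauss_mul -gauss_gseq -(gauss_even _ (_ - _)); congr (gauss _ _ * gauss _ _).
    by rewrite intrB; ring.
  by field.
under eq_integral do rewrite E EFinM.
rewrite ge0_integralZl_EFin//.
- by rewrite integral_gauss ?divr_gt0// -EFinM mulrC.
- by move=> t _; rewrite lee_fin gauss_ge0.
- apply/measurable_EFinP; apply: measurableT_comp; last exact: measurable_funB.
  by apply: continuous_measurable_fun; exact: continuous_gauss.
- by rewrite gseq_ge0// expR_ge0.
Qed.

Section Constants.
Variable c : R.
Hypothesis c0 : 0 < c.
Let q := expR (- (2 * c)^-1).
Let I := Num.sqrt (c / 2 * pi).

Let q0 : 0 < q. Proof. exact: expR_gt0. Qed.
Let q1 : q < 1.
Proof. by rewrite expR_lt1 oppr_lt0 invr_gt0 mulr_gt0. Qed.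
Let I0 : 0 < I. Proof. by rewrite sqrtr_gt0 !mulr_gt0// pi_gt0. Qed.

Let qq : q ^+ 2 = expR (- c^-1).
Proof. by rewrite -expRM_natl; congr expR; field; rewrite gt_eqF. Qed.

Let pE (k : int) : gauss c k%:~R = gseq (q ^+ 2) k.
Proof. by rewrite qq gauss_gseq. Qed.

Let q20 : 0 < q ^+ 2. Proof. exact: exprn_gt0. Qed.
Let q21 : q ^+ 2 < 1. Proof. by rewrite expr_lt1// ltW. Qed.

Let gram (k l : int) := integral_gauss_gram k l c0.

(** Reduces to E X >= P Y, where X, Y are the forms of the theta sequence at b and at its
twist: X >= P |b|^2 by minimality at pi, and Y <= E |b|^2. *)
Let lower_form b N : I / gsum q * Form (zconv (gseq (q ^+ 2)) (gseq (q ^+ 2))) b N <=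
  Form (fun k => I * gseq q k) b N.
Proof.
have E1 := gsum_ge1 q0 q1.
rewrite Form_zconv_gseq// FormZ -mulrA ler_pM2l// ler_pdivrMl; last by lra.
have [p0 cq] := coercive_gseq q0 q1.
have lo := cq b N.
have hi : Form (gseq q) (fun k => sgn k * b k) N <= gsum q * psum (fun k => b k ^+ 2) N.
  have := Form_le (fun k => sgn k * b k) N (gseq_even q) (asum_gseq q0 q1).
  rewrite psum_sgn_sqr; congr (_ <= _ * _); apply: eq_zsum => k.
  by rewrite ger0_norm// gseq_ge0// ltW.
have e0 : 0 < gsum q by lra.
have h1 := ler_wpM2l (ltW e0) lo; have h2 := ler_wpM2l (ltW p0) hi.
lra.
Qed.

(** I X is one of the two terms on the right, and the other is a positive multiple of Y. *)
Let upper_form b N : Form (fun k => I * gseq q k) b N <=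
  2 * I / gsum q * Form (zconv (gseq (q ^+ 2)) (gseq (q ^+ 2))) b N.
Proof.
have E1 := gsum_ge1 q0 q1.
have e0 : 0 < gsum q by lra.
have [p0 cq] := coercive_gseq q0 q1.
have lo := cq (fun k => sgn k * b k) N.
have lo0 : 0 <= Form (gseq q) (fun k => sgn k * b k) N.
  by apply: le_trans lo; rewrite mulr_ge0 ?psum_ge0 ?ltW// => k; exact: sqr_ge0.
rewrite Form_zconv_gseq// FormZ.
set X := Form _ b N; set Y := Form _ _ N in lo0 *.
have -> : 2 * I / gsum q * (gsum q / 2 * X + gsumpi q / 2 * Y) =
   I * X + I * (gsumpi q / gsum q * Y) by field; rewrite gt_eqF.
by rewrite lerDl; apply: mulr_ge0; [exact: ltW|rewrite mulr_ge0// divr_ge0// ltW].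
Qed.

(** Both estimates of lower_nod_constant coincide, since the minimum of G / P^2 is
attained at pi. *)
Lemma gauss_lower_constant :
  lower_riesz_constant (integer_shifts (nod_function (fun t => (gauss c t)%:C%C))) =
  I / gsum q.
Proof.
have [p0 _] := coercive_gseq q0 q1.
have [m0 cm] := coercive_gseq q20 q21.
have E1 := gsum_ge1 q0 q1; have e0 : 0 < gsum q by lra.
have A0 : 0 < I / gsum q by rewrite divr_gt0.
have pF : (fun k : int => gauss c k%:~R) = gseq (q ^+ 2) by apply/funext => k; exact: pE.
have := @lower_nod_constant R (gauss c) (1 + c) (fun k => I * gseq q k)
  (@continuous_gauss c) (gauss_even _) (gauss_ge0 _) (fun t => gauss_le t c0) gram
  (gsumpi (q ^+ 2)) (I / gsum q) (2 * I / gsum q) m0.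
rewrite pF => /(_ cm A0 lower_form upper_form).
have ev (k : int) : I * gseq q (- k) = I * gseq q k by rewrite gseq_even.
have as_ : asum (fun k => I * gseq q k) by apply/asumZ/asum_gseq.
move=> /(_ ev as_).
have -> : zsum (fun k => sgn k * (I * gseq q k)) = I * gsumpi q.
  rewrite -zsumZ; last by apply/asum_sgnM/asum_gseq.
  by apply: eq_zsum => k; rewrite mulrCA.
have -> : zsum (fun k => sgn k * gauss c k%:~R) = gsumpi (q ^+ 2).
  by apply: eq_zsum => k; rewrite pE.
rewrite gsumpi_sqr//.
have -> : I * gsumpi q / (gsum q * gsumpi q) = I / gsum q by field; rewrite !gt_eqF.
by move=> h; apply/esym/eqP; rewrite eq_le.
Qed.

Lemma gauss_upper_constant :
  I * gsum q / gsum (q ^+ 2) ^+ 2 <=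
  upper_riesz_constant (integer_shifts (nod_function (fun t => (gauss c t)%:C%C)))
  <= 2 * I / gsum q.
Proof.
have [p0 _] := coercive_gseq q0 q1.
have [m0 cm] := coercive_gseq q20 q21.
have E1 := gsum_ge1 q0 q1; have e0 : 0 < gsum q by lra.
have A0 : 0 < I / gsum q by rewrite divr_gt0.
have pF : (fun k : int => gauss c k%:~R) = gseq (q ^+ 2) by apply/funext => k; exact: pE.
have := @upper_nod_constant R (gauss c) (1 + c) (fun k => I * gseq q k)
  (@continuous_gauss c) (gauss_even _) (gauss_ge0 _) (fun t => gauss_le t c0) gram
  (gsumpi (q ^+ 2)) (I / gsum q) (2 * I / gsum q) m0.
rewrite pF => /(_ cm A0 lower_form upper_form).
have ev (k : int) : I * gseq q (- k) = I * gseq q k by rewrite gseq_even.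
have as_ : asum (fun k => I * gseq q k) by apply/asumZ/asum_gseq.
move=> /(_ ev as_).
by rewrite (zsumZ I (asum_gseq q0 q1)).
Qed.

End Constants.

Lemma gsum_near (c : R) : 0 < c -> `|gsum (expR (- c^-1)) - Num.sqrt (c * pi)| <= 1.
Proof.
move=> c0.
have q1 : expR (- c^-1) < 1 by rewrite expR_lt1 oppr_lt0 invr_gt0.
have E : (fun k : int => gauss c k%:~R) = gseq (expR (- c^-1)).
  by apply/funext => k; exact: gauss_gseq.
have := @sum_vs_integral R (gauss c) (Num.sqrt (c * pi)) (gauss_ge0 c)
  (@continuous_gauss c) (gauss_even c) (fun x y => @gauss_nonincreasing c x y c0).
rewrite E => h.
have -> : 1 = gauss c 0 by rewrite /gauss expr0n/= mul0r oppr0 expR0.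
apply: h; last exact: asum_gseq (expR_gt0 _) q1.
by have := integral_gauss 0 c0; under eq_integral do rewrite subr0.
Qed.

End Gaussian.

(** * Lorentz integrals *)

Section Lorentz.
Context {R : realType}.
Local Notation mu := (@lebesgue_measure R).
Implicit Types (s t a b : R).

Definition lor s t : R := s ^+ 2 / (s ^+ 2 + t ^+ 2).

Section Integrals.
Variable s : R.
Hypothesis s0 : 0 < s.

Let den_gt0 t : 0 < s ^+ 2 + t ^+ 2.
Proof. by have := sqr_ge0 t; have := exprn_gt0 2 s0; lra. Qed.

Lemma continuous_lor : continuous (lor s).
Proof.
move=> t; apply: (@continuousM _ _ (fun=> s ^+ 2) (fun t => (s ^+ 2 + t ^+ 2)^-1)).
  exact: cst_continuous.
apply: continuousV; first by rewrite gt_eqF.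
apply: (@continuousD _ R^o); first exact: cst_continuous.
exact: exprn_continuous.
Qed.

Lemma lor_even t : lor s (- t) = lor s t.
Proof. by rewrite /lor sqrrN. Qed.

Lemma lor_ge0 t : 0 <= lor s t.
Proof. by rewrite divr_ge0 ?sqr_ge0// ltW. Qed.

Lemma lor_le t : lor s t <= (1 + s ^+ 2) / (1 + t ^+ 2).
Proof.
have t0 := sqr_ge0 t; have s2 := exprn_gt0 2 s0; have d := den_gt0 t.
rewrite /lor ler_pdivrMr// mulrAC ler_pdivlMr; last by lra.
have := sqr_ge0 (s * s); nra.
Qed.

Lemma lor_nonincreasing (x y : R) : 0 <= x -> x <= y -> lor s y <= lor s x.
Proof.
move=> x0 xy; rewrite /lor ler_pM2l ?exprn_gt0// lef_pV2 ?posrE// lerD2l.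
by rewrite lerXn2r ?nnegrE//; exact: le_trans xy.
Qed.

Lemma lor0 : lor s 0 = 1.
Proof. by rewrite /lor expr0n/= addr0 divff// expf_neq0// gt_eqF. Qed.

Lemma asum_lor : asum (fun k => lor s k%:~R).
Proof.
apply: asum_le (asumZ (1 + s ^+ 2) asum_inv_sqr) => k.
by rewrite ger0_norm ?lor_ge0// lor_le.
Qed.

Lemma is_derive_subr a t : is_derive t 1 (fun u => u - a) 1.
Proof.
have := is_deriveB (is_derive_id t (1 : R)) (is_derive_cst a t (1 : R)).
by rewrite subr0.
Qed.

Lemma is_derive_atan_lor a t :
  is_derive t 1 (fun u => s * atan ((u - a) / s)) (lor s (t - a)).
Proof.
have h1 : is_derive t 1 (fun u => s^-1 * (u - a)) (s^-1 * 1).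
  by apply: is_deriveMl; exact: is_derive_subr.
have h2 : is_derive (s^-1 * (t - a)) 1 atan (1 + (s^-1 * (t - a)) ^+ 2)^-1.
  exact: is_derive1_atan.
have h3 := is_deriveMl s (@is_derive1_comp _ atan (fun u => s^-1 * (u - a)) t _ _ h2 h1).
have e1 : (fun u => s * atan ((u - a) / s)) = (fun u => s * (atan \o (fun u => s^-1 * (u - a))) u).
  by apply/funext => u /=; rewrite [(u - a) / s]mulrC.
rewrite e1; have -> // : lor s (t - a) = s * ((1 + (s^-1 * (t - a)) ^+ 2)^-1 * (s^-1 * 1)).
have := den_gt0 (t - a); rewrite /lor => d; field.
by rewrite !gt_eqF//; have := sqr_ge0 (t - a); have := exprn_gt0 2 s0; nra.
Qed.

Lemma is_derive_den a t :
  is_derive t 1 (fun u => s ^+ 2 + (u - a) ^+ 2) (2 * (t - a)).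
Proof.
have := is_deriveD (is_derive_cst (s ^+ 2) t (1 : R)) (is_deriveM (is_derive_subr a t) (is_derive_subr a t)).
have -> : cst (s ^+ 2) + (fun u => u - a) * (fun u => u - a) = (fun u => s ^+ 2 + (u - a) ^+ 2).
  by apply/funext => u; rewrite expr2.
by have -> : 0 + ((t - a) *: 1 + (t - a) *: 1) = 2 * (t - a) :> R by rewrite /GRing.scale/=; ring.
Qed.

Lemma is_derive_ln_lor a t :
  is_derive t 1 (fun u => ln (s ^+ 2 + (u - a) ^+ 2)) (2 * (t - a) / (s ^+ 2 + (t - a) ^+ 2)).
Proof.
have h1 := is_derive_den a t.
have h2 : is_derive (s ^+ 2 + (t - a) ^+ 2) 1 (@ln R) (s ^+ 2 + (t - a) ^+ 2)^-1.
  exact: is_derive1_ln.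
have := @is_derive1_comp _ (@ln R) (fun u => s ^+ 2 + (u - a) ^+ 2) t _ _ h2 h1.
by rewrite mulrC.
Qed.

Lemma cvg_atan_lor a :
  s * atan ((u - a) / s) @[u --> +oo] --> s * (pi / 2) /\
  s * atan ((u - a) / s) @[u --> -oo] --> - (s * (pi / 2)).
Proof.
have up b : s * atan ((u - b) / s) @[u --> +oo] --> s * (pi / 2).
  apply: cvgMl_tmp.
  apply: (@cvg_comp _ _ _ (fun u => (u - b) / s) atan +oo +oo); last exact: cvgy_atan.
  apply/cvgryPge => A; near=> u.
  have : A * s + b <= u by near: u; apply: nbhs_pinfty_ge; exact: num_real.
  by rewrite ler_pdivlMr//; lra.
split => //; apply/cvgNy_compNP.
rewrite (_ : _ \o _ = fun u => - (s * atan ((u - (- a)) / s))); first by apply: cvgN; exact: up.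
by apply/funext => u /=; rewrite -mulrN -atanN -mulNr opprD opprK.
Unshelve. all: by end_near. Qed.

(** The quotient of the arguments is 1 + h u, where h u decays like 1 / u. *)
Lemma cvg_ln_lor a b :
  ln (s ^+ 2 + (u - a) ^+ 2) - ln (s ^+ 2 + (u - b) ^+ 2) @[u --> +oo] --> (0 : R).
Proof.
pose n := b - a.
pose h u := (2 * n * (u - b) + n ^+ 2) / (s ^+ 2 + (u - b) ^+ 2).
have hc : h u @[u --> +oo] --> (0 : R).
  apply/cvgrPdist_le => e e0; near=> u.
  pose C := 2 * `|n| + n ^+ 2.
  have C0 : 0 <= C by rewrite addr_ge0 ?sqr_ge0// mulr_ge0.
  have u1 : 1 <= u - b by have : 1 + b <= u; [near: u; apply: nbhs_pinfty_ge; exact: num_real|lra].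
  have u2 : C <= e * (u - b).
    have : C / e + b <= u by near: u; apply: nbhs_pinfty_ge; exact: num_real.
    by rewrite -ler_pdivrMl// mulrC; lra.
  rewrite sub0r normrN /h normrM (gtr0_norm (_ : 0 < _^-1)) ?invr_gt0//.
  rewrite ler_pdivrMr//; set y := u - b in u1 u2 *.
  apply: (@le_trans _ _ (C * y)).
    apply: le_trans (ler_normD _ _) _; rewrite !normrM (gtr0_norm (_ : 0 < y)); last by lra.
    rewrite (ger0_norm (_ : 0 <= 2 :> R))// -[`|n| * `|n|]expr2 real_normK ?num_real// /C.
    by have := sqr_ge0 n; nra.
  have := exprn_gt0 2 s0; nra.
have : ln (1 + h u) @[u --> +oo] --> (0 : R).
  rewrite -[X in _ --> X]ln1; apply: continuous_cvg; first exact: continuous_ln.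
  by rewrite -[X in _ --> X]addr0; apply: cvgD => //; exact: cvg_cst.
have -> // : (fun u => ln (1 + h u)) =
  (fun u => ln (s ^+ 2 + (u - a) ^+ 2) - ln (s ^+ 2 + (u - b) ^+ 2)).
apply/funext => u; have d1 := den_gt0 (u - a); have d2 := den_gt0 (u - b).
rewrite -ln_div ?posrE//; congr ln.
by rewrite /h /n; field; rewrite gt_eqF.
Unshelve. all: by end_near. Qed.

Lemma integral_lor : (\int[mu]_t (lor s t)%:E = (pi * s)%:E)%E.
Proof.
transitivity ((s * (pi / 2) - - (s * (pi / 2)))%:E)%E; last by congr (_%:E); field.
apply: (@ge0_integral_derive _ (lor s) (fun u => s * atan ((u - 0) / s))).
- exact: lor_ge0.
- exact: continuous_lor.
- by move=> x; have := is_derive_atan_lor 0 x; rewrite subr0.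
- exact: (cvg_atan_lor 0).1.
- exact: (cvg_atan_lor 0).2.
Qed.

Let continuous_lor_mul a b : continuous (fun t => lor s (t - a) * lor s (t - b)).
Proof.
move=> t; apply: (@continuousM _ _ (fun t => lor s (t - a)) (fun t => lor s (t - b)));
  (apply: continuous_comp; last exact: continuous_lor);
  by apply: (@continuousB _ R^o); [exact: id|exact: cst_continuous].
Qed.


(** Together with atan it forms the antiderivative of the squared kernel. *)
Let ratio a u : R := (u - a) / (s ^+ 2 + (u - a) ^+ 2).

Let is_derive_ratio a t : is_derive t 1 (ratio a)
  ((s ^+ 2 - (t - a) ^+ 2) / (s ^+ 2 + (t - a) ^+ 2) ^+ 2).
Proof.
have h1 : is_derive t 1 (fun u => s ^+ 2 + (u - a) ^+ 2) (2 * (t - a)).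
  exact: is_derive_den.
have h2 : is_derive t 1 (fun u => (s ^+ 2 + (u - a) ^+ 2)^-1)
    (- (s ^+ 2 + (t - a) ^+ 2) ^- 2 * (2 * (t - a))).
  apply: (@is_deriveV _ (fun u => s ^+ 2 + (u - a) ^+ 2) t _ 1 _ h1).
  by rewrite gt_eqF.
have := is_deriveM (is_derive_subr a t) h2.
have d := den_gt0 (t - a).
rewrite /GRing.scale/= => h3.
rewrite (_ : (s ^+ 2 - (t - a) ^+ 2) / (s ^+ 2 + (t - a) ^+ 2) ^+ 2 =
  (t - a) * (- (s ^+ 2 + (t - a) ^+ 2) ^- 2 * (2 * (t - a))) +
  (s ^+ 2 + (t - a) ^+ 2)^-1 * 1); first exact: h3.
by field; rewrite gt_eqF.
Qed.

Let ratio_cvg a : ratio a u @[u --> +oo] --> (0 : R).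
Proof.
apply/cvgrPdist_le => e e0; near=> u.
have u1 : 1 <= u - a by have : 1 + a <= u; [near: u; apply: nbhs_pinfty_ge; exact: num_real|lra].
have u2 : 1 <= e * (u - a).
  have : 1 / e + a <= u by near: u; apply: nbhs_pinfty_ge; exact: num_real.
  by rewrite -ler_pdivrMl// mulrC; lra.
rewrite sub0r normrN /ratio ger0_norm; last by rewrite divr_ge0// ?ltW//; lra.
rewrite ler_pdivrMr//; set y := u - a in u1 u2 *.
have := exprn_gt0 2 s0; nra.
Unshelve. all: by end_near. Qed.

Let ratio_cvgN a : ratio a u @[u --> -oo] --> (0 : R).
Proof.
apply/cvgNy_compNP; rewrite (_ : _ \o _ = fun u => - ratio (- a) u).
  suff : - ratio (- a) u @[u --> +oo] --> - (0 : R) by rewrite oppr0.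
  by apply: cvgN; exact: ratio_cvg.
by apply/funext => u /=; rewrite /ratio -mulNr; congr (_ / (_ + _)); ring.
Qed.

Lemma integral_lor_mul_diag a :
  (\int[mu]_t (lor s (t - a) * lor s (t - a))%:E = (pi * s / 2)%:E)%E.
Proof.
pose F u := 2^-1 * (s ^+ 2 * ratio a u + s * atan ((u - a) / s)).
have lim x : (2^-1 * (s ^+ 2 * 0 + x)) = x / 2 :> R by rewrite mulr0 add0r mulrC.
transitivity ((s * (pi / 2) / 2 - (- (s * (pi / 2)) / 2))%:E)%E; last by congr (_%:E); field.
apply: (@ge0_integral_derive _ (fun t => lor s (t - a) * lor s (t - a)) F).
- by move=> x; rewrite mulr_ge0// lor_ge0.
- exact: continuous_lor_mul.
- move=> x; have h := is_deriveMl 2^-1 (is_deriveD (is_deriveMl (s ^+ 2) (is_derive_ratio a x)) (is_derive_atan_lor a x)).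
  rewrite (_ : lor s (x - a) * lor s (x - a) = 2^-1 * (s ^+ 2 * ((s ^+ 2 - (x - a) ^+ 2) / (s ^+ 2 + (x - a) ^+ 2) ^+ 2) + lor s (x - a))).
    exact: h.
  by rewrite /lor; field; rewrite gt_eqF.
- rewrite -(lim (s * (pi / 2))); apply: cvgMl_tmp; apply: cvgD; last exact: (cvg_atan_lor a).1.
  by apply: cvgMl_tmp; exact: ratio_cvg.
- rewrite -(lim (- (s * (pi / 2)))); apply: cvgMl_tmp; apply: cvgD; last exact: (cvg_atan_lor a).2.
  by apply: cvgMl_tmp; exact: ratio_cvgN.
Qed.

Let cvg_ln_lorN a b :
  ln (s ^+ 2 + (u - a) ^+ 2) - ln (s ^+ 2 + (u - b) ^+ 2) @[u --> -oo] --> (0 : R).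
Proof.
apply/cvgNy_compNP; rewrite (_ : _ \o _ = fun u =>
  ln (s ^+ 2 + (u - (- a)) ^+ 2) - ln (s ^+ 2 + (u - (- b)) ^+ 2)); first exact: cvg_ln_lor.
by apply/funext => u /=; congr (ln (_ + _) - ln (_ + _)); ring.
Qed.

(** Partial fractions: the product is a combination of the two kernels and of the
logarithmic derivatives of their denominators, and the logarithms cancel at infinity. *)
Lemma integral_lor_mul a b : a != b ->
  (\int[mu]_t (lor s (t - a) * lor s (t - b))%:E =
   (2 * pi * s ^+ 3 / ((a - b) ^+ 2 + 4 * s ^+ 2))%:E)%E.
Proof.
move=> ab; have n0 : a - b != 0 by rewrite subr_eq0.
set n := a - b in n0 *.
have D0 : 0 < n ^+ 2 + 4 * s ^+ 2 by have := sqr_ge0 n; have := exprn_gt0 2 s0; lra.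
pose A := s ^+ 2 / (n ^+ 2 + 4 * s ^+ 2).
pose F u := A * (s ^+ 2 / n * (ln (s ^+ 2 + (u - b) ^+ 2) - ln (s ^+ 2 + (u - a) ^+ 2)) +
   (s * atan ((u - b) / s) + s * atan ((u - a) / s))).
have lim x : A * (s ^+ 2 / n * 0 + (x + x)) = 2 * A * x :> R by ring.
transitivity ((2 * A * (s * (pi / 2)) - 2 * A * (- (s * (pi / 2))))%:E)%E; last first.
  by congr (_%:E); rewrite /A; field; rewrite gt_eqF.
apply: (@ge0_integral_derive _ (fun t => lor s (t - a) * lor s (t - b)) F).
- by move=> x; rewrite mulr_ge0// lor_ge0.
- exact: continuous_lor_mul.
- move=> x; have h := is_deriveMl A (is_deriveD (is_deriveMl (s ^+ 2 / n)
    (is_deriveB (is_derive_ln_lor b x) (is_derive_ln_lor a x)))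
    (is_deriveD (is_derive_atan_lor b x) (is_derive_atan_lor a x))).
  rewrite (_ : lor s (x - a) * lor s (x - b) = A * (s ^+ 2 / n *
    (2 * (x - b) / (s ^+ 2 + (x - b) ^+ 2) - 2 * (x - a) / (s ^+ 2 + (x - a) ^+ 2)) +
    (lor s (x - b) + lor s (x - a)))).
    exact: h.
  have d1 := den_gt0 (x - a); have d2 := den_gt0 (x - b).
  have E : x - b = (x - a) + n by rewrite /n; ring.
  rewrite /A /lor; rewrite E in d2 *; field.
  by rewrite n0 !gt_eqF.
- rewrite -(lim (s * (pi / 2))); apply: cvgMl_tmp; apply: cvgD; first by apply: cvgMl_tmp; exact: cvg_ln_lor.
  by apply: cvgD; [exact: (cvg_atan_lor b).1|exact: (cvg_atan_lor a).1].
- rewrite -(lim (- (s * (pi / 2)))); apply: cvgMl_tmp; apply: cvgD; first by apply: cvgMl_tmp; exact: cvg_ln_lorN.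
  by apply: cvgD; [exact: (cvg_atan_lor b).2|exact: (cvg_atan_lor a).2].
Qed.

(** Convolving two Lorentz kernels doubles the width. *)
Lemma integral_lor_gram (k l : int) :
  (\int[mu]_t (lor s (t - k%:~R) * lor s (t - l%:~R))%:E =
   (pi * s / 2 * lor (2 * s) (k - l)%:~R)%:E)%E.
Proof.
have s2 := exprn_gt0 2 s0.
have [->|kl] := eqVneq k l.
  rewrite integral_lor_mul_diag subrr /lor expr0n/= addr0 divff ?mulr1//.
  by rewrite expf_neq0// mulf_neq0// gt_eqF.
rewrite integral_lor_mul ?eqr_int//; congr (_%:E); rewrite /lor intrB.
have := sqr_ge0 (k%:~R - l%:~R : R) => h.
by field; rewrite !gt_eqF//; lra.
Qed.

End Integrals.
End Lorentz.

(** * The symbol of the Lorentz samples *)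

Section LorentzForms.
Context {R : realType}.
Implicit Types (x y : R) (N : nat).

Definition sinhR y : R := (expR y - expR (- y)) / 2.
Definition coshR y : R := (expR y + expR (- y)) / 2.

Lemma coshR_ge1 y : 1 <= coshR y.
Proof.
rewrite /coshR ler_pdivlMr// mul1r expRN.
have e0 := expR_gt0 y; set z := expR y in e0 *.
rewrite -subr_ge0 (_ : z + z^-1 - 2 = (z - 1) ^+ 2 / z); last by field; rewrite gt_eqF.
by rewrite divr_ge0 ?sqr_ge0// ltW.
Qed.

Lemma coshR_double y : coshR (2 * y) = 1 + 2 * sinhR y ^+ 2.
Proof.
rewrite /coshR /sinhR -mulrN ![2 * _]mulr_natl !mulr2n !expRD.
have : expR y * expR (- y) = 1 by rewrite -expRD subrr expR0.
by move=> e; rewrite -[X in _ = X + _]e; field.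
Qed.

Lemma sinhRN y : sinhR (- y) = - sinhR y.
Proof. by rewrite /sinhR opprK; field. Qed.

Lemma sinhR_ge0 y : 0 <= y -> 0 <= sinhR y.
Proof.
move=> y0; rewrite divr_ge0// subr_ge0 ler_expR; lra.
Qed.

Lemma sinhR_gt0 y : 0 < y -> 0 < sinhR y.
Proof. by move=> y0; rewrite divr_gt0// subr_gt0 ltr_expR; lra. Qed.

Lemma sinhR_le y : 0 <= y -> sinhR y <= y * expR y.
Proof.
move=> y0; rewrite /sinhR ler_pdivrMr//.
have := expR_ge1Dx (- (2 * y)).
have e0 := expR_gt0 y.
have -> : expR (- (2 * y)) = expR (- y) / expR y.
  by rewrite -expRN -expRD; congr expR; ring.
rewrite ler_pdivlMr//; lra.
Qed.

(** With y = a / 2 it follows from y cos y <= sin y, that is, from the monotonicity of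
sin x - x cos x, and from 2 cos^2 y >= 1. *)
Lemma sin_ge_half (a : R) : 0 <= a -> a <= pi / 2 -> a / 2 <= sin a.
Proof.
move=> a0 a1; have p0 := @pi_gt0 R.
pose y := a / 2.
have h : y * cos y <= sin y.
  rewrite -subr_ge0.
  have := @ge0_derive_le R (fun x => sin x - x * cos x) (fun x => x * sin x) 0 y.
  rewrite sin0 mul0r subr0; apply.
  - by rewrite /y; lra.
  - move=> x.
    have := is_deriveB (is_derive_sin x) (is_deriveM (is_derive_id x (1 : R)) (is_derive_cos x)).
    rewrite (_ : cos x - _ = x * sin x)//.
    by rewrite /GRing.scale/=; ring.
  - move=> x /andP[x0 xy]; rewrite mulr_ge0// sin_ge0_pi// x0/=.
    by apply: (le_trans xy); rewrite /y; lra.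
have c0 : 0 <= cos a by rewrite cos_ge0_pihalf//; lra.
have cy : 0 <= cos y by rewrite cos_ge0_pihalf// /y; lra.
have aE : a = y + y by rewrite /y; field.
have ca : cos a = 2 * cos y ^+ 2 - 1.
  by rewrite aE cosD -!expr2 sin2cos2; ring.
have sa : sin a = 2 * (sin y * cos y) by rewrite aE sinD; ring.
have := ler_wpM2r cy h.
rewrite sa -/y; have y0 : 0 <= y by rewrite /y; lra.
have := mulr_ge0 y0 c0; rewrite ca; nra.
Qed.

Lemma cos_int2pi (k : int) : cos (k%:~R * (2 * pi)) = 1 :> R.
Proof.
have nat_case (n : nat) : cos (n%:R * (2 * pi)) = 1 :> R.
  have := periodicn (@cosD2pi R) n 0; rewrite add0r cos0 => e; rewrite -[RHS]e.
  by congr cos; rewrite -[RHS]mulr_natl -[pi *+ 2]mulr_natl.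
case: (intP k) => [|n|n]; first by rewrite mul0r cos0.
  exact: nat_case.
by rewrite mulrNz mulNr cosN nat_case.
Qed.

Section Fixed.
Variable s : R.
Hypothesis s0 : 0 < s.
Let sh := sinhR (s * pi).

Let sh_gt0 : 0 < sh.
Proof. by rewrite sinhR_gt0// mulr_gt0// pi_gt0. Qed.

(** The antiderivative of cosh (s (pi - x)) cos (k x); its increment over [0, 2 pi] shows
that the Lorentz samples are the Fourier coefficients of
pi s cosh (s (pi - x)) / sinh (s pi). *)
Let Wc (k : int) x := (- s * sinhR (s * (pi - x)) * cos (k%:~R * x) +
  k%:~R * coshR (s * (pi - x)) * sin (k%:~R * x)) / (s ^+ 2 + k%:~R ^+ 2).

Let den_gt0 (k : int) : 0 < s ^+ 2 + k%:~R ^+ 2 :> R.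
Proof. by have := sqr_ge0 (k%:~R : R); have := exprn_gt0 2 s0; lra. Qed.

Let is_derive_expR_lin (c x : R) : is_derive x 1 (fun x => expR (c * (pi - x))) (- c * expR (c * (pi - x))).
Proof.
have h1 : is_derive x 1 (fun x => c * (pi - x)) (c * -1).
  apply: is_deriveMl.
  have := is_deriveB (is_derive_cst (pi : R) x (1 : R)) (is_derive_id x (1 : R)).
  by rewrite sub0r.
have := @is_derive1_comp _ expR (fun x => c * (pi - x)) x _ _ (is_derive_expR _) h1.
by rewrite mulrN1 mulrC.
Qed.


Let is_derive_sinh x : is_derive x 1 (fun x => sinhR (s * (pi - x))) (- s * coshR (s * (pi - x))).
Proof.
have h := is_deriveMl 2^-1 (is_deriveB (is_derive_expR_lin s x) (is_derive_expR_lin (- s) x)).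
have -> : - s * coshR (s * (pi - x)) =
  2^-1 * (- s * expR (s * (pi - x)) - - - s * expR (- s * (pi - x))).
  by rewrite /coshR (mulNr s (pi - x)); field.
have -> // : (fun x => sinhR (s * (pi - x))) =
  (fun x => 2^-1 * (expR (s * (pi - x)) - expR (- s * (pi - x)))).
by apply/funext => u; rewrite /sinhR mulNr mulrC.
Qed.

Let is_derive_cosh x : is_derive x 1 (fun x => coshR (s * (pi - x))) (- s * sinhR (s * (pi - x))).
Proof.
have h := is_deriveMl 2^-1 (is_deriveD (is_derive_expR_lin s x) (is_derive_expR_lin (- s) x)).
have -> : - s * sinhR (s * (pi - x)) =
  2^-1 * (- s * expR (s * (pi - x)) + - - s * expR (- s * (pi - x))).
  by rewrite /sinhR (mulNr s (pi - x)); field.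
have -> // : (fun x => coshR (s * (pi - x))) =
  (fun x => 2^-1 * (expR (s * (pi - x)) + expR (- s * (pi - x)))).
by apply/funext => u; rewrite /coshR mulNr mulrC.
Qed.

Let is_derive_lin (k : int) x : is_derive x 1 (fun x => k%:~R * x : R) k%:~R.
Proof. by rewrite -[X in is_derive _ _ _ X]mulr1; exact: is_deriveMl. Qed.

Let is_derive_cosk (k : int) x :
  is_derive x 1 (fun x => cos (k%:~R * x)) (- k%:~R * sin (k%:~R * x)).
Proof.
have := @is_derive1_comp _ (@cos R) (fun x => k%:~R * x) x _ _ (is_derive_cos _) (is_derive_lin k x).
by rewrite mulNr mulrC -mulNr.
Qed.

Let is_derive_sink (k : int) x :
  is_derive x 1 (fun x => sin (k%:~R * x)) (k%:~R * cos (k%:~R * x)).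
Proof.
have := @is_derive1_comp _ (@sin R) (fun x => k%:~R * x) x _ _ (is_derive_sin _) (is_derive_lin k x).
by rewrite mulrC.
Qed.

Let is_derive_Wc (k : int) x : is_derive x 1 (Wc k) (coshR (s * (pi - x)) * cos (k%:~R * x)).
Proof.
have h := is_deriveMl (s ^+ 2 + k%:~R ^+ 2)^-1 (is_deriveD
  (is_deriveMl (- s) (is_deriveM (is_derive_sinh x) (is_derive_cosk k x)))
  (is_deriveMl k%:~R (is_deriveM (is_derive_cosh x) (is_derive_sink k x)))).
have d := den_gt0 k.
rewrite (_ : coshR _ * _ = (s ^+ 2 + k%:~R ^+ 2)^-1 *
  (- s * (sinhR (s * (pi - x)) * (- k%:~R * sin (k%:~R * x)) +
     cos (k%:~R * x) * (- s * coshR (s * (pi - x)))) +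
   k%:~R * (coshR (s * (pi - x)) * (k%:~R * cos (k%:~R * x)) +
     sin (k%:~R * x) * (- s * sinhR (s * (pi - x)))))); last by field; rewrite gt_eqF.
rewrite (_ : Wc k = fun x => (s ^+ 2 + k%:~R ^+ 2)^-1 *
  (- s * (sinhR (s * (pi - x)) * cos (k%:~R * x)) +
   k%:~R * (coshR (s * (pi - x)) * sin (k%:~R * x)))); first exact: h.
by apply/funext => u; rewrite /Wc mulrC !mulrA.
Qed.

Let Wc_diff (k : int) : Wc k (2 * pi) - Wc k 0 = 2 * sh / s * lor s k%:~R.
Proof.
have d := den_gt0 k; have s1 := s0.
rewrite /Wc cos_int2pi sin_int2pi !mulr0 cos0 sin0 !mulr0 !addr0 subr0.
have -> : s * (pi - 2 * pi) = - (s * pi) by ring.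
by rewrite sinhRN -/sh /lor; field; rewrite gt_eqF//= gt_eqF.
Qed.

Let p k : R := lor s k%:~R.
Let m := pi * s / sh.

Let p_even k : p (- k) = p k. Proof. by rewrite /p mulrNz lor_even. Qed.

(** The weight cosh (s (pi - x)) - 1 is nonnegative. *)
Lemma lor_coercive b N : m * psum (fun k => b k ^+ 2) N <= Form p b N.
Proof.
have := @Form_weight_ge0 R (fun x => coshR (s * (pi - x)) - 1)
  (fun k x => Wc k x - cosint k x) b N.
rewrite (@eq_Form _ _ (fun k => 2 * sh / s * p k - 2 * pi * delta k)); last first.
  by move=> k; rewrite -Wc_diff -cosint_2pi; ring.
rewrite FormB (FormZ (2 * sh / s) p) (FormZ (2 * pi) delta) Form_delta => h.
suff : 0 <= 2 * sh / s * Form p b N - 2 * pi * psum (fun k => b k ^+ 2) N.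
  rewrite subr_ge0 -(ler_pM2l (_ : 0 < s / (2 * sh))); last by rewrite divr_gt0// mulr_gt0.
  have s1 := s0; have h1 := sh_gt0.
  rewrite (_ : _ * (2 * pi * _) = m * psum (fun k => b k ^+ 2) N); last first.
    by rewrite /m; field; rewrite gt_eqF.
  by rewrite (_ : _ * (2 * sh / s * _) = Form p b N)//; field; rewrite !gt_eqF.
apply: h => [k x|x _]; last by rewrite subr_ge0 coshR_ge1.
rewrite mulrBl mul1r.
exact: (is_deriveB (is_derive_Wc k x) (is_derive_cosint k x)).
Qed.

(** The coefficients of 2 + 2 cos x, a nonnegative symbol vanishing at pi. *)
Let fejer k : R := 2 * delta k + delta (k + 1) + delta (k - 1).

(** The symbol vanishes at pi, so the form at the alternating sequence does not grow. *)
Let Form_fejer N : Form fejer sgn N = 2.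
Proof.
rewrite Form_sgn; elim: N => [|N IH].
  by rewrite /Form !psum0 !mul1r /fejer /delta /sgn subr0 /= mulr1 !addr0.
have ev k : sgn (- k) * fejer (- k) = sgn k * fejer k :> R.
  rewrite sgnN /fejer /delta; congr (_ * _).
  have -> : (- k == 0) = (k == 0) by lia.
  have -> : (- k + 1 == 0) = (k - 1 == 0) by lia.
  have -> : (- k - 1 == 0) = (k + 1 == 0) by lia.
  by rewrite addrAC.
rewrite (Form1S _ ev) IH (psum_even _ ev) big_ord_recl big1 ?addr0; last first.
  move=> i _; rewrite /fejer /delta.
  have -> : (Posz (lift ord0 i).+1 == 0) = false by [].
  have -> : (Posz (lift ord0 i).+1 + 1 == 0) = false by [].
  have -> : (Posz (lift ord0 i).+1 - 1 == 0) = false by rewrite lift0; lia.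
  by rewrite !mulr0 !addr0 mulr0.
by rewrite /fejer /delta /sgn /= expr0 expr1 !mulr0 !addr0; ring.
Qed.

(** Near pi both 1 + cos x and cosh (s (pi - x)) - 1 vanish to second order: with
a = (x - pi) / 2 they are 2 sin^2 a and 2 sinh^2 (s a), and |sinh (s a)| is at most a
constant times |sin a| on [-pi/2, pi/2]. *)
Let weight x : 0 <= x <= 2 * pi ->
  0 <= 4 * s ^+ 2 * expR (s * pi) ^+ 2 * (1 + cos x) + (1 - coshR (s * (pi - x))).
Proof.
move=> /andP[x0 x1]; have pi0 := @pi_gt0 R.
pose a := (x - pi) / 2.
have -> : x = 2 * a + pi by rewrite /a; field.
have -> : s * (pi - (2 * a + pi)) = 2 * (s * - a) by ring.
rewrite coshR_double cosDpi (mulr_natl a 2) cos_mulr2n.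
have -> : 1 - (cos a ^+ 2 *+ 2 - 1) = 2 * sin a ^+ 2.
  by rewrite sin2cos2; ring.
have key (y : R) : 0 <= y <= pi / 2 ->
  sinhR (s * y) ^+ 2 <= 4 * s ^+ 2 * expR (s * pi) ^+ 2 * sin y ^+ 2.
  move=> /andP[y0 y1]; have sy : 0 <= s * y by rewrite mulr_ge0// ltW.
  have -> : 4 * s ^+ 2 * expR (s * pi) ^+ 2 * sin y ^+ 2 =
    (2 * s * expR (s * pi) * sin y) ^+ 2 by ring.
  rewrite ler_sqr ?nnegrE.
  - apply: le_trans (sinhR_le sy) _.
    have h := sin_ge_half y0 y1.
    apply: (@le_trans _ _ (s * y * expR (s * pi))).
      by rewrite ler_wpM2l// ler_expR ler_wpM2l; [|exact: ltW|lra].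
    have -> : 2 * s * expR (s * pi) * sin y = s * (2 * sin y) * expR (s * pi) by ring.
    rewrite ler_wpM2r ?expR_ge0// ler_wpM2l; [by []|exact: ltW|lra].
  - exact: sinhR_ge0.
  - have := sin_ge_half y0 y1 => h.
    rewrite !mulr_ge0 ?expR_ge0//; [exact: ltW|lra].
have : sinhR (s * - a) ^+ 2 <= 4 * s ^+ 2 * expR (s * pi) ^+ 2 * sin a ^+ 2.
  have [a0|a0] := lerP 0 a.
    by rewrite mulrN sinhRN sqrrN; apply: key; rewrite a0/= /a; lra.
  rewrite -[sin a]opprK -sinN sqrrN; apply: key.
  by rewrite oppr_ge0 (ltW a0)/= /a; lra.
lra.
Qed.

(** Adding a multiple of 1 + cos x makes 1 - cosh (s (pi - x)) nonnegative without
changing the symbol at pi, so the value there is at most m; the converse is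
coercivity. *)
Lemma lor_symbol_pi : zsum (fun k => sgn k * p k) = m.
Proof.
have a := asum_lor s0; have s1 := s0; have h1 := sh_gt0.
apply/eqP; rewrite eq_le; apply/andP; split; last first.
  by apply: coercive_le_symbol_pi => // b N; exact: lor_coercive.
set C := 4 * s ^+ 2 * expR (s * pi) ^+ 2.
pose E k := 2 * sh / s * (sgn k * p k) - 2 * pi * delta k.
have aE1 : asum (fun k => 2 * sh / s * (sgn k * p k)) by apply: asumZ; exact: asum_sgnM.
have aE2 : asum (fun k => 2 * pi * delta k : R) by apply: asumZ; exact: asum_delta.
have : zsum E <= 0.
  apply: (@Form1_bounded_zsum_le0 _ _ (C * pi * 2)).
  - by move=> k; rewrite /E sgnN p_even /delta oppr_eq0.
  - exact: asumB.
  move=> N.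
  have EE k : E k = sgn k * (2 * sh / s * p k - 2 * pi * delta k).
    rewrite /E mulrBr mulrCA; congr (_ - _).
    by rewrite /delta; case: eqVneq => [->|]; rewrite ?mulr0// /sgn expr0 mul1r.
  rewrite (eq_Form _ _ EE) -Form_sgn -[X in _ <= _ * X](Form_fejer N) -FormZ -subr_ge0 -FormB.
  have := @Form_weight_ge0 R (fun x => C * (1 + cos x) + (1 - coshR (s * (pi - x))))
    (fun k x => C / 2 * (2 * cosint k x + cosint (k + 1) x + cosint (k - 1) x) + (cosint k x - Wc k x)) sgn N.
  set F1 := Form _ _ _; set F2 := Form _ _ _.
  have -> : F1 = F2.
    apply: eq_Form => k; rewrite /fejer.
    have := cosint_2pi k (R := R); have := cosint_2pi (k + 1) (R := R).
    have := cosint_2pi (k - 1) (R := R); have := Wc_diff k; rewrite -/(p k).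
    set d0 := delta k; set d1 := delta (k + 1); set d2 := delta (k - 1).
    move=> e1 e2 e3 e4.
    rewrite (_ : C * pi * _ = C / 2 * (2 * (2 * pi * d0) + 2 * pi * d1 + 2 * pi * d2)); last by field.
    by rewrite -e1 -e2 -e3 -e4; ring.
  apply => [k x|x /weight//].
  rewrite [X in is_derive _ _ _ X](_ : _ = C / 2 * (2 * cos (k%:~R * x) +
     cos ((k + 1)%:~R * x) + cos ((k - 1)%:~R * x)) +
     (cos (k%:~R * x) - coshR (s * (pi - x)) * cos (k%:~R * x))); last first.
    by rewrite intrD intrB (mulrDl k%:~R) (mulrBl x k%:~R) mul1r cosD cosB; field.
  have i0 := is_derive_cosint k x; have i1 := is_derive_cosint (k + 1) x.
  have i2 := is_derive_cosint (k - 1) x.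
  have i3 := is_derive_Wc k x.
  exact: (is_deriveD (is_deriveMl (C / 2) (is_deriveD (is_deriveD
    (is_deriveMl 2 i0) i1) i2)) (is_deriveB i0 i3)).
rewrite /E zsumB// zsumZ ?zsum_deltaM; last exact: asum_sgnM.
rewrite subr_le0 /m => h.
rewrite ler_pdivlMr//; move: h; rewrite mulrAC ler_pdivrMr//.
lra.
Qed.

End Fixed.

End LorentzForms.

(** * The Lorentz system *)

Section LorentzConstants.
Context {R : realType}.
Implicit Types (b u : int -> R) (N : nat) (k l : int).
Local Open Scope complex_scope.

Variable s : R.
Hypothesis s0 : 0 < s.

Let p k : R := lor s k%:~R.
Let q k : R := lor (2 * s) k%:~R.
Let S0 := zsum p.
Let T := pi * s / S0.
Let m := pi * s / sinhR (s * pi).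
Let g k := pi * s / 2 * q k.

Let p_sum : asum p. Proof. exact: asum_lor. Qed.
Let q_sum : asum q. Proof. by apply: asum_lor; rewrite mulr_gt0. Qed.
Let p_even k : p (- k) = p k. Proof. by rewrite /p mulrNz lor_even. Qed.
Let q_even k : q (- k) = q k. Proof. by rewrite /q mulrNz lor_even. Qed.
Let ps_gt0 : 0 < pi * s. Proof. by rewrite mulr_gt0// pi_gt0. Qed.
Let m_gt0 : 0 < m. Proof. by rewrite divr_gt0// sinhR_gt0// mulrC. Qed.

Let S0_gt0 : 0 < S0.
Proof.
apply: (@lt_le_trans _ _ (psum p 0)).
  by rewrite psum0 /p lor0.
by apply: ge0_psum_le => // k; exact: lor_ge0.
Qed.

Let T_gt0 : 0 < T. Proof. by rewrite divr_gt0. Qed.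

(** The family l p(l) is not absolutely summable: only its symmetric partial sums are
under control, whence the detour through vanishing. *)
Let vanishing_mul_lor : vanishing (fun l => l%:~R * p l).
Proof.
have h : (n%:R * p n%:Z : R) @[n --> \oo] --> (0 : R).
  apply: (@squeeze_cvgr _ _ _ _ (fun=> 0) (fun n => 2 * s ^+ 2 * harmonic n)).
  - apply: nearW => n; rewrite mulr_ge0 ?lor_ge0//=.
    have sn : 0 < s ^+ 2 + n%:R ^+ 2 by have := exprn_gt0 2 s0; have := sqr_ge0 (n%:R : R); lra.
    rewrite /p /lor -[n%:~R]/(n%:R : R) mulrA ler_pdivrMr// mulrAC.
    rewrite ler_pdivlMr ?ltr0n// -[n.+1%:R]natr1.
    have [->|n0] := posnP n.
      rewrite !mul0r; apply: mulr_ge0; first by rewrite mulr_ge0 ?sqr_ge0.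
      by rewrite addr_ge0 ?sqr_ge0.
    have n1 : 1 <= n%:R :> R by rewrite ler1n.
    have s2 := exprn_gt0 2 s0; rewrite mulrAC [leRHS]mulrAC ler_pM2r//.
    set x := n%:R in n1 *; nra.
  - exact: cvg_cst.
  - rewrite -[X in _ --> X](mulr0 (2 * s ^+ 2)); apply: cvgMl_tmp; exact: cvg_harmonic.
split => //; apply: (@eq_cvgn _ (fun n => - (n%:R * p n%:Z))).
  by move=> n; rewrite p_even mulrNz mulNr.
by rewrite -[X in _ --> X]oppr0; apply: cvgN.
Qed.

Let psum_mul_lor N : psum (fun l => l%:~R * p l) N = 0.
Proof.
elim: N => [|N IH]; first by rewrite psum0 mul0r.
by rewrite psumS IH p_even mulrNz mulNr add0r subrr.
Qed.

(** Partial fractions: p (n - l) * p l equals q n / 4 * (h l + h (n - l)), where h l is p l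
plus a multiple of the odd family l * p l. The odd part has zero symmetric sums, and
reflecting l into n - l does not change the sum of h. *)
Lemma zconv_lor n : n != 0 -> zconv p p n = q n / 2 * S0.
Proof.
move=> n0; have nR : n%:~R != 0 :> R by rewrite intr_eq0.
(* one of the two partial fractions; the other is its reflection under l |-> n - l *)
pose h l := 2 / n%:~R * (l%:~R * p l) + p l.
have vh : vanishing h.
  have [v1 v2] := vanishing_mul_lor; have [w1 w2] := asum_cvg0 p_sum.
  split; rewrite -[X in _ --> X](addr0 0) -[X in _ --> X + _](mulr0 (2 / n%:~R));
    apply: cvgD => //; exact: cvgMl_tmp.
have ch : psum h N @[N --> \oo] --> S0.
  apply: (@eq_cvgn _ (psum p)); last exact: asum_cvg.
  by move=> N; rewrite psumD [in RHS]psumZ psum_mul_lor mulr0 add0r.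
have ch' : psum (fun l => h (n - l)) N @[N --> \oo] --> S0.
  apply: (@eq_cvgn _ (psum (fun l => h (l + n)))); last exact: psum_shift_cvg.
  by move=> N; rewrite -psum_opp; apply: eq_psum => l; congr h; rewrite addrC.
apply: zsum_eq.
have s2 : 0 < s ^+ 2 by rewrite exprn_gt0.
apply: (@eq_cvgn _ (fun N => q n / 4 * (psum h N + psum (fun l => h (n - l)) N))).
  move=> N; rewrite -psumD -psumZ; apply: eq_psum => l.
  rewrite /h /q /p /lor intrB.
  have d1 : s ^+ 2 + l%:~R ^+ 2 != 0 :> R by rewrite gt_eqF// ltr_wpDr// sqr_ge0.
  have d2 : s ^+ 2 + (n%:~R - l%:~R) ^+ 2 != 0 :> R by rewrite gt_eqF// ltr_wpDr// sqr_ge0.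
  have d3 : (2 * s) ^+ 2 + n%:~R ^+ 2 != 0 :> R.
    by rewrite gt_eqF// exprMn ltr_wpDr ?sqr_ge0// mulr_gt0.
  by field; rewrite nR d1 d2 d3.
rewrite (_ : q n / 2 * S0 = q n / 4 * (S0 + S0)); last by field.
by apply: cvgMl_tmp; apply: cvgD.
Qed.

(** The defect at n = 0 of the proportionality between g and the autocorrelation. *)
Let kappa := T * zconv p p 0 - pi * s / 2.

Let gramE k : g k = T * zconv p p k - kappa * delta k.
Proof.
rewrite /delta; have [->|k0] := eqVneq k 0.
  have -> : g 0 = pi * s / 2 by rewrite /g /q lor0 ?mulr_gt0// mulr1.
  rewrite /kappa mulr1; ring.
by rewrite mulr0 subr0 zconv_lor// /g /T; have S1 := S0_gt0; field; rewrite gt_eqF.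
Qed.

Let g_sum : asum g. Proof. exact: asumZ. Qed.

(** Adding the value at pi keeps the even indices twice, and at an even integer 2 k the
kernel of width 2 s takes the value of the kernel of width s at k. *)
Let zsum_lor_double : zsum q + zsum (fun k => sgn k * q k) = 2 * S0.
Proof.
rewrite -zsumD//; last exact: asum_sgnM.
rewrite -zsum_even_odd; last by apply: asumD => //; exact: asum_sgnM.
rewrite (_ : zsum (fun k => _ + _ * q (2 * k - 1)) = 0); last first.
  apply: zsum_eq; apply: (@eq_cvgn _ (fun=> 0)); last exact: cvg_cst.
  move=> N; rewrite -[LHS](mul0r (psum p N)) -psumZ; apply: eq_psum => k.
  rewrite (_ : sgn _ = -1) ?mulN1r ?subrr ?mul0r//.
  by rewrite /sgn -signr_odd (_ : odd _ = true) ?expr1//; lia.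
rewrite addr0 -zsumZ//; apply: eq_zsum => k.
rewrite (_ : sgn _ = 1); last by rewrite /sgn -signr_odd (_ : odd _ = false)//; lia.
transitivity (2 * q (2 * k)); first by ring.
congr (_ * _).
rewrite /q /p /lor intrM -[2%:~R]/(2 : R) !exprMn -mulrDr.
by rewrite -mulf_div divff ?mul1r// expf_neq0.
Qed.

Let symbol_pi : zsum (fun k => sgn k * p k) = m.
Proof. exact: lor_symbol_pi. Qed.

Let zsum_gram : zsum g = T * S0 ^+ 2 - kappa.
Proof.
under eq_zsum do rewrite gramE.
have a := asum_zconv p_sum p_sum.
rewrite zsumB; [|exact: asumZ|exact/asumZ/asum_delta].
by rewrite zsum_deltaM zsumZ// zsum_zconv// expr2.
Qed.

Let zsum_sgn_gram : zsum (fun k => sgn k * g k) = T * m ^+ 2 - kappa.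
Proof.
have a := asum_sgnM (asum_zconv p_sum p_sum).
rewrite (@eq_zsum _ _ (fun k => T * (sgn k * zconv p p k) - kappa * delta k)); last first.
  move=> k; rewrite gramE mulrBr mulrCA; congr (_ - _).
  by rewrite /delta; case: eqVneq => [->|]; rewrite ?mulr0// /sgn expr0 mul1r.
rewrite zsumB; [|exact: asumZ|exact/asumZ/asum_delta].
by rewrite zsum_deltaM zsumZ// zsum_sgn_autocorr// symbol_pi.
Qed.

(** Compare the values at 0 and at pi of G = T P^2 - kappa; their sum is known by
zsum_lor_double. *)
Let kappaE : kappa = T * m ^+ 2 / 2.
Proof.
have S1 := S0_gt0.
have : zsum g + zsum (fun k => sgn k * g k) = T * S0 ^+ 2.
  have -> : zsum (fun k => sgn k * g k) = pi * s / 2 * zsum (fun k => sgn k * q k).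
    rewrite -zsumZ; last exact: asum_sgnM.
    by apply: eq_zsum => k; rewrite mulrCA.
  by rewrite (zsumZ _ q_sum) -mulrDr zsum_lor_double /T; field; rewrite gt_eqF.
rewrite zsum_gram zsum_sgn_gram; lra.
Qed.

Let lor_autocorr_coercive b N :
  m ^+ 2 * psum (fun k => b k ^+ 2) N <= Form (zconv p p) b N.
Proof. apply: autocorr_coercive => // b' N'; exact: lor_coercive. Qed.

Let Form_gram b N :
  Form g b N = T * Form (zconv p p) b N - kappa * psum (fun k => b k ^+ 2) N.
Proof. by rewrite (eq_Form _ _ gramE) FormB !FormZ Form_delta. Qed.

Let lower_form b N : T / 2 * Form (zconv p p) b N <= Form g b N.
Proof.
rewrite Form_gram kappaE.
have := ler_wpM2l (ltW T_gt0) (lor_autocorr_coercive b N); lra.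
Qed.

Let upper_form b N : Form g b N <= T * Form (zconv p p) b N.
Proof.
rewrite Form_gram kappaE lerBlDr lerDl mulr_ge0//.
  by rewrite mulr_ge0// mulr_ge0 ?sqr_ge0// ltW.
by apply: psum_ge0 => k; exact: sqr_ge0.
Qed.

Let T2_gt0 : 0 < T / 2. Proof. by rewrite divr_gt0. Qed.
Let g_even k : g (- k) = g k. Proof. by rewrite /g q_even. Qed.

(** At pi the quotient G / P^2 = T - kappa / P^2 equals T / 2, the bound of lower_form. *)
Lemma lor_lower_constant :
  lower_riesz_constant (integer_shifts (nod_function (fun t => (lor s t)%:C%C))) =
  pi * s / (2 * zsum (fun k => lor s k%:~R)).
Proof.
have S1 := S0_gt0; have m1 := m_gt0.
have := @lower_nod_constant R (lor s) (1 + s ^+ 2) g (continuous_lor s0) (lor_even _)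
  (lor_ge0 s0) (lor_le s0) (integral_lor_gram s0) m (T / 2) T m_gt0 (lor_coercive s0)
  T2_gt0 lower_form upper_form g_even g_sum.
rewrite -/p symbol_pi zsum_sgn_gram kappaE.
have -> : (T * m ^+ 2 - T * m ^+ 2 / 2) / m ^+ 2 = T / 2 by field; rewrite gt_eqF.
move=> h; rewrite -/S0 (_ : _ / (2 * S0) = T / 2); last by rewrite /T; field; rewrite gt_eqF.
by apply/esym/eqP; rewrite eq_le.
Qed.

Lemma lor_upper_constant :
  pi * s / 2 * zsum (fun k => lor (2 * s) k%:~R) / zsum (fun k => lor s k%:~R) ^+ 2 <=
  upper_riesz_constant (integer_shifts (nod_function (fun t => (lor s t)%:C%C)))
  <= pi * s / zsum (fun k => lor s k%:~R).
Proof.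
have := @upper_nod_constant R (lor s) (1 + s ^+ 2) g (continuous_lor s0) (lor_even _)
  (lor_ge0 s0) (lor_le s0) (integral_lor_gram s0) m (T / 2) T m_gt0 (lor_coercive s0)
  T2_gt0 lower_form upper_form g_even g_sum.
by rewrite /g zsumZ.
Qed.

Lemma zsum_lor_near : `|zsum (fun k => lor s k%:~R) - pi * s| <= 1.
Proof.
have := @sum_vs_integral R (lor s) (pi * s) (lor_ge0 s0) (continuous_lor s0) (lor_even _)
  (lor_nonincreasing s0) (integral_lor s0) p_sum.
by rewrite lor0.
Qed.

End LorentzConstants.

(** * Passage to the limit *)

Section Limits.
Context {R : realType}.
Implicit Types (f : R -> R) (l C y S x : R).

Lemma cvg_pinfty_rate f l C :
  (forall x, 2 <= x -> `|f x - l| <= C / x) -> f x @[x --> +oo%R] --> l.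
Proof.
move=> fl; have C0 : 0 <= C.
  by have := le_trans (normr_ge0 _) (fl 2 (lexx _)); rewrite ler_pdivlMr// mul0r.
apply/cvgrPdist_le => e e0; near=> x.
have x2 : 2 <= x by near: x; apply: nbhs_pinfty_ge; exact: num_real.
have xC : C / e <= x by near: x; apply: nbhs_pinfty_ge; exact: num_real.
rewrite distrC; apply: le_trans (fl x x2) _.
by rewrite ler_pdivrMr; [rewrite mulrC -ler_pdivrMr|lra].
Unshelve. all: by end_near. Qed.

Lemma ratio_near y S : 2 <= y -> `|S - y| <= 1 -> `|y / S - 1| <= 2 / y.
Proof.
move=> y2; rewrite ler_norml => /andP[S1 S2].
have S0 : 0 < S by lra.
have y0 : 0 < y by lra.
rewrite (_ : y / S - 1 = (y - S) / S); last by field; rewrite gt_eqF.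
rewrite normrM (gtr0_norm (_ : 0 < S^-1)) ?invr_gt0// ler_pdivrMr// mulrAC ler_pdivlMr//.
have : `|y - S| <= 1 by rewrite ler_norml; lra.
move=> h; have := ler_wpM2r (ltW y0) h; lra.
Qed.

Lemma le_rate C y x : 0 <= C -> 0 < x -> x <= y -> C / y <= C / x.
Proof.
by move=> C0 x0 xy; rewrite ler_wpM2l// lef_pV2 ?posrE//; exact: lt_le_trans xy.
Qed.

(** The situation common to both families: y is the integral of a unimodal function with
maximum 1 and S the corresponding unit-step sum. The lower bound lo is G(0) / P(0)^2;
6 is large enough for the error terms of both families. *)
Lemma lower_upper_rate (A B lo y S x : R) : 2 <= x -> x <= y -> `|S - y| <= 1 ->
  A = y / (2 * S) -> lo <= B <= y / S -> 1 - 6 / y <= lo ->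
  `|A - 1 / 2| <= 6 / x /\ `|B - 1| <= 6 / x.
Proof.
move=> x2 xy Sy AE /andP[B1 B2] Blo.
have y2 : 2 <= y by lra.
have := ratio_near y2 Sy.
have S0 : 0 < S by move: Sy; rewrite ler_norml => /andP[]; lra.
have h6 : 6 / y <= 6 / x by apply: le_rate; lra.
have h2 : 2 / y <= 6 / y by rewrite ler_wpM2r ?invr_ge0; lra.
have h0 : 0 <= 2 / y by rewrite divr_ge0; lra.
rewrite AE (_ : y / (2 * S) = y / S / 2); last by field; rewrite gt_eqF.
by rewrite !ler_norml => /andP[r1 r2]; lra.
Qed.

Lemma lor_rate (s : R) : 2 <= s ->
  `|lower_riesz_constant (integer_shifts (nod_function (fun t => (lor s t)%:C%C))) - 1 / 2|
    <= 6 / s /\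
  `|upper_riesz_constant (integer_shifts (nod_function (fun t => (lor s t)%:C%C))) - 1|
    <= 6 / s.
Proof.
move=> s2; have s0 : 0 < s by lra.
have sy : s <= pi * s by rewrite ler_peMl ?(ltW s0)//; have := @pi_ge2 R; lra.
have near1 := zsum_lor_near s0.
apply: (lower_upper_rate s2 sy near1 (lor_lower_constant s0) (lor_upper_constant s0)).
have s20 : 0 < 2 * s by lra.
have := zsum_lor_near s20; move: near1.
set y := pi * s in sy *; set S1 := zsum _; set S2 := zsum _.
rewrite (_ : pi * (2 * s) = 2 * y); last by rewrite /y; ring.
rewrite !ler_norml => /andP[a1 a2] /andP[b1 b2].
have y0 : 0 < y by lra.
apply: (@le_trans _ _ (y / 2 * (2 * y - 1) / (y + 1) ^+ 2)).
  rewrite ler_pdivlMr ?exprn_gt0//; last by lra.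
  rewrite -(ler_pM2r y0) (_ : _ * _ * y = (y - 6) * (y + 1) ^+ 2); last first.
    by field; rewrite gt_eqF.
  nra.
have S10 : 0 < S1 by lra.
apply: ler_pM.
- by rewrite mulr_ge0//; lra.
- by rewrite invr_ge0 sqr_ge0.
- by rewrite ler_wpM2l//; lra.
- rewrite lef_pV2 ?posrE ?exprn_gt0//; last by lra.
  by rewrite lerXn2r ?nnegrE//; lra.
Qed.

Lemma gauss_rate (s : R) : 2 <= s ->
  `|lower_riesz_constant (integer_shifts (nod_function
      (fun t => (gauss (2 * s ^+ 2) t)%:C%C))) - 1 / 2| <= 6 / s /\
  `|upper_riesz_constant (integer_shifts (nod_function
      (fun t => (gauss (2 * s ^+ 2) t)%:C%C))) - 1| <= 6 / s.
Proof.
move=> s2; set c := 2 * s ^+ 2; have s0 : 0 < s by lra.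
have c0 : 0 < c by rewrite mulr_gt0// exprn_gt0.
have c20 : 0 < 2 * c by rewrite mulr_gt0.
pose I := Num.sqrt (c / 2 * pi).
have pi1 := @pi_ge2 R.
have I0 : 0 <= I := sqrtr_ge0 _.
have Isqr : I ^+ 2 = c / 2 * pi by rewrite sqr_sqrtr// mulr_ge0 ?pi_ge0// divr_ge0// ltW.
have sI : s <= I.
  rewrite -ler_sqr ?nnegrE ?(ltW s0)// Isqr /c.
  by have := exprn_gt0 2 s0; nra.
have E2I : Num.sqrt (2 * c * pi) = 2 * I.
  rewrite (_ : 2 * c * pi = (2 * I) ^+ 2); last by rewrite exprMn Isqr; field.
  by rewrite sqrtr_sqr ger0_norm// mulr_ge0.
have near1 := gsum_near c20; rewrite E2I in near1.
have near2 := gsum_near c0.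
have qq : expR (- (2 * c)^-1) ^+ 2 = expR (- c^-1) :> R.
  by rewrite expr2 -expRD; congr expR; field; rewrite gt_eqF.
have := gauss_upper_constant c0; rewrite qq => up.
have y2 : s <= 2 * I by lra.
apply: (lower_upper_rate s2 y2 near1 _ up).
  rewrite gauss_lower_constant// -/I.
  have E0 : 0 < gsum (expR (- (2 * c)^-1)).
    by move: near1; rewrite ler_norml => /andP[]; lra.
  by field; rewrite gt_eqF.
move: near1 near2; set E := gsum _; set M := gsum _; set w := Num.sqrt (c * pi).
have w0 : 0 <= w := sqrtr_ge0 _.
have wsqr : w ^+ 2 = 2 * I ^+ 2.
  by rewrite Isqr sqr_sqrtr; [field|rewrite mulr_ge0 ?pi_ge0// ltW].
have wI : w <= 2 * I.
  by rewrite -ler_sqr ?nnegrE ?mulr_ge0// wsqr exprMn; have := sqr_ge0 I; lra.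
rewrite !ler_norml => /andP[a1 a2] /andP[b1 b2]; rewrite -/I.
have Iw : I <= w by rewrite -ler_sqr ?nnegrE// wsqr; have := sqr_ge0 I; lra.
apply: (@le_trans _ _ (I * (2 * I - 1) / (w + 1) ^+ 2)).
  rewrite ler_pdivlMr ?exprn_gt0//; last by lra.
  have I1 : 0 < I by lra.
  rewrite -(ler_pM2r I1) (_ : _ * _ * I = (I - 3) * (w + 1) ^+ 2); last first.
    by field; rewrite gt_eqF.
  have [I3|I3] := lerP I 3.
    apply: (@le_trans _ _ 0).
      by rewrite mulr_le0_ge0 ?sqr_ge0//; lra.
    by rewrite !mulr_ge0//; lra.
  apply: (@le_trans _ _ ((I - 3) * (2 * I ^+ 2 + 4 * I + 1))).
    rewrite ler_wpM2l//; first by lra.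
    rewrite sqrrD1 wsqr -mulr_natl; lra.
  nra.
have M0 : 0 < M by lra.
apply: ler_pM.
- by rewrite mulr_ge0//; lra.
- by rewrite invr_ge0 sqr_ge0.
- by rewrite ler_wpM2l//; lra.
- rewrite lef_pV2 ?posrE ?exprn_gt0//; last by lra.
  by rewrite lerXn2r ?nnegrE//; lra.
Qed.

End Limits.

Theorem theorem3 (R : realType) :
  (A_G sigma @[sigma --> +oo%R] --> (1 / 2 : R) /\
   A_L sigma @[sigma --> +oo%R] --> (1 / 2 : R)) /\
  (B_G sigma @[sigma --> +oo%R] --> (1 : R) /\
   B_L sigma @[sigma --> +oo%R] --> (1 : R)).
Proof.
split; split; apply: (@cvg_pinfty_rate _ _ _ 6) => s s2.
- exact: (gauss_rate s2).1.
- exact: (lor_rate s2).1.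
- exact: (gauss_rate s2).2.
- exact: (lor_rate s2).2.
Qed.
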